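(* Let $n\ge 1$, let $\mathbf i\in\Sigma_{n+1}$ be a reduced word of the longest element $w_0$ of $\mathfrak S_{n+1}$, and let $\lambda=\lambda_1\varpi_1+\cdots+\lambda_n\varpi_n$ be a regular dominant integral weight (all $\lambda_i$ positive integers). The following are equivalent: (1) the string polytope $\Delta_{\mathbf i}(\lambda)$ is unimodularly equivalent to the Gelfand–Cetlin polytope $GC(\lambda)$; (2) $\Delta_{\mathbf i}(\lambda)$ has exactly $n(n+1)$ facets; (3) the string cone $C_{\mathbf i}$ is simplicial; (4) there exists $(\sigma_1,\dots,\sigma_n)\in\{A,D\}^n$ such that $\mathrm{ind}_{\sigma_k}\big(C_{\sigma_{k+1}}\circ\cdots\circ C_{\sigma_n}(\mathbf i)\big)=0$ for all $k=n,n-1,\dots,1$ (for $k=n$ this reads $\mathrm{ind}_{\sigma_n}(\mathbf i)=0$).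
   Context: $N=n(n+1)/2$. $s_i=(i,i+1)\in\mathfrak S_{n+1}$; $\Sigma_{n+1}$ is the set of $\mathbf i=(i_1,\dots,i_N)\in[n]^N$ with $w_0=s_{i_1}\cdots s_{i_N}$. Wiring diagram $G(\mathbf i)$: $n+1$ wires $\ell_1,\dots,\ell_{n+1}$ run from top to bottom through positions $1,\dots,n+1$ (left to right); at the top $\ell_k$ is in position $k$. Reading the diagram from top to bottom, the $j$-th crossing (node) $t_j$ swaps the two wires currently in positions $i_j,i_j+1$ (the node lies in column $i_j$). Every two wires cross exactly once; at the bottom $\ell_k$ is in position $n+2-k$ and ends at its lower end $L_k$. The symbol $t_j$ also denotes the $j$-th coordinate of $\mathbb R^N$. Rigorous paths: for $k\in[n]$, $G(\mathbf i,k)$ is $G(\mathbf i)$ with $\ell_1,\dots,\ell_k$ oriented upward and $\ell_{k+1},\dots,\ell_{n+1}$ downward. A rigorous path in $G(\mathbf i,k)$ starts at $L_k$, ends at $L_{k+1}$, moves along wires in their orientation, may switch from one wire to the other only at the node where they cross, passes each node at most once, and never passes straight (without switching) through the node $\ell_a\cap\ell_b$ while travelling on $\ell_a$ when both wires are oriented downward with $a>b$, or both upward with $a<b$. $\mathcal{GP}(\mathbf i)$ is the set of all rigorous paths (all $k$). String inequality of a rigorous path $P$: $\sum_j a_jt_j\ge 0$, where $a_j=1$ if $P$ switches at $t_j$ from $\ell_r$ to $\ell_s$ with $r<s$, $a_j=-1$ if it switches with $r>s$, and $a_j=0$ if $P$ does not switch at $t_j$. The string cone $C_{\mathbf i}\subset\mathbb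 R^N$ is the set of points satisfying all string inequalities. $C_{\mathbf i}$ is simplicial if it has exactly $N$ facets. $\lambda=\sum\lambda_i\varpi_i$ ($\varpi_i$ fundamental weights of $\mathfrak{sl}_{n+1}$) is dominant if all $\lambda_i\ge0$, integral if all $\lambda_i\in\mathbb Z$, regular if all $\lambda_i\neq0$. The $\lambda$-inequality of node $t_j$ is $t_j\le\lambda_{i_j}+\sum_{k>j}a_kt_k$ with $a_k=1$ if $|i_k-i_j|=1$, $a_k=-2$ if $i_k=i_j$, $a_k=0$ otherwise. The string polytope $\Delta_{\mathbf i}(\lambda)$ is the set of points of $\mathbb R^N$ satisfying all string inequalities and all $N$ $\lambda$-inequalities. Gelfand–Cetlin polytope $GC(\lambda)\subset\mathbb R^N$ (coordinates $x_{k,j}$, $1\le j\le k\le n$): all $x$ with $x_{k+1,j}\ge x_{k,j}\ge x_{k+1,j+1}$ for $1\le j\le k\le n$, where $x_{n+1,j}:=\lambda_j+\cdots+\lambda_n$ and $x_{n+1,n+1}:=0$. Two polyhedra in $\mathbb R^N$ are unimodularly equivalent if an affine map $x\mapsto Mx+v$ with $M\in GL_N(\mathbb Z)$, $v\in\mathbb Z^N$ maps one onto the other. Indices and contractions: a 2-move exchanges adjacent letters $i,j$ with $|i-j|>1$; $\sim$ is the equivalence relation generated by 2-moves. $D_n=(n,n-1,\dots,1)$, $A_n=(1,2,\dots,n)$. Every $\mathbf i\in\Sigma_{n+1}$ satisfies $\mathbf i\sim\mathbf i_D^-\,D_n\,\mathbf i_D^+$ and $\mathbf i\sim\mathbf i_A^-\,A_n\,\mathbf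 i_A^+$ (concatenations) for some words $\mathbf i_D^\pm,\mathbf i_A^\pm$; $\mathrm{ind}_D(\mathbf i):=|\mathbf i_D^+|$ and $\mathrm{ind}_A(\mathbf i):=|\mathbf i_A^+|$ (lengths; independent of choices). For a word $\mathbf w$, $\mathbf w\pm1$ adds $\pm1$ to every letter. Contractions $C_D(\mathbf i):=\mathbf i_D^-(\mathbf i_D^+-1)\in\Sigma_n$ and $C_A(\mathbf i):=(\mathbf i_A^--1)\mathbf i_A^+\in\Sigma_n$ (well defined up to $\sim$; the wiring diagram of $C_D(\mathbf i)$ is $G(\mathbf i)$ with $\ell_{n+1}$ deleted, that of $C_A(\mathbf i)$ is $G(\mathbf i)$ with $\ell_1$ deleted and wires relabeled). Indices are invariant under $\sim$. $\Sigma_2=\{(1)\}$ and both indices of $(1)$ are $0$. *)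

(* Defs.v *)
From HB Require Import structures.
From mathcomp Require Import all_boot all_order all_algebra all_fingroup.
Set Implicit Arguments. Unset Strict Implicit. Unset Printing Implicit Defensive.
Import Order.TTheory GRing.Theory Num.Theory.

Definition NN (n : nat) : nat := (n * n.+1)./2.

(* ---------- reduced words of w0 in S_{n+1} ----------
   Words are seq nat with letters in [1,n]; s_a = (a, a+1) acts on the
   0-based positions a-1, a of 'I_(n+1). *)
Definition sgen (n a : nat) : 'S_n.+1 := tperm (inord a.-1) (inord a).
Definition w0perm (n : nat) : 'S_n.+1 := perm (@rev_ord_inj n.+1).
Definition reduced_w0 (n : nat) (w : seq nat) : Prop :=
  [/\ size w = NN n, all (fun a => (0 < a <= n)%N) w &
      foldr (fun a p => (sgen n a * p)%g) 1%g w = w0perm n].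

(* ---------- wiring diagram ----------
   conf n w t : the wire labels (1..n+1) in positions 1..n+1 (list index 0..n)
   just before the node t (0-based node index, t = 0..N-1). *)
Definition swap_pos (c : seq nat) (p q : nat) : seq nat :=
  [seq nth 0 c (if k == p then q else if k == q then p else k) | k <- iota 0 (size c)].
Definition conf (n : nat) (w : seq nat) (t : nat) : seq nat :=
  foldl (fun c a => swap_pos c a.-1 a) (iota 1 n.+1) (take t w).
Definition wireL (n : nat) (w : seq nat) (t : nat) : nat := nth 0 (conf n w t) (nth 0 w t).-1.
Definition wireR (n : nat) (w : seq nat) (t : nat) : nat := nth 0 (conf n w t) (nth 0 w t).
Definition on_wire (n : nat) (w : seq nat) (a t : nat) : bool :=
  (a == wireL n w t) || (a == wireR n w t).
Definition other_wire (n : nat) (w : seq nat) (a t : nat) : nat :=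
  if a == wireL n w t then wireR n w t else wireL n w t.

(* In G(i,k), wires a <= k are oriented upward, wires a > k downward.
   next_node n w k a p = next node met when travelling on wire a in its
   orientation, coming from node p (for an upward wire, p = size w means
   coming from its lower end L_a). None = the wire's end is reached. *)
Definition next_node (n : nat) (w : seq nat) (k a p : nat) : option nat :=
  if (a <= k)%N then
    (let c := [seq t <- iota 0 p | on_wire n w a t] in
     if c is [::] then None else Some (last 0 c))
  else ohead [seq t <- iota p.+1 (size w - p.+1) | on_wire n w a t].

Definition forbidden_straight (n : nat) (w : seq nat) (k a t : nat) : bool :=
  let b := other_wire n w a t in
  [&& (k < a)%N, (k < b)%N & (b < a)%N] || [&& (a <= k)%N, (b <= k)%N & (a < b)%N].

(* A path is encoded by the list of pairs (node visited, wire on which the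
   path leaves that node). *)
Fixpoint rig_walk (n : nat) (w : seq nat) (k a p : nat) (s : seq (nat * nat)) : Prop :=
  match s with
  | [::] => a = k.+1 /\ next_node n w k a p = None
  | (j, a') :: s' =>
      [/\ next_node n w k a p = Some j,
          a' = a \/ a' = other_wire n w a j,
          (a' = a -> ~~ forbidden_straight n w k a j) &
          rig_walk n w k a' j s']
  end.

(* rigorous paths of G(i,k): start at L_k (going up wire k), end at L_{k+1},
   each node passed at most once *)
Definition rigorous (n : nat) (w : seq nat) (k : nat) (s : seq (nat * nat)) : Prop :=
  [/\ (1 <= k <= n)%N, uniq (map fst s) & rig_walk n w k k (size w) s].

(* t_{j+1} of the paper is tc x j (0-based) *)
Definition tc (R : realFieldType) (m : nat) (x : 'rV[R]_m) (j : nat) : R :=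
  if (insub j : option 'I_m) is Some i then x ord0 i else 0%R.

Local Open Scope ring_scope.

Fixpoint sval (R : realFieldType) (m : nat) (x : 'rV[R]_m) (a : nat)
    (s : seq (nat * nat)) : R :=
  match s with
  | [::] => 0
  | (j, a') :: s' =>
      (if a' == a then 0 else if (a < a')%N then tc x j else - tc x j)
      + sval x a' s'
  end.

Definition string_cone (R : realFieldType) (n : nat) (w : seq nat)
    : 'rV[R]_(NN n) -> Prop :=
  fun x => forall k s, rigorous n w k s -> 0 <= sval x k s.

Definition lam_coef (R : realFieldType) (w : seq nat) (j k : nat) : R :=
  let a := nth 0%N w j in let b := nth 0%N w k in
  if a == b then -2 else if (a == b.+1) || (b == a.+1) then 1 else 0.

(* lam i = lambda_i (only 1 <= i <= n matters) *)
Definition lam_ineqs (R : realFieldType) (n : nat) (w : seq nat) (lam : nat -> nat)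
    (x : 'rV[R]_(NN n)) : Prop :=
  forall j, (j < NN n)%N ->
    tc x j <= (lam (nth 0%N w j))%:R + \sum_(j.+1 <= k < NN n) lam_coef R w j k * tc x k.

Definition string_polytope (R : realFieldType) (n : nat) (w : seq nat) (lam : nat -> nat)
    : 'rV[R]_(NN n) -> Prop :=
  fun x => @string_cone R n w x /\ lam_ineqs w lam x.

(* ---------- Gelfand-Cetlin polytope ----------
   coordinate x_{k,j} (1 <= j <= k <= n) is stored at index k(k-1)/2 + (j-1) *)
Definition gcidx (k j : nat) : nat := ((k * k.-1)./2 + j.-1)%N.
Definition gcval (R : realFieldType) (n : nat) (lam : nat -> nat) (x : 'rV[R]_(NN n))
    (k j : nat) : R :=
  if k == n.+1 then \sum_(j <= i < n.+1) (lam i)%:R else tc x (gcidx k j).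
Definition GC (R : realFieldType) (n : nat) (lam : nat -> nat) : 'rV[R]_(NN n) -> Prop :=
  fun x => forall k j, (1 <= j <= k)%N -> (k <= n)%N ->
    gcval lam x k j <= gcval lam x k.+1 j /\ gcval lam x k.+1 j.+1 <= gcval lam x k j.

Definition unimod_equiv (R : realFieldType) (m : nat) (P Q : 'rV[R]_m -> Prop) : Prop :=
  exists (M : 'M[int]_m) (v : 'rV[int]_m),
    M \in unitmx /\
    forall y, Q y <-> exists x, P x /\
      y = x *m map_mx (fun z : int => z%:~R) M + map_mx (fun z : int => z%:~R) v.

Definition dotv (R : realFieldType) (m : nat) (a x : 'rV[R]_m) : R := \sum_i a ord0 i * x ord0 i.
Definition same_set (R : realFieldType) (m : nat) (S T : 'rV[R]_m -> Prop) : Prop :=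
  forall x, S x <-> T x.
Definition aff_dim_ge (R : realFieldType) (m : nat) (S : 'rV[R]_m -> Prop) (d : nat) : Prop :=
  exists (x0 : 'rV[R]_m) (X : 'M[R]_(d, m)),
    [/\ S x0, forall i, S (x0 + row i X) & \rank X = d].
Definition aff_dim (R : realFieldType) (m : nat) (S : 'rV[R]_m -> Prop) (d : nat) : Prop :=
  aff_dim_ge S d /\ ~ aff_dim_ge S d.+1.
Definition face (R : realFieldType) (m : nat) (P F : 'rV[R]_m -> Prop) : Prop :=
  exists (a : 'rV[R]_m) (b : R),
    (forall x, P x -> dotv a x <= b) /\ (forall x, F x <-> P x /\ dotv a x = b).
Definition facet (R : realFieldType) (m : nat) (P F : 'rV[R]_m -> Prop) : Prop :=
  face P F /\ exists d, aff_dim P d.+1 /\ aff_dim F d.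
Definition has_facets (R : realFieldType) (m : nat) (P : 'rV[R]_m -> Prop) (k : nat) : Prop :=
  exists F : 'I_k -> ('rV[R]_m -> Prop),
    [/\ forall i, facet P (F i),
        forall i j, same_set (F i) (F j) -> i = j &
        forall G, facet P G -> exists i, same_set G (F i)].
Definition simplicial (R : realFieldType) (m : nat) (P : 'rV[R]_m -> Prop) : Prop :=
  has_facets P m.

Local Close Scope ring_scope.

Inductive move2 : seq nat -> seq nat -> Prop :=
  M2 (u v : seq nat) (a b : nat) :
    (a.+1 < b) || (b.+1 < a) -> move2 (u ++ a :: b :: v) (u ++ b :: a :: v).
(* the equivalence ~ generated by 2-moves (move2 is symmetric) *)
Inductive equiv2 : seq nat -> seq nat -> Prop :=
  | E2refl u : equiv2 u u
  | E2step u v x : move2 u v -> equiv2 v x -> equiv2 u x.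

Inductive AD := SA | SD.
Definition Dw (m : nat) : seq nat := rev (iota 1 m).
Definition Aw (m : nat) : seq nat := iota 1 m.
Definition ADw (s : AD) (m : nat) : seq nat := if s is SD then Dw m else Aw m.

Definition ind_is (s : AD) (m : nat) (w : seq nat) (r : nat) : Prop :=
  exists u v, equiv2 w (u ++ ADw s m ++ v) /\ size v = r.
(* w' is (a representative of) C_s(w), w in Sigma_{m+1} *)
Definition contr (s : AD) (m : nat) (w w' : seq nat) : Prop :=
  exists u v, equiv2 w (u ++ ADw s m ++ v) /\
    w' = (if s is SD then u ++ map predn v else map predn u ++ v).

(* ss = [:: sigma_m; sigma_{m-1}; ...; sigma_1]:
   ind_{sigma_m}(w) = 0, ind_{sigma_{m-1}}(C_{sigma_m} w) = 0, ... *)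
Fixpoint good_seq (m : nat) (ss : seq AD) (w : seq nat) : Prop :=
  match ss with
  | [::] => True
  | s :: ss' => ind_is s m w 0 /\ exists w', contr s m w w' /\ good_seq m.-1 ss' w'
  end.
Definition cond4 (n : nat) (w : seq nat) : Prop :=
  exists ss : seq AD, size ss = n /\ good_seq n ss w.

(* Main.v *)
Require Import Defs.
From HB Require Import structures.
From mathcomp Require Import all_boot all_order all_algebra all_fingroup.
From mathcomp Require Import zify ring lra.
From Stdlib Require Import Classical FunctionalExtensionality.
Set Implicit Arguments. Unset Strict Implicit. Unset Printing Implicit Defensive.
Import Order.TTheory GRing.Theory Num.Theory.

(* A real number attached to each piece of wire (a potential) determines a point t
   of the coordinate space, t_j being the jump at the j-th crossing; the string
   functional of a path at t is then the total increase of the potential along the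
   pieces of wire that the path traverses. Potentials c_a constant on each wire a
   give points at which every path of G(i,k) takes the value c_(k+1) - c_k; for
   suitable c one obtains an interior point of the cone and a point at which all
   lambda-inequalities are tight. A potential counting the pieces of wire outside a
   given path shows that no string inequality is redundant. So the facets of the
   cone are the rigorous paths, and those of the polytope are the rigorous paths
   together with the N lambda-inequalities; (2) and (3) both say that there are
   exactly N paths.

   Every crossing is the peak of a greedy path that switches increasingly exactly
   once, so there are at least N paths, and if there are exactly N then no path has
   two increasing switches and no crossing is a peak for two different k. Excluding
   the corresponding configurations of crossings, one finds by induction on
   intervals of consecutive wires that the first or the last wire crosses all
   others below their mutual crossings, i.e. that i ~ u D_n or i ~ (u+1) A_n; this
   gives (4). Conversely, for such a word the cone is the product of the cone of u
   with a chain 0 <= t_N <= ... in the last coordinates, the lambda-inequalities of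
   the last block say that these coordinates encode one row of a Gelfand-Cetlin
   pattern, and the other lambda-inequalities are those of u for the weight of that
   row; hence (1). Finally GC(lambda) has n(n+1) facets, so (1) gives (2). *)

(** A facet count is certified by points: one at which every inequality is strict and, for each
    inequality, one at which it alone is tight. The potentials serve to construct these points. The
    order of the crossings enters mainly through one property: for wires a < b < c the crossing of a
    and c lies in time between those of a, b and of b, c. Conditions on the word compare only
    crossings along a common wire, because these comparisons survive the renumbering of nodes by
    2-moves. Two obstacles shape the step from (4) to (1). Above the last block the
    lambda-inequalities involve the block coordinates, so lambda cannot stay fixed in the induction:
    the top row of the pattern is a variable, and the row below it is a form in the point.
    Unimodularity has to survive this dependence; it is carried along as solvability over the
    integers for every integral top row, and becomes an invertible matrix only at the end. Points
    are mostly functions on natural numbers, so that words of different lengths can share them. *)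

Local Arguments gcidx : simpl never.

(** * Facets of a polyhedron *)

Local Open Scope ring_scope.

Section Facets.
Variables (R : realFieldType) (m : nat).
Implicit Types (x y a : 'rV[R]_m) (S P : 'rV[R]_m -> Prop).

Lemma dotvE a x : dotv a x = (x *m a^T) 0 0.
Proof. by rewrite mxE; apply: eq_bigr => i _; rewrite mxE mulrC. Qed.

Lemma dotvDr a x y : dotv a (x + y) = dotv a x + dotv a y.
Proof. by rewrite !dotvE mulmxDl mxE. Qed.

Lemma dotvZr a c x : dotv a (c *: x) = c * dotv a x.
Proof. by rewrite !dotvE -scalemxAl mxE. Qed.

Lemma dotvC a x : dotv a x = dotv x a.
Proof. by apply: eq_bigr => i _; rewrite mulrC. Qed.

Lemma dotv_sumr a (I : finType) (f : I -> 'rV[R]_m) :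
  dotv a (\sum_i f i) = \sum_i dotv a (f i).
Proof.
by rewrite dotvE mulmx_suml summxE; apply: eq_bigr => i _; rewrite dotvE.
Qed.

Lemma dotv0l x : dotv 0 x = 0.
Proof. by apply: big1 => i _; rewrite mxE mul0r. Qed.

Lemma dotv_self_gt0 a : a != 0 -> 0 < dotv a a.
Proof.
case/rV0Pn => j hj; rewrite /dotv (bigD1 j) //=.
apply: ltr_pwDl; first by rewrite -expr2 lt0r sqr_ge0 sqrf_eq0 hj.
by apply: sumr_ge0 => i _; rewrite -expr2 sqr_ge0.
Qed.

Lemma aff_dim_ge_pred S d : aff_dim_ge S d.+1 -> aff_dim_ge S d.
Proof.
case=> x0 [X [hx0 hX hr]]; exists x0, (rowsub (lift ord0) X); split=> //.
  by move=> i; rewrite row_rowsub; apply: hX.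
have freeX : row_free X by apply/eqP.
rewrite rowsubE mxrankMfree //; apply/eqP/row_freeP.
exists (rowsub (lift ord0) 1%:M)^T; apply/matrixP => i j.
rewrite !mxE (bigD1 (lift ord0 i)) //= big1 ?addr0; last first.
  by move=> k hk; rewrite !mxE eq_sym (negPf hk) mul0r.
by rewrite !mxE eqxx mul1r (inj_eq lift_inj) eq_sym.
Qed.

Lemma aff_dim_ge_leq S d e : (e <= d)%N -> aff_dim_ge S d -> aff_dim_ge S e.
Proof.
move=> le_ed; rewrite -(subnK le_ed); elim: (d - e)%N => // k IH.
by rewrite addSn => /aff_dim_ge_pred.
Qed.

Lemma aff_dim_uniq S d e : aff_dim S d -> aff_dim S e -> d = e.
Proof.
move=> [d1 d2] [e1 e2]; case: (ltngtP d e) => // h.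
  by case: d2; apply: aff_dim_ge_leq e1.
by case: e2; apply: aff_dim_ge_leq d1.
Qed.

Definition affine (g : 'rV[R]_m -> R) : Prop :=
  exists a b, forall x, g x = b - dotv a x.

Lemma affine_avg (g : 'rV[R]_m -> R) (I : finType) (y : I -> 'rV[R]_m) :
  affine g -> (0 < #|I|)%N ->
  g (#|I|%:R^-1 *: \sum_i y i) = #|I|%:R^-1 * \sum_i g (y i).
Proof.
move=> [a [b hg]] hI; have hI' : #|I|%:R != 0 :> R by rewrite pnatr_eq0 -lt0n.
rewrite hg dotvZr dotv_sumr; under [in RHS]eq_bigr do rewrite hg.
by rewrite sumrB mulrBr sumr_const -(mulr_natl b) mulrA mulVf // mul1r.
Qed.

Section Polyhedron.
Variables (I : finType) (g : I -> 'rV[R]_m -> R) (P : 'rV[R]_m -> Prop).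
Variables (x0 : 'rV[R]_m) (z : I -> 'rV[R]_m).
Hypotheses (m_gt0 : (0 < m)%N) (Hg : forall i, affine (g i)).
Hypothesis HP : forall x, P x <-> forall i, 0 <= g i x.
Hypothesis Hx0 : forall i, 0 < g i x0.
Hypothesis Hz0 : forall i, g i (z i) = 0.
Hypothesis Hz : forall i j, j != i -> 0 < g j (z i).

(** [Q] selects the inequalities that must stay strict: all of them around an interior point, all
    but one around a point of a facet. *)
Lemma small_step x (J : finType) (v : J -> 'rV[R]_m) (Q : pred I) :
  (forall i, Q i -> 0 < g i x) ->
  exists2 e : R, 0 < e & forall i j, Q i -> 0 < g i (x + e *: v j).
Proof.
move=> hx.
have one (i : I) (j : J) : exists e : R, 0 < e /\
    (Q i -> forall e', 0 < e' -> e' <= e -> 0 < g i (x + e' *: v j)).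
  have [a [b hg]] := Hg i.
  case: (boolP (Q i)) => hQ; last by exists 1; split.
  have := hx i hQ; rewrite hg => hpos.
  exists ((b - dotv a x) / (1 + `|dotv a (v j)|)); split.
    by apply: divr_gt0 => //; apply: ltr_pwDl => //; apply: normr_ge0.
  move=> _ e' he' hle; rewrite hg dotvDr dotvZr.
  have h1 : 0 < 1 + `|dotv a (v j)| by apply: ltr_pwDl => //; apply: normr_ge0.
  have h2 : e' * (1 + `|dotv a (v j)|) <= b - dotv a x by rewrite -ler_pdivlMr.
  have h3 : e' * dotv a (v j) <= e' * `|dotv a (v j)|.
    by apply: ler_wpM2l; [apply: ltW | apply: ler_norm].
  move: h2; rewrite mulrDr mulr1; lra.
have [e he] := fin_all_exists (fun p : I * J => one p.1 p.2).
pose E := \big[Num.min/1]_(p : I * J) e p.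
have E_gt0 : 0 < E.
  by rewrite /E; elim/big_ind: _ => // [a b ha hb|p _]; [rewrite lt_min ha hb | case: (he p)].
exists E => // i j hQ; have [_ h] := he (i, j); apply: h => //=.
by rewrite /E (bigD1 (i, j)) //= ge_min lexx.
Qed.

Lemma polyhedron_aff_dim : aff_dim P m.
Proof.
split; last first.
  move=> [y [X [_ _ hr]]]; have := rank_leq_col X; rewrite hr; lia.
have [e e0 he] := @small_step x0 'I_m (fun j => row j 1%:M) predT (fun i _ => Hx0 i).
exists x0, (e%:M); split.
- by apply/HP => i; apply/ltW.
- move=> j; apply/HP => i; apply/ltW.
  have -> : row j e%:M = e *: row j 1%:M by apply/rowP => k; rewrite !mxE mulr_natr.
  exact: he.
- by apply: mxrank_unit; rewrite unitmxE det_scalar unitrX // unitfE gt_eqF.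
Qed.

Definition facet_of i x := P x /\ g i x = 0.

Lemma facet_face i : exists a b, [/\ a != 0, forall x, g i x = b - dotv a x &
   forall x, facet_of i x <-> P x /\ dotv a x = b].
Proof.
have [a [b hg]] := Hg i; exists a, b; split=> //.
  apply/eqP => a0; have := Hx0 i; have := Hz0 i.
  by rewrite !hg a0 !dotv0l subr0 => ->; rewrite ltxx.
by move=> x; rewrite /facet_of hg; split=> -[hp h]; split=> //; lra.
Qed.

Lemma rank_orth d (X : 'M[R]_(d, m)) a :
  (forall i, dotv a (row i X) = 0) -> (X <= kermx a^T)%MS.
Proof.
move=> h; apply/row_subP => i; apply/sub_kermxP; apply/matrixP => j k.
by rewrite !ord1 -dotvE h mxE.
Qed.

Lemma rank_kermx_tr a : a != 0 -> \rank (kermx a^T) = m.-1.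
Proof. by move=> ha; rewrite mxrank_ker mxrank_tr rank_rV ha subn1. Qed.

(** Around [z i] all other inequalities are strict, so a small multiple of a basis of the hyperplane
    directions stays in [P]; this gives dimension m - 1. *)
Lemma facet_ofP i : facet P (facet_of i).
Proof.
have [a [b [a0 hg hF]]] := facet_face i; split.
  exists a, b; split=> // x /HP /(_ i); rewrite hg; lra.
exists m.-1; split; first by rewrite prednK //; apply: polyhedron_aff_dim.
split; last first.
  case=> y [X [hy hX hr]].
  have /mxrankS : (X <= kermx a^T)%MS.
    apply: rank_orth => j; have /hF [_] := hX j; have /hF [_ <-] := hy.
    rewrite dotvDr; lra.
  rewrite rank_kermx_tr // hr; lia.
pose X := row_base (kermx a^T).
have dX : \rank (kermx a^T) = m.-1 by apply: rank_kermx_tr.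
have [e e0 he] := @small_step (z i) _ (fun j => row j X) (predC1 i) (@Hz i).
have kerX j : dotv a (row j X) = 0.
  have : (row j X <= kermx a^T)%MS.
    by apply: submx_trans (row_sub _ _) _; rewrite /X eq_row_base.
  by move/sub_kermxP => h; rewrite dotvE h mxE.
suff : aff_dim_ge (facet_of i) (\rank (kermx a^T)) by rewrite dX.
have hzi : facet_of i (z i).
  split=> //; apply/HP => j; case: (eqVneq j i) => [->|h]; first by rewrite Hz0.
  exact/ltW/Hz.
exists (z i), (e *: X); split=> //.
  move=> j; have -> : row j (e *: X) = e *: row j X by apply/rowP => k; rewrite !mxE.
  have g0 : g i (z i + e *: row j X) = 0.
    by rewrite hg dotvDr dotvZr kerX mulr0 addr0 -hg Hz0.
  split=> //; apply/HP => k; case: (eqVneq k i) => [->|h]; first by rewrite g0.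
  exact/ltW/he.
by rewrite mxrank_scale_nz ?gt_eqF // /X eq_row_base.
Qed.

Lemma facet_of_inj i j : same_set (facet_of i) (facet_of j) -> i = j.
Proof.
move=> h; apply/eqP/negPn/negP => hij.
have hzi : facet_of i (z i).
  split=> //; apply/HP => k; case: (eqVneq k i) => [->|hk]; first by rewrite Hz0.
  exact/ltW/Hz.
have [_] := (h _).1 hzi; have := @Hz i j; rewrite eq_sym hij => /(_ isT) hh h0.
by rewrite h0 ltxx in hh.
Qed.

(** If no [g i] vanished on all of [G], averaging one witness per inequality would give a point of
    [G] interior to [P], from which a step along the normal [a] leaves the valid half-space. Once
    [G] lies in some hyperplane [g i = 0], its dimension makes this hyperplane and the supporting
    one coincide. *)
Lemma facet_is_facet_of G : facet P G -> exists i, same_set G (facet_of i).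
Proof.
case=> -[a [b [hval hG]]] [d [dP dGd]]; have [dG ndG] := dGd.
have ed : d.+1 = m := aff_dim_uniq dP polyhedron_aff_dim.
have [y0 hy0] : exists y, G y by have [y [X [hy _ _]]] := dG; exists y.
have a_neq0 : a != 0.
  apply/eqP => a0.
  have b0 : b = 0 by have /hG [_] := hy0; rewrite a0 dotv0l.
  have PG x : P x -> G x by move=> hx; apply/hG; rewrite a0 dotv0l b0.
  have [[y [X [hy hX hr]]] _] := dP; apply: ndG.
  by exists y, X; split=> // [|i]; apply: PG.
have [i hi] : exists i, forall y, G y -> g i y = 0.
  apply: NNPP => hn.
  have hy i : exists y, G y /\ g i y <> 0.
    apply: NNPP => hi; apply: hn; exists i => y hy; apply: NNPP => hgy.
    by apply: hi; exists y.
  have [f hf] := fin_all_exists hy.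
  (* The extra index [None] keeps the averaged family nonempty even if there are no inequalities. *)
  pose y (o : option I) := if o is Some i then f i else y0.
  have Gy o : G (y o) by case: o => [i|] //=; case: (hf i).
  have cO : (0 < #|{: option I}|)%N by rewrite card_option.
  pose q := #|{: option I}|%:R^-1 *: \sum_o y o.
  have gq i : true -> 0 < g i q.
    move=> _; rewrite affine_avg // mulr_gt0 ?invr_gt0 ?ltr0n //.
    rewrite (bigD1 (Some i)) //=; apply: ltr_pwDl.
      have [/hG [/HP /(_ i) h1 _] h2] := hf i.
      by rewrite lt0r h1 andbT; apply/eqP.
    by apply: sumr_ge0 => o _; have /hG [/HP /(_ i)] := Gy o.
  have aq : dotv a q = b.
    rewrite /q dotvZr dotv_sumr (eq_bigr (fun=> b)); last first.
      by move=> o _; have /hG [] := Gy o.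
    by rewrite sumr_const -(mulr_natl b) mulKf // pnatr_eq0 -lt0n.
  have [e e0 he] := @small_step q 'I_1 (fun=> a) predT gq.
  have /hval : P (q + e *: a) by apply/HP => i; apply/ltW/(he i ord0).
  rewrite dotvDr dotvZr aq -subr_ge0 opprD addNKr oppr_ge0 leNgt.
  by rewrite mulr_gt0 // dotv_self_gt0.
exists i => x; split; first by move=> hx; split; [case/hG: hx | exact: hi].
have [c [b' [c0 hg hF]]] := facet_face i.
case/hF => hx hcx; apply/hG; split=> //.
have [y [X [hy hX hr]]] := dG.
have orth v : dotv v y = dotv v (y + row ord0 (0 : 'M_(1, m))) by rewrite row0 addr0.
have XaE : (X :=: kermx a^T)%MS.
  apply/eqmxP; rewrite -mxrank_leqif_eq ?hr ?rank_kermx_tr -?ed //.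
  apply: rank_orth => j; have /hG [_ h1] := hX j; have /hG [_ h2] := hy.
  move: h1; rewrite dotvDr h2; lra.
have XcE : (X :=: kermx c^T)%MS.
  apply/eqmxP; rewrite -mxrank_leqif_eq ?hr ?rank_kermx_tr -?ed //.
  apply: rank_orth => j; have := hi _ (hX j); have := hi _ hy.
  rewrite !hg dotvDr; lra.
have : (x - y <= kermx c^T)%MS.
  apply/sub_kermxP/matrixP => j k; rewrite !ord1 -dotvE mxE dotvDr -scaleN1r dotvZr.
  have := hi _ hy; rewrite hg hcx; lra.
rewrite -XcE XaE => /sub_kermxP h.
have : dotv a (x - y) = 0 by rewrite dotvE h mxE.
rewrite dotvDr -scaleN1r dotvZr; have /hG [_ ->] := hy; lra.
Qed.

Lemma polyhedron_has_facets k : has_facets P k <-> k = #|I|.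
Proof.
split=> [[F [hF injF surjF]]|->]; last first.
  exists (fun i => facet_of (enum_val i)); split.
  - by move=> i; apply: facet_ofP.
  - by move=> i j /facet_of_inj; apply: enum_val_inj.
  - move=> G /facet_is_facet_of [i hi]; exists (enum_rank i).
    by rewrite enum_rankK.
(* Two lists of all facets without repetition inject into each other. *)
have [f hf] := fin_all_exists (fun i => facet_is_facet_of (hF i)).
have [h hh] := fin_all_exists (fun i => surjF _ (facet_ofP i)).
have inj_f : injective f.
  by move=> i j e; apply: injF => x; rewrite (hf i x) (hf j x) e.
have inj_h : injective h.
  by move=> i j e; apply: facet_of_inj => x; rewrite (hh i x) (hh j x) e.
apply/eqP; rewrite eqn_leq -{1}(card_ord k) (leq_card f inj_f) /=.
by rewrite -[X in (_ <= X)%N](card_ord k) (leq_card h inj_h).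
Qed.
End Polyhedron.
End Facets.

Local Close Scope ring_scope.

(** * Wiring diagrams *)

Definition tau (p q k : nat) : nat := if k == p then q else if k == q then p else k.

(** A case list that linear arithmetic can use directly. *)
Lemma tauP p q k : (k = p /\ tau p q k = q) \/ (k <> p /\ k = q /\ tau p q k = p)
  \/ (k <> p /\ k <> q /\ tau p q k = k).
Proof.
rewrite /tau; case: (k =P p) => h; first by left.
by case: (k =P q) => h'; [right; left | right; right].
Qed.

Lemma tau_lt p q k m : p < m -> q < m -> k < m -> tau p q k < m.
Proof. have := tauP p q k; lia. Qed.

Lemma tauK p q : involutive (tau p q).
Proof. by move=> k; have := tauP p q k; have := tauP p q (tau p q k); lia. Qed.

Lemma size_swap_pos c p q : size (swap_pos c p q) = size c.
Proof. by rewrite size_map size_iota. Qed.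

Lemma nth_swap_pos c p q i : p < size c -> q < size c ->
  nth 0 (swap_pos c p q) i = nth 0 c (tau p q i).
Proof.
move=> hp hq; case: (ltnP i (size c)) => hi.
  by rewrite (nth_map 0) ?size_iota // nth_iota.
rewrite !nth_default ?size_swap_pos //.
have := tauP p q i; lia.
Qed.

Lemma perm_swap_pos c p q : p < size c -> q < size c -> uniq c ->
  perm_eq (swap_pos c p q) c.
Proof.
move=> hp hq hu; have sz := size_swap_pos c p q.
have us : uniq (swap_pos c p q).
  apply/(uniqP 0) => i j; rewrite !inE sz => hi hj; rewrite !nth_swap_pos //.
  have lt k : k < size c -> tau p q k < size c.
    have := tauP p q k; lia.
  by move/(uniqP 0 hu _ _ (lt _ hi) (lt _ hj))/(can_inj (@tauK p q)).
rewrite perm_sym; apply: uniq_perm => // x.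
have sub : {subset swap_pos c p q <= c}.
  move=> y /mapP [i]; rewrite mem_iota => /andP [_ hi] ->.
  apply: mem_nth; rewrite -/(tau p q i); exact: tau_lt.
by have [_ h] := uniq_min_size us sub (eq_leq (esym sz)); rewrite h.
Qed.

Lemma index_swap_pos c p q x : p < size c -> q < size c -> uniq c -> x \in c ->
  index x (swap_pos c p q) = tau p q (index x c).
Proof.
move=> hp hq hu hx.
have lt : tau p q (index x c) < size c.
  by have := hx; rewrite -index_mem; have := tauP p q (index x c); lia.
have -> : x = nth 0 (swap_pos c p q) (tau p q (index x c)).
  by rewrite nth_swap_pos // tauK nth_index.
rewrite index_uniq ?size_swap_pos //; last by rewrite (perm_uniq (perm_swap_pos _ _ _)).
by rewrite nth_swap_pos // tauK nth_index.
Qed.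

Definition letters_ok n (w : seq nat) := all (fun a => 0 < a <= n) w.

Lemma confS n w t : t < size w ->
  conf n w t.+1 = swap_pos (conf n w t) (nth 0 w t).-1 (nth 0 w t).
Proof. by move=> h; rewrite /conf (take_nth 0) // foldl_rcons. Qed.

Lemma conf_cat n u v i : conf n (u ++ v) (size u + i) =
  foldl (fun c a => swap_pos c a.-1 a) (conf n u (size u)) (take i v).
Proof. by rewrite /conf takeD take_size_cat // drop_size_cat // foldl_cat take_size. Qed.

Lemma conf_catl n u v t : t <= size u -> conf n (u ++ v) t = conf n u t.
Proof. by move=> h; rewrite /conf takel_cat. Qed.

Section Conf.
Variables (n : nat) (w : seq nat).
Hypothesis Hw : letters_ok n w.

Lemma letter_ok t : t < size w -> 0 < nth 0 w t <= n.
Proof. by move=> h; apply: (allP Hw); apply: mem_nth. Qed.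

Lemma conf_perm t : perm_eq (conf n w t) (iota 1 n.+1).
Proof.
elim: t => [|t IH]; first by rewrite /conf take0.
case: (ltnP t (size w)) => h; last first.
  suff -> : conf n w t.+1 = conf n w t by [].
  by rewrite /conf !take_oversize // ltnW.
rewrite confS //; have sz : size (conf n w t) = n.+1.
  by rewrite (perm_size IH) size_iota.
have hl := letter_ok h; apply: perm_trans (IH); apply: perm_swap_pos; rewrite ?sz; try lia.
by rewrite (perm_uniq IH) iota_uniq.
Qed.

Lemma size_conf t : size (conf n w t) = n.+1.
Proof. by rewrite (perm_size (conf_perm t)) size_iota. Qed.

Lemma conf_uniq t : uniq (conf n w t).
Proof. by rewrite (perm_uniq (conf_perm t)) iota_uniq. Qed.

Lemma mem_conf t a : (a \in conf n w t) = (0 < a <= n.+1).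
Proof. by rewrite (perm_mem (conf_perm t)) mem_iota; lia. Qed.

Definition ix t a := index a (conf n w t).

Lemma ix_lt t a : 0 < a <= n.+1 -> ix t a <= n.
Proof. by move=> h; rewrite -ltnS -[X in _ < X](size_conf t) index_mem mem_conf. Qed.

Lemma nth_ix t a : 0 < a <= n.+1 -> nth 0 (conf n w t) (ix t a) = a.
Proof. by move=> h; rewrite nth_index // mem_conf. Qed.

Lemma ix_nth t i : i <= n -> ix t (nth 0 (conf n w t) i) = i.
Proof. by move=> h; rewrite /ix index_uniq ?size_conf ?conf_uniq. Qed.

Lemma ix_inj t a b : 0 < a <= n.+1 -> 0 < b <= n.+1 -> ix t a = ix t b -> a = b.
Proof. by move=> ha hb h; rewrite -(nth_ix t ha) h nth_ix. Qed.

Lemma wire_range t : t < size w ->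
  [/\ 0 < wireL n w t <= n.+1, 0 < wireR n w t <= n.+1 & wireL n w t != wireR n w t].
Proof.
move=> h; have hl := letter_ok h; rewrite -!(mem_conf t) !mem_nth ?size_conf; try lia.
by split=> //; rewrite nth_uniq ?size_conf ?conf_uniq //; lia.
Qed.

Lemma ixL t : t < size w -> ix t (wireL n w t) = (nth 0 w t).-1.
Proof. by move=> h; have hl := letter_ok h; apply: ix_nth; lia. Qed.

Lemma ixR t : t < size w -> ix t (wireR n w t) = nth 0 w t.
Proof. by move=> h; have hl := letter_ok h; apply: ix_nth; lia. Qed.

Lemma ixS t a : t < size w -> 0 < a <= n.+1 ->
  ix t.+1 a = tau (nth 0 w t).-1 (nth 0 w t) (ix t a).
Proof.
move=> h ha; have hl := letter_ok h; rewrite /ix confS // index_swap_pos ?size_conf ?conf_uniq ?mem_conf //; lia.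
Qed.

Lemma on_wire_ix t a : t < size w -> 0 < a <= n.+1 ->
  on_wire n w a t = (ix t a == (nth 0 w t).-1) || (ix t a == nth 0 w t).
Proof.
move=> h ha; have hl := letter_ok h; have [rL rR _] := wire_range h.
rewrite /on_wire -(ixL h) -(ixR h); congr (_ || _); apply/eqP/eqP => [->//|]; exact: ix_inj.
Qed.

Lemma on_wire_range t a : t < size w -> on_wire n w a t -> 0 < a <= n.+1.
Proof. by move=> /wire_range [h1 h2 _] /orP [] /eqP ->. Qed.

Lemma ix_mono t a b : t < size w -> 0 < a <= n.+1 -> 0 < b <= n.+1 ->
  ~~ (on_wire n w a t && on_wire n w b t) ->
  (ix t.+1 a < ix t.+1 b) = (ix t a < ix t b).
Proof.
move=> h ha hb; have hl := letter_ok h; rewrite !on_wire_ix // !ixS //.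
have := @ix_inj t _ _ ha hb.
case: (eqVneq a b) => [->|ab] hinj; first by rewrite !ltnn.
have {}hinj : ix t a <> ix t b by move=> e; case/eqP: ab; apply: hinj.
have := tauP (nth 0 w t).-1 (nth 0 w t) (ix t a); have := tauP (nth 0 w t).-1 (nth 0 w t) (ix t b); lia.
Qed.

Lemma ix_swap t a b : t < size w -> on_wire n w a t -> on_wire n w b t ->
  (ix t.+1 a < ix t.+1 b) = (ix t b < ix t a).
Proof.
move=> h ha hb; have ra := on_wire_range h ha; have rb := on_wire_range h hb.
move: ha hb; have hl := letter_ok h; rewrite !on_wire_ix // !ixS //.
have := tauP (nth 0 w t).-1 (nth 0 w t) (ix t a); have := tauP (nth 0 w t).-1 (nth 0 w t) (ix t b); lia.
Qed.

End Conf.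

(** The condition on the product of letters, read in the diagram: the bottom order is reversed. In
    this form it passes easily to diagrams with a wire deleted. *)
Definition red n w := [/\ size w = NN n, letters_ok n w &
  conf n w (size w) = rev (iota 1 n.+1)].

(** The value [size w] means that the wires do not meet. *)
Definition crossing n w a b := find (fun t => on_wire n w a t && on_wire n w b t) (iota 0 (size w)).

Lemma XC n w a b : crossing n w a b = crossing n w b a.
Proof. by apply: eq_find => t; rewrite andbC. Qed.

Lemma X_spec n w a b : crossing n w a b < size w ->
  on_wire n w a (crossing n w a b) && on_wire n w b (crossing n w a b).
Proof.
move=> h; have hs : has (fun t => on_wire n w a t && on_wire n w b t) (iota 0 (size w)).
  by rewrite has_find size_iota.
by have := nth_find 0 hs; rewrite -/(crossing n w a b) nth_iota.
Qed.

Lemma X_min n w a b t : t < crossing n w a b -> t < size w ->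
  ~~ (on_wire n w a t && on_wire n w b t).
Proof.
move=> h ht; have := @before_find _ 0 (fun t => on_wire n w a t && on_wire n w b t) (iota 0 (size w)) t h.
by rewrite nth_iota // add0n => ->.
Qed.

Section Red.
Variables (n : nat) (w : seq nat).
Hypothesis Hr : red n w.
Let Hw : letters_ok n w. Proof. by case: Hr. Qed.
Let Hsz : size w = NN n. Proof. by case: Hr. Qed.
Notation N := (size w).
Notation X := (crossing n w).
Notation ix := (ix n w).

Lemma ix0 a : 0 < a <= n.+1 -> ix 0 a = a.-1.
Proof.
move=> h; rewrite /ix /conf take0; change (index a (iota 1 n.+1) = a.-1).
have e : nth 0 (iota 1 n.+1) a.-1 = a by rewrite nth_iota; lia.
by rewrite -{1}e index_uniq ?iota_uniq // size_iota; lia.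
Qed.

Lemma ixN a : 0 < a <= n.+1 -> ix N a = n.+1 - a.
Proof.
move=> h; rewrite /ix; case: Hr => _ _ ->.
have e : nth 0 (rev (iota 1 n.+1)) (n.+1 - a) = a.
  by rewrite nth_rev ?size_iota ?nth_iota; lia.
by rewrite -{1}e index_uniq ?rev_uniq ?iota_uniq // size_rev size_iota; lia.
Qed.

Lemma ix_const a b s t : s <= t -> t <= N -> 0 < a <= n.+1 -> 0 < b <= n.+1 ->
  (forall u, s <= u < t -> ~~ (on_wire n w a u && on_wire n w b u)) ->
  (ix t a < ix t b) = (ix s a < ix s b).
Proof.
move=> hst hN ha hb; rewrite -(subnKC hst) in hN *.
elim: (t - s) hN => [|d IH] hN hu; first by rewrite addn0.
rewrite addnS ix_mono ?IH //; try lia.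
- by move=> u hu'; apply: hu; lia.
- by apply: hu; lia.
Qed.

Lemma X_lt a b : 0 < a <= n.+1 -> 0 < b <= n.+1 -> a != b -> X a b < N.
Proof.
wlog ab : a b / a < b.
  move=> hwlog ha hb hab; case: (ltngtP a b) => h; last by rewrite h eqxx in hab.
    exact: hwlog.
  by rewrite XC; apply: hwlog => //; rewrite eq_sym.
move=> ha hb _; rewrite ltnNge; apply/negP => hX.
have := @ix_const a b 0 N (leq0n _) (leqnn _) ha hb.
rewrite !ix0 // !ixN // => h.
suff : (n.+1 - a < n.+1 - b) = (a.-1 < b.-1) by lia.
by apply: h => u /andP [_ hu]; apply: X_min => //; apply: leq_trans hX.
Qed.

Let pairs := [seq (a, b) | b <- iota 1 n.+1, a <- iota 1 b.-1].

Lemma size_pairs : size pairs = N.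
Proof.
have -> : pairs = [seq (a, b) | b <- [seq 1 + i | i <- iota 0 n.+1], a <- iota 1 b.-1].
  by rewrite -(iotaDl 1 0).
rewrite size_allpairs_dep sumnE !big_map Hsz /NN.
under eq_bigr do rewrite size_iota.
have -> : (n * n.+1)./2 = 'C(n.+1, 2) by rewrite bin2 /= mulnC.
by rewrite -bin2_sum /index_iota subn0; apply: eq_bigr.
Qed.

Lemma mem_pairs p : (p \in pairs) = (0 < p.1) && (p.1 < p.2 <= n.+1).
Proof.
apply/allpairsPdep/idP => [[b [a [hb ha ->]]]|h].
  by move: hb ha; rewrite !mem_iota /=; lia.
by exists p.2, p.1; rewrite !mem_iota -surjective_pairing; split=> //; lia.
Qed.

Lemma on_two t a b c : on_wire n w a t -> on_wire n w b t -> a != b ->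
  on_wire n w c t -> (c == a) || (c == b).
Proof.
rewrite /on_wire; case/orP => /eqP -> /orP [] /eqP -> h /orP [] /eqP ->;
rewrite ?eqxx ?orbT //; by rewrite eqxx in h.
Qed.

Lemma on_pair t a b c d : a < b -> c < d -> on_wire n w a t -> on_wire n w b t ->
  on_wire n w c t -> on_wire n w d t -> a = c /\ b = d.
Proof. rewrite /on_wire; lia. Qed.

Lemma X_uniq t a b : t < N -> a != b -> on_wire n w a t -> on_wire n w b t -> X a b = t.
Proof.
wlog ab : a b / a < b.
  move=> hwlog ht hab ha hb; case: (ltngtP a b) => h; last by rewrite h eqxx in hab.
    exact: hwlog.
  by rewrite XC; apply: hwlog => //; rewrite eq_sym.
move=> ht _ ha hb.
pose f (p : nat * nat) := X p.1 p.2.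
have spec p : p \in pairs ->
    [/\ f p < N, p.1 < p.2, on_wire n w p.1 (f p) & on_wire n w p.2 (f p)].
  rewrite mem_pairs => hp; have h : X p.1 p.2 < N by apply: X_lt; lia.
  by have /andP [h1 h2] := X_spec h; split=> //; lia.
have uniq_pairs : uniq pairs.
  apply: allpairs_uniq_dep; rewrite ?iota_uniq //; first by move=> ? _; exact: iota_uniq.
  by move=> [b1 a1] [b2 a2] _ _ /= [-> ->].
have umap : uniq (map f pairs).
  rewrite map_inj_in_uniq // => -[p1 p2] [q1 q2] /spec /= [_ hp h1 h2] /spec /= [_ hq h3 h4] e.
  rewrite -e in h3 h4; by have [-> ->] := on_pair hp hq h1 h2 h3 h4.
have sub : {subset map f pairs <= iota 0 N}.
  by move=> x /mapP [p /spec [h _ _ _] ->]; rewrite mem_iota.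
have le : size (iota 0 N) <= size (map f pairs) by rewrite size_map size_pairs size_iota.
have [_ e] := uniq_min_size umap sub le.
have : t \in map f pairs by rewrite e mem_iota.
case/mapP => -[p1 p2] /spec /= [_ hp h1 h2] e2; rewrite -e2 in h1 h2.
by have [-> ->] := on_pair ab hp ha hb h1 h2.
Qed.

Lemma X_on a b : 0 < a <= n.+1 -> 0 < b <= n.+1 -> a != b ->
  on_wire n w a (X a b) && on_wire n w b (X a b).
Proof. by move=> ha hb hab; apply/X_spec/X_lt. Qed.

(** Converts a comparison of times into a comparison of positions at one time. *)
Lemma X_ix a b t : 0 < a < b -> b <= n.+1 -> t <= N -> (X a b < t) = (ix t b < ix t a).
Proof.
move=> ha hb ht.
have ra : 0 < a <= n.+1 by lia.
have rb : 0 < b <= n.+1 by lia.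
have ab : a != b by lia.
have hX := X_lt ra rb ab.
have before s : s <= X a b -> (ix s b < ix s a) = false.
  move=> hs; rewrite (@ix_const b a 0 s) ?ix0 //; try lia.
  by move=> u hu; rewrite andbC; apply: X_min; lia.
case: ltnP => h; last by rewrite before.
have /andP [oa ob] := X_on ra rb ab.
rewrite (@ix_const b a (X a b).+1 t) //.
  rewrite ix_swap //; apply/esym; rewrite ltnNge leq_eqVlt (before _ (leqnn _)) orbF.
  by apply/eqP => e; have := @ix_inj n w Hw (X a b) b a rb ra e; lia.
move=> u hu; apply/negP => /andP [o1 o2].
have := @X_uniq u a b; lia.
Qed.

Lemma ltLR t : t < N -> wireL n w t < wireR n w t.
Proof.
move=> ht; have [rL rR hLR] := wire_range Hw ht.
have hl := letter_ok Hw ht.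
rewrite ltnNge; apply/negP => h.
have hX : X (wireR n w t) (wireL n w t) = t.
  by apply: X_uniq; rewrite ?on_wire ?eqxx ?orbT // 1?eq_sym // /on_wire eqxx ?orbT.
have := @X_ix (wireR n w t) (wireL n w t) t; rewrite hX ltnn ixL // ixR //; lia.
Qed.

Lemma X_LR t : t < N -> X (wireL n w t) (wireR n w t) = t.
Proof.
move=> ht; apply: X_uniq; rewrite // ?ltn_eqF ?ltLR // /on_wire eqxx ?orbT //.
Qed.

Lemma X_neq a b c : 0 < a <= n.+1 -> 0 < b <= n.+1 -> 0 < c <= n.+1 ->
  a != b -> a != c -> b != c -> X a b != X a c.
Proof.
move=> ha hb hc ab ac bc; apply/eqP => e.
have /andP [o1 o2] := X_on ha hb ab; have /andP [o3 o4] := X_on ha hc ac.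
by rewrite -e in o4; have := on_two o1 o2 ab o4; rewrite eq_sym (negPf ac) eq_sym (negPf bc).
Qed.

(** When a and c cross they are adjacent, so b lies on one side of both and has by then crossed
    exactly one of them. *)
Lemma between a b c : 0 < a < b -> b < c <= n.+1 ->
  (X a b < X a c /\ X a c < X b c) \/ (X b c < X a c /\ X a c < X a b).
Proof.
move=> hab hbc; set t := X a c.
have ht : t < N by apply: X_lt; lia.
have /andP [oa oc] : on_wire n w a t && on_wire n w c t by apply: X_on; lia.
have nb : ~~ on_wire n w b t.
  by apply/negP => ob; have := on_two oa oc _ ob; lia.
have e1 := @X_ix a b t; have e2 := @X_ix b c t.
have n1 : X a b != t by apply: X_neq; lia.
have n2 : X b c != t by rewrite /t XC [X a c]XC; apply: X_neq; lia.
have ra : 0 < a <= n.+1 by lia.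
have rb : 0 < b <= n.+1 by lia.
have rc : 0 < c <= n.+1 by lia.
move: oa oc nb; rewrite !on_wire_ix // => oa oc nb.
have hac : (ix t c < ix t a) = false by rewrite -X_ix ?ltnn //; lia.
have := @ix_inj n w Hw t a c ra rc.
have hl := letter_ok Hw ht.
lia.
Qed.

Lemma other_wireP t a : t < N -> on_wire n w a t ->
  let b := other_wire n w a t in
  [/\ 0 < b <= n.+1, b != a, on_wire n w b t & X a b = t].
Proof.
move=> ht oa; have [rL rR hLR] := wire_range Hw ht; rewrite /other_wire.
case: eqP => e /=.
  by split=> //; rewrite ?e 1?eq_sym // ?X_LR // /on_wire eqxx orbT.
have {e} ea : a = wireR n w t by move: oa; rewrite /on_wire; lia.
by split=> //; rewrite ?ea // ?(XC _ _ (wireR _ _ _)) ?X_LR // /on_wire eqxx.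
Qed.

Lemma other_wireE t a b : t < N -> a != b -> on_wire n w a t -> on_wire n w b t ->
  other_wire n w a t = b.
Proof. by rewrite /other_wire /on_wire => ht ab oa ob; case: eqP; lia. Qed.

End Red.

(** * Walks and string functionals *)

Section Next.
Variables (n : nat) (w : seq nat).
Notation N := (size w).
Notation on := (on_wire n w).
Notation next := (next_node n w).

Lemma next_up0 k a : a <= k -> next k a 0 = None.
Proof. by rewrite /next_node => ->. Qed.

(** One-step recursions in the current node, fit for sweeping the diagram node by node. *)
Lemma next_upS k a p : a <= k ->
  next k a p.+1 = if on a p then Some p else next k a p.
Proof.
move=> h; rewrite /next_node h -addn1 iotaD filter_cat /= add0n.
case: (on a p); last by rewrite cats0.
by case e: (_ ++ _) => [|x s]; [case: filter e | rewrite -e last_cat].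
Qed.

Lemma next_dnS k a p : k < a -> p.+1 < N ->
  next k a p = if on a p.+1 then Some p.+1 else next k a p.+1.
Proof.
move=> h hp; rewrite /next_node leqNgt h /= -(@subnSK p.+1) //=.
by case: ifP.
Qed.

Lemma next_dnN k a p : k < a -> N <= p.+1 -> next k a p = None.
Proof. by move=> h hp; rewrite /next_node leqNgt h /=; have -> : N - p.+1 = 0 by lia. Qed.

Lemma next_upP k a p : a <= k ->
  match next k a p with
  | Some j => [/\ j < p, on a j & forall t, j < t < p -> ~~ on a t]
  | None => forall t, t < p -> ~~ on a t
  end.
Proof.
move=> h; elim: p => [|p IH]; first by rewrite next_up0.
rewrite next_upS //; case: ifPn => hp.
  by split=> // t; lia.
case: next IH => [j [h1 h2 h3]|h1].
  split=> //; first by lia.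
  by move=> t ht; case: (ltngtP t p) => e; [apply: h3; lia | lia | rewrite e].
by move=> t ht; case: (ltngtP t p) => e; [apply: h1; lia | lia | rewrite e].
Qed.

Lemma next_dnP k a p : k < a ->
  match next k a p with
  | Some j => [/\ p < j < N, on a j & forall t, p < t < j -> ~~ on a t]
  | None => forall t, p < t < N -> ~~ on a t
  end.
Proof.
move=> h; move: {2}(N - p) (leqnn (N - p)) => d; elim: d p => [|d IH] p hd.
  by rewrite next_dnN; try lia; move=> t; lia.
case: (leqP N p.+1) => hp; first by rewrite next_dnN //; move=> t; lia.
rewrite next_dnS //; case: ifPn => hon.
  by split=> //; [lia | move=> t; lia].
have := IH p.+1; case: next => [j|] h1.
  have [h2 h3 h4] := h1 ltac:(lia); split=> //; first by lia.
  by move=> t ht; case: (eqVneq t p.+1) => [->//|e]; apply: h4; lia.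
by move=> t ht; case: (eqVneq t p.+1) => [->//|e]; apply: h1; lia.
Qed.

Lemma next_up_some k a p j : a <= k -> j < p -> on a j ->
  (forall t, j < t < p -> ~~ on a t) -> next k a p = Some j.
Proof.
move=> h hj oj hn; have := next_upP p h; case: next => [j' [h1 h2 h3]|]; last first.
  by move=> /(_ j hj); rewrite oj.
congr Some; apply/eqP; rewrite eqn_leq; apply/andP; split; rewrite leqNgt; apply/negP => e.
  by have := hn j'; rewrite h2; lia.
by have := h3 j; rewrite oj; lia.
Qed.

Lemma next_dn_some k a p j : k < a -> p < j < N -> on a j ->
  (forall t, p < t < j -> ~~ on a t) -> next k a p = Some j.
Proof.
move=> h hj oj hn; have := next_dnP p h; case: next => [j' [h1 h2 h3]|]; last first.
  by move=> /(_ j hj); rewrite oj.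
congr Some; apply/eqP; rewrite eqn_leq; apply/andP; split; rewrite leqNgt; apply/negP => e.
  by have := h3 j; rewrite oj; lia.
by have := hn j'; rewrite h2; lia.
Qed.

Lemma next_up_none k a p : a <= k -> (forall t, t < p -> ~~ on a t) -> next k a p = None.
Proof.
move=> h hn; have := next_upP p h; case: next => // j [h1 h2 _].
by have := hn j h1; rewrite h2.
Qed.

Lemma next_dn_none k a p : k < a -> (forall t, p < t < N -> ~~ on a t) -> next k a p = None.
Proof.
move=> h hn; have := next_dnP p h; case: next => // j [h1 h2 _].
by have := hn j h1; rewrite h2.
Qed.

Lemma next_some k a p j : p <= N -> next k a p = Some j -> j < N /\ on a j.
Proof.
move=> hp e; case: (leqP a k) => h.
  by have := next_upP p h; rewrite e => -[h1 h2 _]; split=> //; lia.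
by have := next_dnP p h; rewrite e => -[h1 h2 _]; split=> //; lia.
Qed.

(** A piece of wire ending at a node comes from a single node, so walks can be traced backwards. *)
Lemma next_inj k a p p' j : p < N -> p' < N -> on a p -> on a p' ->
  next k a p = Some j -> next k a p' = Some j -> p = p'.
Proof.
move=> hp hp' op op' e e'.
wlog lt : p p' hp hp' op op' e e' / p < p'.
  by move=> hw; case: (ltngtP p p') => h //; [apply: hw | apply/esym; apply: hw].
case: (leqP a k) => h.
  have := next_upP p h; rewrite e => -[h1 h2 _].
  by have := next_upP p' h; rewrite e' => -[_ _ /(_ p)]; rewrite op; lia.
have := next_dnP p' h; rewrite e' => -[h1 h2 _].
by have := next_dnP p h; rewrite e => -[_ _ /(_ p')]; rewrite op'; lia.
Qed.

Lemma next_none_inj k a p p' : p < N -> p' < N -> on a p -> on a p' ->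
  next k a p = None -> next k a p' = None -> p = p'.
Proof.
move=> hp hp' op op' e e'.
wlog lt : p p' hp hp' op op' e e' / p < p'.
  by move=> hw; case: (ltngtP p p') => h //; [apply: hw | apply/esym; apply: hw].
case: (leqP a k) => h.
  by have := next_upP p' h; rewrite e' => /(_ p lt); rewrite op.
by have := next_dnP p h; rewrite e => /(_ p'); rewrite op'; lia.
Qed.

Fixpoint rwb (k a p : nat) (s : seq (nat * nat)) : bool :=
  match s with
  | [::] => (a == k.+1) && (next k a p == None)
  | (j, a') :: s' =>
      [&& next k a p == Some j, (a' == a) || (a' == other_wire n w a j),
          (a' == a) ==> ~~ forbidden_straight n w k a j & rwb k a' j s']
  end.

Lemma rwP k a p s : reflect (rig_walk n w k a p s) (rwb k a p s).
Proof.
elim: s a p => [|[j a'] s IH] a p /=.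
  by apply: (iffP andP) => -[/eqP -> /eqP ->].
apply: (iffP and4P) => [[/eqP h1 h2 /implyP h3 /IH h4]|[h1 h2 h3 /IH h4]].
  split=> //; first by case/orP: h2 => /eqP ->; [left|right].
  by move=> e; apply: h3; apply/eqP.
split=> //; first exact/eqP.
  by case: h2 => ->; rewrite eqxx ?orbT.
by apply/implyP => /eqP; apply: h3.
Qed.

Definition rigb (P : nat * seq (nat * nat)) : bool :=
  [&& 1 <= P.1 <= n, uniq (map fst P.2) & rwb P.1 P.1 N P.2].

Lemma rigP k s : reflect (rigorous n w k s) (rigb (k, s)).
Proof. by apply: (iffP and3P) => [[h1 h2 /rwP]|[h1 h2 /rwP]]. Qed.

Fixpoint allseqs (T : Type) (m : nat) (l : seq T) : seq (seq T) :=
  if m is m'.+1 then [seq x :: s | x <- l, s <- allseqs m' l] else [:: [::]].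

Lemma mem_allseqs (T : eqType) (l s : seq T) : all (mem l) s -> s \in allseqs (size s) l.
Proof.
elim: s => //= x s IH /andP [hx hs].
by apply/allpairsP; exists (x, s); rewrite hx IH.
Qed.

End Next.

Section Walk.
Variables (n : nat) (w : seq nat).
Hypothesis Hr : red n w.
Let Hw : letters_ok n w. Proof. by case: Hr. Qed.
Notation N := (size w).
Notation X := (crossing n w).
Notation on := (on_wire n w).
Notation next := (next_node n w).
Notation walk := (rig_walk n w).

Lemma walk_nodes k a p s : p <= N -> walk k a p s ->
  forall j a', (j, a') \in s -> j < N /\ on a' j.
Proof.
elim: s a p => [|[j a'] s IH] a p //= hp [h1 h2 _ h4] j1 a1.
have [hj oj] := next_some hp h1.
rewrite inE => /orP [/eqP [-> ->]|]; last by apply: (IH a' j) => //; lia.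
split=> //; case: h2 => -> //; by have [] := other_wireP Hr hj oj.
Qed.

(** Nodes are passed at most once, so a path is a list of length at most N over a finite
    alphabet. *)
Lemma gp_enum : exists G : seq (nat * seq (nat * nat)),
  uniq G /\ forall k s, rigorous n w k s <-> (k, s) \in G.
Proof.
pose al := [seq (j, a) | j <- iota 0 N, a <- iota 0 n.+2].
pose S := flatten [seq allseqs m al | m <- iota 0 N.+1].
exists (undup [seq P <- [seq (k, s) | k <- iota 0 n.+1, s <- S] | rigb n w P]).
split=> [|k s]; first exact: undup_uniq.
rewrite mem_undup mem_filter; split=> [h|/andP [/rigP] //].
apply/andP; split; first exact/rigP.
case: h => hk hu hwk; apply/allpairsP; exists (k, s); split=> //; first by rewrite mem_iota /=; lia.
have hn := walk_nodes (leqnn N) hwk.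
apply/flattenP; exists (allseqs (size s) al).
  apply/mapP; exists (size s) => //; rewrite mem_iota add0n ltnS /=.
  rewrite -(size_map fst) -(size_iota 0 N); apply: uniq_leq_size => // x /mapP [[j a] h ->].
  by have [h1 _] := hn j a h; rewrite mem_iota add0n.
apply/mem_allseqs/allP => -[j a] h; have [h1 h2] := hn j a h.
have rg := on_wire_range Hw h1 h2.
by apply/allpairsP; exists (j, a); rewrite !mem_iota; split=> //=; lia.
Qed.

Lemma LR_of j a b : j < N -> on a j -> on b j -> a < b ->
  wireL n w j = a /\ wireR n w j = b.
Proof. by move=> hj; have := ltLR Hr hj; rewrite /on_wire; lia. Qed.

Lemma LR_other j a a' : j < N -> on a j -> a' = a \/ a' = other_wire n w a j -> on a' j.
Proof. by move=> hj oj [->|->] //; have [] := other_wireP Hr hj oj. Qed.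

End Walk.

Local Open Scope ring_scope.

(** The string functional with coordinates given by an arbitrary function, so that potentials,
    multiples and renumbered coordinates can be substituted. *)
Fixpoint gs (R : zmodType) (f : nat -> R) (a : nat) (s : seq (nat * nat)) : R :=
  match s with
  | [::] => 0
  | (j, a') :: s' => (if a' == a then 0 else if (a < a')%N then f j else - f j) + gs f a' s'
  end.

Lemma sval_gs (R : realFieldType) m (x : 'rV[R]_m) a s : Defs.sval x a s = gs (tc x) a s.
Proof. by elim: s a => [|[j a'] s IH] a //=; rewrite IH. Qed.

Lemma gsD (R : zmodType) (f g : nat -> R) a s :
  gs (fun t => f t + g t) a s = gs f a s + gs g a s.
Proof.
elim: s a => [|[j a'] s IH] a /=; first by rewrite addr0.
by rewrite IH addrACA; congr (_ + _); case: ifP => _; [rewrite addr0 | case: ifP => // _; rewrite opprD].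
Qed.

Lemma gsZ (R : pzRingType) (c : R) (f : nat -> R) a s :
  gs (fun t => c * f t) a s = c * gs f a s.
Proof.
elim: s a => [|[j a'] s IH] a /=; first by rewrite mulr0.
by rewrite IH mulrDr; congr (_ + _); case: ifP => _; [rewrite mulr0 | case: ifP => // _; rewrite mulrN].
Qed.

Lemma eq_gs (R : zmodType) (f g : nat -> R) a s :
  (forall j a', (j, a') \in s -> f j = g j) -> gs f a s = gs g a s.
Proof.
elim: s a => [|[j a'] s IH] a //= h; rewrite (h j a') ?mem_head // (IH a') //.
by move=> j1 a1 h1; apply: (h j1 a1); rewrite inE h1 orbT.
Qed.

Section Potential.
Variables (n : nat) (w : seq nat) (R : realFieldType).
Hypothesis Hr : red n w.
Let Hw : letters_ok n w. Proof. by case: Hr. Qed.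
Notation N := (size w).
Notation on := (on_wire n w).
Notation next := (next_node n w).
Notation walk := (rig_walk n w).

(* A potential on each wire turns the string functional into the total increase
   of the potential along the pieces of wire that the walk traverses. *)
Lemma gs_step (F : nat -> nat -> R) a a' j : (j < N)%N -> on a j ->
  a' = a \/ a' = other_wire n w a j ->
  (if a' == a then 0 else
   if (a < a')%N then F (wireL n w j) j - F (wireR n w j) j
   else - (F (wireL n w j) j - F (wireR n w j) j)) = F a j - F a' j.
Proof.
move=> hj oj [->|e]; first by rewrite eqxx subrr.
have [ra na oa' _] := other_wireP Hr hj oj; rewrite -e in ra na oa'.
rewrite (negPf na); case: ltnP => h.
  by have [-> ->] := LR_of Hr hj oj oa' h.
by have [|-> ->] := LR_of Hr hj oa' oj; [rewrite ltn_neqAle na | rewrite opprB].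
Qed.

Lemma gs_const (c : nat -> R) k a p s : (p <= N)%N -> walk k a p s ->
  gs (fun t => c (wireR n w t) - c (wireL n w t)) a s = c k.+1 - c a.
Proof.
elim: s a p => [|[j a'] s IH] a p hp /=; first by case=> ->; rewrite subrr.
move=> [h1 h2 _ h4]; have [hj oj] := next_some hp h1.
rewrite (IH a' j) //; last exact: ltnW.
have := gs_step (fun a _ => - c a) hj oj h2.
by rewrite opprK [- _ + _]addrC => ->; ring.
Qed.

Variable S : seq (nat * nat).
Variable k : nat.

Fixpoint nsteps (a : nat) (s : seq (nat * nat)) : nat :=
  if s is (j, a') :: s' then ((a, j) \notin S) + nsteps a' s' else 0%N.

Definition cnt a (i j : nat) := count (fun u => on a u && ((a, u) \notin S)) (iota i (j - i)).

Lemma cnt_split a i j l : (i <= j)%N -> (j <= l)%N -> cnt a i l = (cnt a i j + cnt a j l)%N.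
Proof.
move=> h1 h2; rewrite /cnt -count_cat; congr count.
by rewrite -[X in iota X (l - j)](subnKC h1) -iotaD; congr iota; lia.
Qed.

Lemma cnt0 a i j : (forall t, (i <= t < j)%N -> ~~ on a t) -> cnt a i j = 0%N.
Proof.
move=> h; apply/eqP; rewrite -leqn0 leqNgt -has_count; apply/hasPn => t.
by rewrite mem_iota => ht; rewrite negb_and h //; lia.
Qed.

Lemma cnt1 a j : on a j -> cnt a j j.+1 = ((a, j) \notin S).
Proof. by move=> h; rewrite /cnt subSnn /= h addn0. Qed.

(** A pair [(a, j)] names the piece of wire a arriving at node j in its orientation. The potential
    counts the pieces outside [S] from the start of the wire, which is its lower end if it is
    oriented upward and its upper end otherwise. *)
Definition pot (a t : nat) : R := (if (a <= k)%N then cnt a t N else cnt a 0 t.+1)%:R.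

(** The second alternative is the start of the path, at the lower end of wire k. *)
Definition state a p := ((p < N)%N /\ on a p) \/ (a = k /\ p = N).

Lemma pot_next a p j : state a p -> next k a p = Some j ->
  pot a j = pot a p + ((a, j) \notin S)%:R.
Proof.
move=> hst hn; have hp : (p <= N)%N by case: hst => [[/ltnW]|[_ ->]].
have [hj oj] := next_some hp hn.
rewrite /pot -natrD; congr _%:R; case: leqP => h.
  have := next_upP n w p h; rewrite hn => -[h1 h2 h3].
  rewrite (@cnt_split a j j.+1 N) // cnt1 // (@cnt_split a j.+1 p N) //.
  by rewrite (@cnt0 a j.+1 p) // add0n addnC.
have := next_dnP n w p h; rewrite hn => -[h1 h2 h3].
rewrite (@cnt_split a 0 j j.+1) // cnt1 // (@cnt_split a 0 p.+1 j) //; last by lia.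
by rewrite (@cnt0 a p.+1 j) ?addn0.
Qed.

Lemma pot_end p : state k.+1 p -> next k k.+1 p = None -> pot k.+1 p = (cnt k.+1 0 N)%:R.
Proof.
move=> [[hp op]|[]]; last by lia.
move=> hn; rewrite /pot ltnn; congr _%:R; rewrite (@cnt_split k.+1 0 p.+1 N) //.
rewrite (@cnt0 k.+1 p.+1 N) ?addn0 //.
by have := @next_dnP n w k k.+1 p (ltnSn k); rewrite hn.
Qed.

(** Every walk arrives with the full count of wire [k.+1], whatever its last node. So for a given
    start the functional is the number of pieces outside [S] up to a constant. *)
Lemma gs_pot a p s : state a p -> walk k a p s ->
  gs (fun t => pot (wireL n w t) t - pot (wireR n w t) t) a s
  = (nsteps a s)%:R + pot a p - (cnt k.+1 0 N)%:R.
Proof.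
elim: s a p => [|[j a'] s IH] a p hst /=.
  by case=> e hn; rewrite e in hst hn *; rewrite (pot_end hst hn) add0r subrr.
move=> [h1 h2 _ h4].
have hp : (p <= N)%N by case: hst => [[/ltnW]|[_ ->]].
have [hj oj] := next_some hp h1.
rewrite (IH a' j) //; last by left; split=> //; apply: LR_other oj h2.
by rewrite (gs_step pot) // (pot_next hst h1) natrD; ring.
Qed.

End Potential.

Local Close Scope ring_scope.

(** * Facets of the string cone and of the string polytope *)

Section Determinism.
Variables (n : nat) (w : seq nat).
Hypothesis Hr : red n w.
Let Hw : letters_ok n w. Proof. by case: Hr. Qed.
Notation N := (size w).
Notation on := (on_wire n w).
Notation next := (next_node n w).
Notation walk := (rig_walk n w).

Fixpoint segs (a : nat) (s : seq (nat * nat)) : seq (nat * nat) :=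
  if s is (j, a') :: s' then (a, j) :: segs a' s' else [::].

Lemma seg_origin k a p s (b j : nat) : walk k a p s -> (b, j) \in segs a s ->
  (b = a /\ next k a p = Some j) \/ exists j' : nat, (j', b) \in s /\ next k b j' = Some j.
Proof.
elim: s a p => [|[j1 a1] s IH] a p //= [h1 h2 _ h4].
rewrite inE => /orP [/eqP [-> ->]|]; first by left.
move=> /(IH _ _ h4) [[-> h]|[j' [h5 h6]]]; right.
  by exists j1; rewrite mem_head.
by exists j'; rewrite inE h5 orbT.
Qed.

Lemma end_origin k a p s : walk k a p s ->
  (a = k.+1 /\ s = [::]) \/ exists j : nat, (j, k.+1) \in s /\ next k k.+1 j = None.
Proof.
elim: s a p => [|[j1 a1] s IH] a p /=; first by case; left.
move=> [_ _ _ h4]; right; have [[e s0]|[j [h5 h6]]] := IH _ _ h4.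
  by move: h4; rewrite s0 e => -[_ h]; exists j1; rewrite mem_head.
by exists j; rewrite inE h5 orbT.
Qed.

Lemma node_once (s : seq (nat * nat)) (j a b : nat) : uniq (map fst s) ->
  (j, a) \in s -> (j, b) \in s -> a = b.
Proof.
elim: s => //= -[j1 a1] s IH /= /andP [h hu]; rewrite !inE.
have nin (c : nat) : (j1, c) \in s -> False.
  by move=> hc; case/negP: h; apply/mapP; exists (j1, c).
case/orP => [/eqP [e1 e2]|h1] /orP [/eqP [e3 e4]|h2].
- by rewrite e2 e4.
- by rewrite e1 in h2; case: (nin b).
- by rewrite e3 in h1; case: (nin a).
- exact: IH.
Qed.

(* A node of a rigorous path is left along one wire only, so a walk using no
   other pieces of wire than the path cannot branch off. *)
Lemma nsteps_eq0 k s0 a p s s' : rigorous n w k s0 -> state n w k a p ->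
  {subset s <= s0} -> walk k a p s -> walk k a p s' ->
  nsteps (segs k s0) a s' = 0 -> s = s'.
Proof.
move=> [hk hu hw0]; have hn0 := walk_nodes Hr (leqnn N) hw0.
elim: s a p s' => [|[j a1] s IH] a p s' hst hsub.
  move=> /= [e hnone]; case: s' => [|[j a2] s'] //= [h _ _ _]; by rewrite h in hnone.
case: s' => [|[j' a2] s2] /=; first by move=> [h1 _ _ _] [_ h2]; rewrite h1 in h2.
move=> [h1 h2 h3 h4] [h1' h2' h3' h4'] hsteps.
have {h1'} ej : j = j' by move: h1'; rewrite h1 => -[].
rewrite -{j'}ej in h2' h3' h4' hsteps *.
have hp : p <= N by case: hst => [[/ltnW]|[_ ->]].
have [hj oj] := next_some hp h1.
have oa1 := LR_other Hr hj oj h2; have oa2 := LR_other Hr hj oj h2'.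
have in0 : (j, a1) \in s0 by apply: hsub; rewrite mem_head.
suff ea : a1 = a2.
  rewrite -{a2}ea in h2' h3' h4' hsteps oa2 *; congr (_ :: _); apply: IH h4 h4' _.
  - by left.
  - by move=> x hx; apply: hsub; rewrite inE hx orbT.
  - by move: hsteps; lia.
case: s2 h4' hsteps => [|[j2 a3] s2] /=.
  move=> [e hnone] _; rewrite e in hnone oa2 *.
  have [[ek _]|[j1 [hj1 hn1]]] := end_origin hw0; first by lia.
  have [lj1 oj1] := hn0 _ _ hj1.
  have ejj := next_none_inj lj1 hj oj1 oa2 hn1 hnone.
  by rewrite ejj in hj1; apply: node_once hu in0 hj1.
move=> [hn2 _ _ _] hsteps.
have hin : (a2, j2) \in segs k s0 by case: ((a2, j2) \in segs k s0) hsteps => //=; lia.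
have [[ek hnN]|[j1 [hj1 hn1]]] := seg_origin hw0 hin.
  (* The piece leaving the lower end of wire k cannot also leave node j: it would have to stop at j,
     which lies on k. *)
  have hak : a2 <= k by rewrite ek.
  have := next_upP n w j hak; rewrite hn2 => -[l1 _ _].
  have oj' : on k j by rewrite -ek.
  have := next_upP n w N (leqnn k); rewrite hnN => -[_ _ /(_ j)].
  by rewrite oj' l1 hj => /(_ isT).
have [lj1 oj1] := hn0 _ _ hj1.
have ejj := next_inj lj1 hj oj1 oa2 hn1 hn2.
by rewrite ejj in hj1; apply: node_once hu in0 hj1.
Qed.

Lemma nsteps_self S a s : {subset segs a s <= S} -> nsteps S a s = 0.
Proof.
elim: s a => [|[j a'] s IH] a //= h; rewrite h ?mem_head // IH // => x hx.
by apply: h; rewrite inE hx orbT.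
Qed.

End Determinism.

Local Open Scope ring_scope.

Definition vec (R : realFieldType) m (f : nat -> R) : 'rV[R]_m := \row_(i < m) f i.

Lemma tc_vec (R : realFieldType) m (f : nat -> R) j : (j < m)%N -> tc (vec m f) j = f j.
Proof. by move=> h; rewrite /tc insubT mxE. Qed.

Lemma tc_dotv (R : realFieldType) m j : exists v : 'rV[R]_m, forall x, tc x j = dotv v x.
Proof.
rewrite /tc; case: insubP => [i hi ei|_]; last by exists 0 => x; rewrite dotv0l.
exists (delta_mx 0 i) => x; rewrite /dotv (bigD1 i) //= !mxE !eqxx mul1r big1 ?addr0 //.
by move=> k hk; rewrite !mxE (negPf hk) mul0r.
Qed.

Lemma dotvDl (R : realFieldType) m (u v x : 'rV[R]_m) : dotv (u + v) x = dotv u x + dotv v x.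
Proof. by rewrite !(dotvC _ x) dotvDr. Qed.

Lemma dotvZl (R : realFieldType) m c (v x : 'rV[R]_m) : dotv (c *: v) x = c * dotv v x.
Proof. by rewrite !(dotvC _ x) dotvZr. Qed.

Lemma gs_dotv (R : realFieldType) m a s :
  exists v : 'rV[R]_m, forall x, gs (tc x) a s = dotv v x.
Proof.
elim: s a => [|[j a'] s IH] a /=; first by exists 0 => x; rewrite dotv0l.
have [v hv] := IH a'; have [u hu] := tc_dotv R m j.
exists ((if a' == a then 0 else if (a < a')%N then 1 else -1) *: u + v) => x.
rewrite hv dotvDl dotvZl -hu; case: ifP => _; first by rewrite mul0r.
by case: ifP => _; rewrite ?mul1r ?mulN1r.
Qed.

Section Cone.
Variables (n : nat) (w : seq nat) (R : realFieldType).
Hypothesis Hr : red n w.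
Let Hw : letters_ok n w. Proof. by case: Hr. Qed.
Let Hsz : size w = NN n. Proof. by case: Hr. Qed.
Notation N := (size w).

Definition wpot (c : nat -> R) (t : nat) : R := c (wireR n w t) - c (wireL n w t).

(** As wire potential it gives every path of G(i,k) the value [d k], and the values for different k
    can be chosen independently. *)
Definition cum (d : nat -> R) (m : nat) : R := \sum_(1 <= i < m) d i.

Lemma cumS d k : (0 < k)%N -> cum d k.+1 - cum d k = d k.
Proof. by move=> h; rewrite /cum big_nat_recr //= [X in X - _]addrC addrK. Qed.

Lemma gs_wpot d k s : rigorous n w k s -> gs (wpot (cum d)) k s = d k.
Proof. by move=> [hk _ h]; rewrite (gs_const Hr _ (leqnn _) h) cumS //; lia. Qed.

(* The functional counts the pieces of wire of a path that lie outside the given one. *)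
Lemma nonredundant (G : seq (nat * seq (nat * nat))) k s :
  (forall k s, rigorous n w k s <-> (k, s) \in G) -> rigorous n w k s ->
  exists f : nat -> R, gs f k s = 0 /\
    forall k' s', rigorous n w k' s' -> (k', s') <> (k, s) -> 0 < gs f k' s'.
Proof.
move=> hG hP; have [hk hu hw0] := hP.
pose S := segs k s.
pose f0 t : R := pot n w R S k (wireL n w t) t - pot n w R S k (wireR n w t) t.
pose B : R := \sum_(Q <- G) `|gs f0 Q.1 Q.2| + 1.
(* For index k this cancels the constant of [gs_pot]; for every other index the shift [B] exceeds
   all absolute values of [f0] on paths. *)
pose d i : R := if i == k then (cnt n w S k.+1 0 N)%:R else B.
exists (fun t => f0 t + wpot (cum d) t).
have stN : state n w k k N by right.
have val s' : rigorous n w k s' ->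
    gs (fun t => f0 t + wpot (cum d) t) k s' = (nsteps S k s')%:R.
  move=> h; have [_ _ h1] := h.
  rewrite gsD (gs_wpot _ h) /d eqxx /f0 (gs_pot _ Hr S stN h1).
  by rewrite /pot leqnn /cnt subnn /= addr0 subrK.
split; first by rewrite val // nsteps_self.
move=> k' s' h ne; case: (eqVneq k' k) => [ek|ek].
  rewrite ek in h ne *; rewrite val // ltr0n lt0n; apply/eqP => h0.
  by case: ne; congr (_, _); apply/esym; apply: (nsteps_eq0 Hr hP stN _ hw0) h0 => //; case: h.
rewrite gsD (gs_wpot _ h) /d (negPf ek) /B addrA.
apply: ltr_wpDl => //; rewrite -lerBlDl sub0r.
have hin : (k', s') \in G by apply/hG.
rewrite (big_rem (k', s')) //=.
have h1 : - gs f0 k' s' <= `|gs f0 k' s'| by rewrite -normrN ler_norm.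
by apply: le_trans h1 _; rewrite lerDl; apply: sumr_ge0.
Qed.

Lemma tc_ltN m (x : 'rV[R]_m) (f : nat -> R) k s : m = N -> rigorous n w k s ->
  (forall j, (j < m)%N -> tc x j = f j) -> gs (tc x) k s = gs f k s.
Proof.
move=> em [_ _ h] hx; apply: eq_gs => j a' hin; apply: hx; rewrite em.
by have [] := walk_nodes Hr (leqnn N) h hin.
Qed.

Lemma gs_vec (f : nat -> R) k s : rigorous n w k s -> gs (tc (vec (NN n) f)) k s = gs f k s.
Proof. by move=> h; apply: (tc_ltN _ h) => // j hj; rewrite tc_vec. Qed.

Section Enum.
Variable G : seq (nat * seq (nat * nat)).
Hypotheses (uG : uniq G) (hG : forall k s, rigorous n w k s <-> (k, s) \in G).

Let P0 : nat * seq (nat * nat) := (0%N, [::]).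
Let Gi (i : 'I_(size G)) := nth P0 G i.

Lemma GiP i : rigorous n w (Gi i).1 (Gi i).2.
Proof. by apply/hG; rewrite -surjective_pairing mem_nth. Qed.

Lemma Gi_inj i j : i != j -> ((Gi i).1, (Gi i).2) <> ((Gi j).1, (Gi j).2).
Proof.
move=> h; rewrite -!surjective_pairing => e; case/negP: h; apply/eqP/val_inj/eqP => /=.
by have := nth_uniq P0 (ltn_ord i) (ltn_ord j) uG; rewrite -/(Gi i) -/(Gi j) e eqxx => <-.
Qed.

Lemma coneE (x : 'rV[R]_(NN n)) :
  string_cone w x <-> forall i, 0 <= gs (tc x) (Gi i).1 (Gi i).2.
Proof.
split=> [h i|h k s hks]; first by rewrite -sval_gs; apply/h/GiP.
have hin : (k, s) \in G by apply/hG.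
have hi : (index (k, s) G < size G)%N by rewrite index_mem.
by have := h (Ordinal hi); rewrite /Gi /= nth_index // sval_gs.
Qed.

Lemma cone_point i : exists f : nat -> R, gs f (Gi i).1 (Gi i).2 = 0 /\
  forall j, j != i -> 0 < gs f (Gi j).1 (Gi j).2.
Proof.
have [f [h1 h2]] := nonredundant hG (GiP i); exists f; split=> // j hj.
by apply: h2; [apply: GiP | apply: Gi_inj].
Qed.

Lemma cone_facets (n_gt0 : (0 < n)%N) k :
  has_facets (@string_cone R n w) k <-> k = size G.
Proof.
have [z hz] := fin_all_exists cone_point.
(* At the interior point chosen here every string functional takes the value 1. *)
have := @polyhedron_has_facets R (NN n) 'I_(size G)
  (fun i x => gs (tc x) (Gi i).1 (Gi i).2) (@string_cone R n w)
  (vec _ (wpot (cum (fun=> 1)))) (fun i => vec _ (z i)).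
rewrite card_ord; apply.
- by rewrite /NN; case: n n_gt0 => // m _; rewrite mulSn; lia.
- move=> i; have [v hv] := gs_dotv R (NN n) (Gi i).1 (Gi i).2.
  exists (- v), 0 => x; rewrite hv sub0r -scaleN1r dotvZl; ring.
- exact: coneE.
- by move=> i; rewrite gs_vec ?gs_wpot //; apply: GiP.
- by move=> i; rewrite gs_vec; [case: (hz i) | apply: GiP].
- by move=> i j hj; rewrite gs_vec; [case: (hz i) => _; apply | apply: GiP].
Qed.
End Enum.
End Cone.

(** * The lambda-inequalities *)

Lemma small_eps (R : realFieldType) (T : eqType) (l : seq T) (A B : T -> R) :
  (forall i, i \in l -> 0 < A i) ->
  exists2 e : R, 0 < e & forall i e', i \in l -> 0 < e' -> e' <= e -> 0 < A i + e' * B i.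
Proof.
elim: l => [|x l IH] h; first by exists 1.
have [|e e0 he] := IH; first by move=> i hi; apply: h; rewrite inE hi orbT.
have Ax : 0 < A x by apply: h; rewrite mem_head.
have B1 : 0 < `|B x| + 1 by apply: ltr_wpDl.
exists (Num.min e (A x / (`|B x| + 1))); first by rewrite lt_min e0 divr_gt0.
move=> i e'; rewrite inE le_min => /orP [/eqP ->|hi] e'0 /andP [h1 h2]; last exact: he.
have h3 : e' * (`|B x| + 1) <= A x by rewrite -ler_pdivlMr.
have h4 : e' * - B x <= e' * `|B x| by rewrite ler_pM2l // -normrN ler_norm.
by move: h3 h4; rewrite mulrDr mulrN; lra.
Qed.

Section Polytope.
Variables (n : nat) (w : seq nat) (R : realFieldType) (lam : nat -> nat).
Hypothesis Hr : red n w.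
Let Hw : letters_ok n w. Proof. by case: Hr. Qed.
Let Hsz : size w = NN n. Proof. by case: Hr. Qed.
Notation N := (size w).
Hypothesis lam_gt0 : forall i, (1 <= i <= n)%N -> (0 < lam i)%N.

Definition lhom (j : nat) (f : nat -> R) : R :=
  \sum_(j.+1 <= k < N) lam_coef R w j k * f k - f j.
Definition lslack j f : R := (lam (nth 0%N w j))%:R + lhom j f.

Lemma lhomD j f g c : lhom j (fun t => f t + c * g t) = lhom j f + c * lhom j g.
Proof.
rewrite /lhom (eq_bigr (fun k => lam_coef R w j k * f k + c * (lam_coef R w j k * g k))); last first.
  by move=> k _; ring.
by rewrite big_split /= -mulr_sumr; ring.
Qed.

Lemma eq_lhom j f g : (j < N)%N -> (forall t, (t < N)%N -> f t = g t) -> lhom j f = lhom j g.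
Proof.
move=> hj h; rewrite /lhom h //; congr (_ - _); apply: eq_big_nat => k hk.
by rewrite h //; lia.
Qed.

(** The system is triangular with -1 on the diagonal, hence solvable from the last node backwards;
    slacks can thus be prescribed. *)
Lemma lhom_solve (b : nat -> R) : exists y, forall j, (j < N)%N -> lhom j y = b j.
Proof.
suff H m : (m <= N)%N -> exists y, forall j, (N - m <= j < N)%N -> lhom j y = b j.
  by have [y hy] := H N (leqnn N); exists y => j hj; apply: hy; rewrite subnn.
elim: m => [|m IH] hm; first by exists (fun=> 0) => j; lia.
have [y hy] := IH (ltnW hm).
pose j0 := (N - m.+1)%N.
pose v := \sum_(j0.+1 <= k < N) lam_coef R w j0 k * y k - b j0.
exists (fun t => if t == j0 then v else y t) => j hj.
have tail i : (j0 <= i)%N -> \sum_(i.+1 <= k < N) lam_coef R w i k * (if k == j0 then v else y k)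
    = \sum_(i.+1 <= k < N) lam_coef R w i k * y k.
  by move=> hi; apply: eq_big_nat => k hk; rewrite gtn_eqF //; lia.
case: (eqVneq j j0) => [->|hne].
  by rewrite /lhom tail // eqxx /v; ring.
rewrite -(hy j); last by rewrite /j0 in hne; lia.
by rewrite /lhom tail ?(negPf hne) //; rewrite /j0 in hne *; lia.
Qed.

(** Reversed because at the bottom positions a and a+1 are held by wires n+2-a and n+1-a. *)
Definition lamc (i : nat) : R := (lam (n.+1 - i)%N)%:R.

(* At [t := j.+1] and [a] the letter of node [j] this says that the lambda-inequality
   of every node is tight at the point given by the wire weights [cum lamc]. *)
Lemma wpot_weights t a : (t <= N)%N -> (0 < a <= n)%N ->
  (lam a)%:R + \sum_(t <= k < N)
    (let b := nth 0%N w k in if a == b then -2 else if (a == b.+1) || (b == a.+1) then 1 else 0)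
      * wpot n w (cum lamc) k
  = cum lamc (nth 0%N (conf n w t) a.-1) - cum lamc (nth 0%N (conf n w t) a) :> R.
Proof.
move=> ht ha; move: {2}(N - t)%N (erefl (N - t)%N) => d.
elim: d t ht => [|d IH] t ht hd.
  have -> : t = N by lia.
  rewrite big_geq // addr0; have [_ _ ->] := Hr.
  rewrite !nth_rev ?size_iota ?nth_iota; try lia.
  have -> : (1 + (n.+1 - a.-1.+1) = (n.+1 - a).+1)%N by lia.
  have -> : (1 + (n.+1 - a.+1) = n.+1 - a)%N by lia.
  rewrite cumS /lamc; last by lia.
  by congr (lam _)%:R; lia.
have ht' : (t < N)%N by lia.
(* The coefficients -2, 1, 0 are negated Cartan integers: moving up past a node with letter b
   applies the simple reflection of b to the differences of neighbouring potentials. *)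
rewrite big_ltn // addrCA (IH t.+1); try lia.
have hl := letter_ok Hw ht'; set b := nth 0%N w t in hl *.
rewrite confS // !nth_swap_pos ?size_conf //; try lia.
rewrite -/b /wpot /wireL /wireR -/b.
have t1 := tauP b.-1 b a.-1; have t2 := tauP b.-1 b a.
case: (eqVneq a b) => [e|ne].
  have -> : tau b.-1 b a.-1 = b by lia.
  have -> : tau b.-1 b a = b.-1 by lia.
  rewrite e; ring.
case: (eqVneq a b.+1) => [e|ne2] /=.
  have -> : tau b.-1 b a.-1 = b.-1 by lia.
  have -> : tau b.-1 b a = a by lia.
  have -> : a.-1 = b by lia.
  ring.
case: (eqVneq b a.+1) => [e|ne3].
  have -> : tau b.-1 b a.-1 = a.-1 by lia.
  have -> : tau b.-1 b a = b by lia.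
  have -> : b.-1 = a by lia.
  ring.
have -> : tau b.-1 b a.-1 = a.-1 by lia.
have -> : tau b.-1 b a = a by lia.
ring.
Qed.

(** Just after node j its two wires have exchanged positions, so the right side of [wpot_weights]
    becomes the coordinate of the node itself. *)
Lemma lslack_wpot j : (j < N)%N -> lslack j (wpot n w (cum lamc)) = 0.
Proof.
move=> hj; rewrite /lslack /lhom addrA.
have hl := letter_ok Hw hj.
have -> := @wpot_weights j.+1 (nth 0%N w j) hj hl.
rewrite confS // !nth_swap_pos ?size_conf //; try lia.
have t1 := tauP (nth 0%N w j).-1 (nth 0%N w j) (nth 0%N w j).-1.
have t2 := tauP (nth 0%N w j).-1 (nth 0%N w j) (nth 0%N w j).
have -> : tau (nth 0%N w j).-1 (nth 0%N w j) (nth 0%N w j).-1 = nth 0%N w j by lia.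
have -> : tau (nth 0%N w j).-1 (nth 0%N w j) (nth 0%N w j) = (nth 0%N w j).-1 by lia.
by rewrite subrr.
Qed.

Lemma lam_ineqsE (x : 'rV[R]_(NN n)) :
  lam_ineqs w lam x <-> forall j : 'I_(NN n), 0 <= lslack j (tc x).
Proof.
have e j : lslack j (tc x) = (lam (nth 0%N w j))%:R + \sum_(j.+1 <= k < NN n) lam_coef R w j k * tc x k - tc x j.
  by rewrite /lslack /lhom addrA Hsz.
split=> [h j|h j hj]; first by rewrite e subr_ge0; apply: h.
by rewrite -subr_ge0 -e; apply: (h (Ordinal hj)).
Qed.

Lemma lslack_affine j : affine (fun x : 'rV[R]_(NN n) => lslack j (tc x)).
Proof.
suff [v hv] : exists v : 'rV[R]_(NN n), forall x, lhom j (tc x) = dotv v x.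
  by exists (- v), (lam (nth 0%N w j))%:R => x; rewrite /lslack hv -scaleN1r dotvZl; ring.
have [u hu] := tc_dotv R (NN n) j.
suff [v hv] : exists v : 'rV[R]_(NN n), forall x,
    \sum_(j.+1 <= k < N) lam_coef R w j k * tc x k = dotv v x.
  by exists (v + (-1) *: u) => x; rewrite /lhom hv hu dotvDl dotvZl mulN1r.
elim: (index_iota _ _) => [|k l [v hv]]; first by exists 0 => x; rewrite big_nil dotv0l.
have [u' hu'] := tc_dotv R (NN n) k.
by exists (lam_coef R w j k *: u' + v) => x; rewrite big_cons hv hu' dotvDl dotvZl.
Qed.

Section Enum.
Variable G : seq (nat * seq (nat * nat)).
Hypotheses (uG : uniq G) (hG : forall k s, rigorous n w k s <-> (k, s) \in G).
Let Gi (i : 'I_(size G)) := nth (0%N, [::]) G i.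

(** Where all lambda-inequalities are tight, the string functionals take the values [lamc k], which
    are positive. A small perturbation keeps them positive while the slacks follow [b]. *)
Lemma near_top_vertex (b : nat -> R) : exists e : R, 0 < e /\ exists f : nat -> R,
  (forall k s, rigorous n w k s -> 0 < gs f k s) /\
  (forall j, (j < N)%N -> lslack j f = e * b j).
Proof.
have [y hy] := lhom_solve b; pose v := wpot n w (cum lamc).
have [|e e0 he] := @small_eps R _ G (fun Q => gs v Q.1 Q.2) (fun Q => gs y Q.1 Q.2).
  move=> [k s] /hG h /=; rewrite /v (gs_wpot Hr _ h) /lamc ltr0n; apply: lam_gt0.
  by case: h; lia.
exists e; split=> //; exists (fun t => v t + e * y t); split=> [k s h|j hj].
  by rewrite gsD gsZ; apply: (he (k, s)) => //; apply/hG.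
by rewrite /lslack lhomD addrA -/(lslack j v) lslack_wpot // add0r hy.
Qed.

(** At the origin the slacks are the positive numbers [lam i], and every point of the cone can be
    scaled towards it. *)
Lemma near_origin (f : nat -> R) : exists e : R, 0 < e /\
  forall j, (j < N)%N -> 0 < lslack j (fun t => e * f t).
Proof.
have [|e e0 he] := @small_eps R _ (iota 0 N) (fun j => (lam (nth 0%N w j))%:R) (fun j => lhom j f).
  by move=> j; rewrite mem_iota => hj; rewrite ltr0n lam_gt0 //; apply: letter_ok.
exists e; split=> // j hj; have := he j e; rewrite mem_iota => /(_ hj e0 (lexx _)).
have -> // : lslack j (fun t => e * f t) = (lam (nth 0%N w j))%:R + e * lhom j f.
have := lhomD j (fun=> 0) f e; rewrite /lslack => h; congr (_ + _).
have e1 : lhom j (fun=> 0) = 0 by rewrite /lhom big1 ?subrr // => k _; rewrite mulr0.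
by move: h; rewrite e1 add0r => <-; rewrite /lhom add0r; under [in RHS]eq_bigr do rewrite add0r.
Qed.

Lemma polytope_facets (n_gt0 : (0 < n)%N) k :
  has_facets (@string_polytope R n w lam) k <-> k = (size G + NN n)%N.
Proof.
(* A string facet is found near the origin, a lambda-facet near the point where all
   lambda-inequalities are tight. *)
have Hpt (i : 'I_(size G) + 'I_(NN n)) : exists f : nat -> R,
    match i with
    | inl i => [/\ gs f (Gi i).1 (Gi i).2 = 0,
        forall j, j != i -> 0 < gs f (Gi j).1 (Gi j).2 &
        forall j : 'I_(NN n), 0 < lslack j f]
    | inr i => [/\ lslack i f = 0, forall j, 0 < gs f (Gi j).1 (Gi j).2 &
        forall j : 'I_(NN n), j != i -> 0 < lslack j f]
    end.
  case: i => i.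
    have [f [h1 h2]] := cone_point R Hr uG hG i; have [e [e0 he]] := near_origin f.
    exists (fun t => e * f t); split=> [|j hj|j]; rewrite ?gsZ.
    - by rewrite h1 mulr0.
    - by rewrite mulr_gt0 // h2.
    - by apply: he; rewrite Hsz.
  have [e [e0 [f [h1 h2]]]] := near_top_vertex (fun j => (j != i)%:R).
  exists f; split=> [|j|j hj]; rewrite ?h2 ?Hsz //.
  - by rewrite eqxx mulr0.
  - by apply: h1; apply: (GiP hG).
  - by rewrite (_ : (j != i :> nat)) ?mulr1.
have [z hz] := fin_all_exists Hpt.
have [e [e0 [f [h1 h2]]]] := near_top_vertex (fun=> 1).
have := @polyhedron_has_facets R (NN n) ('I_(size G) + 'I_(NN n))%type
  (fun i x => match i with inl i => gs (tc x) (Gi i).1 (Gi i).2 | inr j => lslack j (tc x) end)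
  (@string_polytope R n w lam) (vec _ f) (fun i => vec _ (z i)).
have lvec (j : 'I_(NN n)) g : lslack j (tc (vec (NN n) g)) = lslack j g.
  by rewrite /lslack; congr (_ + _); apply: eq_lhom; rewrite ?Hsz // => t ht; rewrite tc_vec.
have gvec (j : 'I_(size G)) (g : nat -> R) :
    gs (tc (vec (NN n) g)) (Gi j).1 (Gi j).2 = gs g (Gi j).1 (Gi j).2.
  by apply: (gs_vec Hr); apply: (GiP hG).
rewrite card_sum !card_ord; apply.
- by rewrite /NN; case: n n_gt0 => // m _; rewrite mulSn; lia.
- move=> [i|j]; last exact: lslack_affine.
  have [v hv] := gs_dotv R (NN n) (Gi i).1 (Gi i).2.
  exists (- v), 0 => x; rewrite hv sub0r -scaleN1r dotvZl; ring.
- move=> x; split=> [[/(coneE hG) h /lam_ineqsE h'] [i|j]|h]; first exact: h.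
    exact: h'.
  by split; [apply/(coneE hG) => i; apply: (h (inl i)) | apply/lam_ineqsE => j; apply: (h (inr j))].
- move=> [i|j]; first by rewrite gvec; apply: h1; apply: (GiP hG).
  by rewrite lvec h2 ?Hsz // mulr1.
- by move=> [i|j]; rewrite ?gvec ?lvec; [case: (hz (inl i)) | case: (hz (inr j))].
- move=> [i|i] [j|j] hij; rewrite ?gvec ?lvec.
  + by case: (hz (inl i)) => _ + _; apply; apply: contraNneq hij => ->.
  + by case: (hz (inl i)).
  + by case: (hz (inr i)).
  + by case: (hz (inr i)) => _ _; apply; apply: contraNneq hij => ->.
Qed.
End Enum.
End Polytope.

Local Close Scope ring_scope.

(** * Paths with one peak *)

Fixpoint inc (a : nat) (s : seq (nat * nat)) : nat :=
  if s is (_, a') :: s' then (a < a') + inc a' s' else 0.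

Lemma uniq_insert (l1 l2 : seq nat) t : uniq (l1 ++ l2) -> all (leq t.+1) (l1 ++ l2) ->
  uniq (l1 ++ t :: l2) /\ all (leq t) (l1 ++ t :: l2).
Proof.
move=> hu ha; have p : perm_eq (l1 ++ t :: l2) (t :: (l1 ++ l2)) by rewrite -cat1s perm_catCA.
rewrite (perm_uniq p) (perm_all _ p) /= hu leqnn andbT; split.
  by apply/negP => /(allP ha); rewrite ltnn.
by apply: sub_all ha => x; apply: ltnW.
Qed.

Section Peak.
Variables (n : nat) (w : seq nat).
Hypothesis Hr : red n w.
Let Hw : letters_ok n w. Proof. by case: Hr. Qed.
Notation N := (size w).
Notation X := (crossing n w).
Notation on := (on_wire n w).
Notation next := (next_node n w).
Notation walk := (rig_walk n w).

Lemma walk_up_skip k a t s : a <= k -> ~~ on a t -> walk k a t s -> walk k a t.+1 s.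
Proof. by move=> h ho; case: s => [|[j a'] s] /=; rewrite next_upS // (negPf ho). Qed.

Lemma walk_dn_skip k a t s : k < a -> 0 < t < N -> ~~ on a t -> walk k a t s -> walk k a t.-1 s.
Proof.
move=> h ht ho; have e : next k a t.-1 = next k a t.
  by rewrite (@next_dnS n w k a t.-1) ?prednK //; try lia; rewrite (negPf ho).
by case: s => [|[j a'] s] /=; rewrite e.
Qed.

Lemma later a b t : ~~ on a t -> 0 < a <= n.+1 -> 0 < b <= n.+1 ->
  (a == b) || (t <= X a b) -> (a == b) || (t < X a b).
Proof.
move=> ho ra rb; case: (eqVneq a b) => //= ab; rewrite leq_eqVlt => /orP [/eqP e|//].
by have /andP [o _] := X_on Hr ra rb ab; rewrite -e (negPf ho) in o.
Qed.

(* Sweeping from the bottom to time [t], the ascending part follows the larger and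
   the descending part the smaller wire at each crossing of equally oriented wires;
   they stay disjoint because their wires have already crossed. *)
Lemma greedy k t al de : 0 < k <= n -> t <= N -> 0 < al <= k -> k < de <= n.+1 ->
  X al de < t -> (al == k) || (t <= X al k) -> (de == k.+1) || (t <= X de k.+1) ->
  exists su sd,
  [/\ forall s, walk k al t s -> walk k k N (su ++ s),
      forall s, inc k (su ++ s) = inc al s,
      walk k de t.-1 sd /\ inc de sd = 0,
      uniq (map fst (su ++ sd)) &
      all (leq t) (map fst (su ++ sd))].
Proof.
move=> hk ht; move: {2}(N - t) (erefl (N - t)) => d.
elim: d t ht al de => [|d IH] t ht al de hd ral rde hX hal hde.
  have e : t = N by lia.
  have eal : al = k.
    by case/orP: hal => [/eqP //|]; have := @X_lt n w Hr al k; lia.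
  have ede : de = k.+1.
    by case/orP: hde => [/eqP //|]; have := @X_lt n w Hr de k.+1; lia.
  exists [::], [::]; split=> //.
  - by rewrite eal e.
  - by rewrite eal.
  - by split=> //=; rewrite next_dnN //; lia.
have ht' : t < N by lia.
have t0 : 0 < t by lia.
case: (boolP (on al t)) => oal.
  have [rb nb ob eX] := other_wireP Hr ht' oal; set al' := other_wire n w al t in rb nb ob eX.
  have ode : ~~ on de t.
    by apply/negP => o; have := X_uniq Hr ht' _ oal o; lia.
  have {}hde : (de == k.+1) || (t < X de k.+1) by apply: later => //; lia.
  have eo : other_wire n w al' t = al by apply: other_wireE => //; rewrite eq_sym.
  have nde : al' != de by apply: contraNneq ode => <-.
  (* Going straight along [al] is forbidden in this case, so below the node the path runs on the
     larger wire and reaches [al] by a decreasing switch. *)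
  case: (boolP ((al < al') && (al' <= k))) => hal'.
    have bt := @between n w Hr al al' de.
    have bt2 := @between n w Hr al al' k.
    have [||||||su [sd [h1 h2 [h3 h3'] h4 h5]]] := IH t.+1 ht' al' de; try lia.
    exists (su ++ [:: (t, al)]), sd; split.
    + move=> s hs; rewrite -catA; apply: h1 => /=; split.
      * by rewrite next_upS ?ob //; lia.
      * by right.
      * by move=> e; rewrite e eqxx in nb.
      * exact: hs.
    + by move=> s; rewrite -catA h2 /=; lia.
    + by split=> //; apply: walk_dn_skip => //; lia.
    + by rewrite -catA map_cat /=; rewrite map_cat in h4 h5; have [] := uniq_insert h4 h5.
    + by rewrite -catA map_cat /=; rewrite map_cat in h4 h5; have [] := uniq_insert h4 h5.
  have [||||||su [sd [h1 h2 [h3 h3'] h4 h5]]] := IH t.+1 ht' al de; try lia.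
    case: (eqVneq al k) => //= e; have := hal; rewrite (negPf e) /= leq_eqVlt.
    case/orP => // /eqP e2; have /andP [_ ok] : on al (X al k) && on k (X al k) by apply: (X_on Hr) => //; lia.
    rewrite -e2 in ok; have := on_two oal ob _ ok; lia.
  exists (su ++ [:: (t, al)]), sd; split.
  + move=> s hs; rewrite -catA; apply: h1 => /=; split.
    * by rewrite next_upS ?oal //; lia.
    * by left.
    * by move=> _; rewrite /forbidden_straight -/al'; lia.
    * exact: hs.
  + by move=> s; rewrite -catA h2 /=; lia.
  + by split=> //; apply: walk_dn_skip => //; lia.
  + by rewrite -catA map_cat /=; rewrite map_cat in h4 h5; have [] := uniq_insert h4 h5.
  + by rewrite -catA map_cat /=; rewrite map_cat in h4 h5; have [] := uniq_insert h4 h5.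
have {}hal : (al == k) || (t < X al k) by apply: later => //; lia.
case: (boolP (on de t)) => ode.
  have [rb nb ob eX] := other_wireP Hr ht' ode; set de' := other_wire n w de t in rb nb ob eX.
  have nde : de' != al by apply: contraNneq oal => <-.
  case: (boolP ((k < de') && (de' < de))) => hde'.
    have bt := @between n w Hr al de' de.
    have bt2 := @between n w Hr k.+1 de' de.
    have e1 := XC n w de de'; have e2 := XC n w de k.+1; have e3 := XC n w de' k.+1.
    have [||||||su [sd [h1 h2 [h3 h3'] h4 h5]]] := IH t.+1 ht' al de'; try lia.
    exists su, ((t, de') :: sd); split=> //.
    + by move=> s hs; apply: h1; apply: walk_up_skip => //; lia.
    + split=> /=; last by rewrite h3'; lia.
      split=> //; last by move=> e; rewrite e eqxx in nb.
        by rewrite (@next_dnS n w k de t.-1) ?prednK ?ode //; lia.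
      by right.
    + by rewrite map_cat /=; rewrite map_cat in h4 h5; have [] := uniq_insert h4 h5.
    + by rewrite map_cat /=; rewrite map_cat in h4 h5; have [] := uniq_insert h4 h5.
  have [||||||su [sd [h1 h2 [h3 h3'] h4 h5]]] := IH t.+1 ht' al de; try lia.
    case: (eqVneq de k.+1) => //= e; have := hde; rewrite (negPf e) /= leq_eqVlt.
    case/orP => // /eqP e2; have /andP [_ ok] : on de (X de k.+1) && on k.+1 (X de k.+1) by apply: (X_on Hr) => //; lia.
    rewrite -e2 in ok; have := on_two ode ob _ ok; lia.
  exists su, ((t, de) :: sd); split=> //.
  + by move=> s hs; apply: h1; apply: walk_up_skip => //; lia.
  + split=> /=; last by rewrite h3'; lia.
    split=> //; last by move=> _; rewrite /forbidden_straight -/de'; lia.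
      by rewrite (@next_dnS n w k de t.-1) ?prednK ?ode //; lia.
    by left.
  + by rewrite map_cat /=; rewrite map_cat in h4 h5; have [] := uniq_insert h4 h5.
  + by rewrite map_cat /=; rewrite map_cat in h4 h5; have [] := uniq_insert h4 h5.
have {}hde : (de == k.+1) || (t < X de k.+1) by apply: later => //; lia.
have [||||||su [sd [h1 h2 [h3 h3'] h4 h5]]] := IH t.+1 ht' al de; try lia.
exists su, sd; split=> //.
- by move=> s hs; apply: h1; apply: walk_up_skip => //; lia.
- by split=> //; apply: walk_dn_skip => //; lia.
- by apply: sub_all h5 => x; lia.
Qed.
End Peak.

Section Peak.
Variables (n : nat) (w : seq nat).
Hypothesis Hr : red n w.
Let Hw : letters_ok n w. Proof. by case: Hr. Qed.
Notation N := (size w).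
Notation X := (crossing n w).
Notation on := (on_wire n w).
Notation next := (next_node n w).
Notation walk := (rig_walk n w).

(** Nodes are numbered from the top, so the least index is the topmost node, the peak. *)
Definition lowest p (s : seq (nat * nat)) := p \in map fst s /\ all (leq p) (map fst s).

(** Below the crossing of a and b, wire a is or still meets k, and wire b is or still meets k+1: a
    path can come up from the end of k along a and get from b down to the end of k+1. *)
Definition peak_ok k a b := [/\ a <= k < b, (a == k) || (X a b < X a k) &
  (b == k.+1) || (X a b < X b k.+1)].

Lemma peak_path k a b : 0 < a -> b <= n.+1 -> peak_ok k a b ->
  exists s, [/\ rigorous n w k s, inc k s = 1 & lowest (X a b) s].
Proof.
move=> ha hb [hk h1 h2].
have ab : a != b by lia.
have [ra rb] : 0 < a <= n.+1 /\ 0 < b <= n.+1 by lia.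
have hX := X_lt Hr ra rb ab.
have [|||||||su [sd [g1 g2 [g3 g4] g5 g6]]] := @greedy n w Hr k (X a b).+1 a b; try lia.
have /andP [oa ob] := X_on Hr ra rb ab.
rewrite map_cat in g5 g6; have [u1 u2] := uniq_insert g5 g6.
exists (su ++ (X a b, b) :: sd); split; last first.
- by split; rewrite map_cat //= mem_cat mem_head orbT.
- by rewrite g2 /= g4 addn0; lia.
split; rewrite ?map_cat //; first by lia.
apply: g1 => /=; split=> //.
- by rewrite next_upS ?oa //; lia.
- by right; rewrite (other_wireE Hr hX ab).
- by move=> e; rewrite e eqxx in ab.
Qed.

(** Take the largest k below [hi] that satisfies the condition on a. The condition fails for k+1 if
    that is below [hi], and then betweenness yields the condition on b. The bounds on k serve to
    produce two different indices for one crossing. *)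
Lemma peak_ok_ex a b lo hi : 0 < a <= lo -> lo < hi <= b -> b <= n.+1 ->
  (a == lo) || (X a b < X a lo) -> (b == hi) || (X a b < X b hi) ->
  exists2 k, peak_ok k a b & lo <= k < hi.
Proof.
move=> ha hlo hb h0 h1.
pose P k := (lo <= k < hi) && ((a == k) || (X a b < X a k)).
have exP : exists k, P k by exists lo; rewrite /P h0; lia.
have ubP k : P k -> k <= b by rewrite /P; lia.
case: (ex_maxnP exP ubP) => k /andP [hk h2] hmax; exists k => //.
split=> //; first by lia.
case: (eqVneq hi k.+1) => [<- //|hbk]; have := hmax k.+1; rewrite /P ltnn.
have bt := @between n w Hr a k.+1 b; rewrite (XC n w b); lia.
Qed.

(** A path determines its peak, so the paths chosen for the N nodes are distinct and fill [G]. *)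
Lemma peaks_exhaust (G : seq (nat * seq (nat * nat))) :
  uniq G -> (forall k s, rigorous n w k s <-> (k, s) \in G) -> size G = N ->
  forall k s, rigorous n w k s -> inc k s = 1 /\
    forall k' s' p, rigorous n w k' s' -> lowest p s -> lowest p s' -> k' = k.
Proof.
move=> uG hG hsz.
have exV (p : 'I_N) : exists P : nat * seq (nat * nat),
    [/\ rigorous n w P.1 P.2, inc P.1 P.2 = 1 & lowest p P.2].
  have [rL rR _] := wire_range Hw (ltn_ord p); have lr := ltLR Hr (ltn_ord p).
  have [|||||k hk _] := @peak_ok_ex (wireL n w p) (wireR n w p) (wireL n w p) (wireR n w p);
    rewrite ?eqxx //; try lia.
  have [||s [h1 h2 h3]] := peak_path _ _ hk; try lia.
  by exists (k, s); rewrite X_LR // in h3.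
have [V hV] := fin_all_exists exV.
have low_uniq p q s : lowest p s -> lowest q s -> p = q.
  move=> [h1 /allP h2] [h3 /allP h4]; apply/eqP; rewrite eqn_leq.
  by rewrite (h2 q h3) (h4 p h1).
have uV : uniq [seq V p | p <- enum 'I_N].
  rewrite map_inj_in_uniq ?enum_uniq // => p q _ _ e; apply: val_inj.
  by have [_ _ l1] := hV p; have [_ _ l2] := hV q; rewrite -e in l2; apply: low_uniq l1 l2.
have sub : {subset [seq V p | p <- enum 'I_N] <= G}.
  by move=> P /mapP [p _ ->]; have [h _ _] := hV p; rewrite [V p]surjective_pairing; apply/hG.
have le : size G <= size [seq V p | p <- enum 'I_N] by rewrite size_map size_enum_ord hsz.
have [_ eqG] := uniq_min_size uV sub le.
have rep k s : rigorous n w k s -> exists p : 'I_N, (k, s) = V p.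
  by move/hG; rewrite -eqG => /mapP [p _ e]; exists p.
move=> k s h; have [p e] := rep k s h; have := hV p; rewrite -e => -[_ h1 h2]; split=> //.
move=> k' s' q h' l l'; have [p' e'] := rep k' s' h'; have := hV p'; rewrite -e' => -[_ _ h3].
have epp : p = p' by apply: val_inj; rewrite /= (low_uniq _ _ _ h2 l) (low_uniq _ _ _ h3 l').
by rewrite -epp -e in e'; case: e'.
Qed.

(** * Paths assembled from legs along single wires *)

Lemma leg_up k a a' q j : a <= k -> j < q <= N -> on a j -> on a' j -> a != a' ->
  (forall b, a < b <= k -> ~~ (j < X a b < q)) ->
  exists su, [/\ forall s, walk k a' j s -> walk k a q (su ++ s),
    forall s, inc a (su ++ s) = (a < a') + inc a' s,
    uniq (map fst su) & forall t : nat, t \in map fst su -> on a t && (j <= t < q)].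
Proof.
move=> hk hjq oa oa' aa'; have hj : j < N by lia.
move: {2}(q - j) (erefl (q - j)) => d; elim: d q hjq => [|d IH] q hjq hd hf; first by lia.
case: q hjq hd hf => // q hjq hd hf.
case: (ltngtP j q) => hq; [|lia|].
  have [||b hb|su [h1 h2 h3 h4]] := IH q; try lia.
    by have := hf b hb; lia.
  have hqN : q < N by lia.
  case: (boolP (on a q)) => oq; last first.
    exists su; split=> // [s hs|t /h4]; last by lia.
    by apply: walk_up_skip => //; apply: h1.
  exists ((q, a) :: su); split=> [s hs|s||t].
  - split; [by rewrite next_upS // oq | by left | | exact: h1].
    move=> _; have [rb nb ob eX] := other_wireP Hr hqN oq.
    by have := hf (other_wire n w a q); rewrite eX /forbidden_straight; set b := other_wire _ _ _ _ in nb *; lia.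
  - by rewrite /= ltnn h2.
  - by rewrite /= h3 andbT; apply/negP => /h4; lia.
  - by rewrite inE => /orP [/eqP -> /=|/h4]; [rewrite oq|]; lia.
rewrite -hq in hf *; exists [:: (j, a')]; split=> //= [s hs|t].
  split=> //; first by rewrite next_upS // oa.
    by right; rewrite (other_wireE Hr hj aa').
  by move=> e; rewrite e eqxx in aa'.
by rewrite inE => /eqP -> /=; rewrite oa; lia.
Qed.

(** As in [leg_up], the last hypothesis says that no node strictly inside the leg forbids going
    straight. *)
Lemma leg_dn k a a' p j : k < a -> p < j < N -> on a j -> on a' j -> a != a' ->
  (forall b, k < b < a -> ~~ (p < X a b < j)) ->
  exists su, [/\ forall s, walk k a' j s -> walk k a p (su ++ s),
    forall s, inc a (su ++ s) = (a < a') + inc a' s,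
    uniq (map fst su) & forall t : nat, t \in map fst su -> on a t && (p < t <= j)].
Proof.
move=> hk hjp oa oa' aa'; have hj : j < N by lia.
move: {2}(j - p) (erefl (j - p)) => d; elim: d p hjp => [|d IH] p hjp hd hf; first by lia.
have hp1 : p.+1 < N by lia.
case: (ltngtP p.+1 j) => hq; [|lia|].
  have [||b hb|su [h1 h2 h3 h4]] := IH p.+1; try lia.
    by have := hf b hb; lia.
  case: (boolP (on a p.+1)) => oq; last first.
    exists su; split=> // [s hs|t /h4]; last by lia.
    by apply: (@walk_dn_skip n w Hr k a p.+1) => //; apply: h1.
  exists ((p.+1, a) :: su); split=> [s hs|s||t].
  - split; [by rewrite next_dnS // oq | by left | | exact: h1].
    move=> _; have [rb nb ob eX] := other_wireP Hr hp1 oq.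
    by have := hf (other_wire n w a p.+1); rewrite eX /forbidden_straight; set b := other_wire _ _ _ _ in nb *; lia.
  - by rewrite /= ltnn h2.
  - by rewrite /= h3 andbT; apply/negP => /h4; lia.
  - by rewrite inE => /orP [/eqP -> /=|/h4]; [rewrite oq|]; lia.
exists [:: (j, a')]; split=> //= [s hs|t].
  split=> //; first by rewrite next_dnS // hq oa.
    by right; rewrite (other_wireE Hr hj aa').
  by move=> e; rewrite e eqxx in aa'.
by rewrite inE => /eqP -> /=; rewrite oa; lia.
Qed.

(** On wire k+1 nothing forbids going straight, because no smaller wire is oriented downward. *)
Lemma leg_end k p : p < N -> exists s, [/\ walk k k.+1 p s, inc k.+1 s = 0,
  uniq (map fst s) & forall t : nat, t \in map fst s -> on k.+1 t && (p < t < N)].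
Proof.
move=> hp; move: {2}(N - p) (erefl (N - p)) => d; elim: d p hp => [|d IH] p hp hd; first by lia.
case: (ltnP p.+1 N) => hp1; last by exists [::]; split=> //=; rewrite next_dnN.
have [|s [h1 h2 h3 h4]] := IH p.+1 hp1; first by lia.
case: (boolP (on k.+1 p.+1)) => oq; last first.
  exists s; split=> // [|t /h4]; last by lia.
  exact: (@walk_dn_skip n w Hr k k.+1 p.+1).
exists ((p.+1, k.+1) :: s); split=> [||/=|t].
- split; [by rewrite next_dnS // oq | by left | | exact: h1].
  by move=> _; rewrite /forbidden_straight; set b := other_wire _ _ _ _; lia.
- by rewrite /= ltnn.
- by rewrite h3 andbT; apply/negP => /h4; lia.
- by rewrite inE => /orP [/eqP -> /=|/h4]; [rewrite oq|]; lia.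
Qed.

Lemma uniq_cat_disj (l1 l2 : seq nat) : uniq l1 -> uniq l2 ->
  (forall t : nat, t \in l1 -> t \in l2 -> False) -> uniq (l1 ++ l2).
Proof.
move=> h1 h2 h; rewrite cat_uniq h1 h2 andbT /=.
by apply/hasPn => t ht; apply/negP => /h /(_ ht).
Qed.

Lemma on_both t a b : t < N -> 0 < a <= n.+1 -> 0 < b <= n.+1 -> a != b ->
  on a t -> on b t -> t = X a b.
Proof. by move=> ht ra rb ab oa ob; rewrite (X_uniq Hr ht). Qed.

Lemma X_on2 a b : 0 < a <= n.+1 -> 0 < b <= n.+1 -> a != b ->
  [/\ X a b < N, on a (X a b) & on b (X a b)].
Proof. by move=> ra rb ab; rewrite X_lt //; have /andP [] := X_on Hr ra rb ab. Qed.

(* The path follows k up to b, then b down to a, a up to k+1, and k+1 down. *)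
Lemma two_peaks a b k : 0 < a < k -> k.+1 < b <= n.+1 ->
  X k b < X a b -> X a k.+1 < X a b ->
  (forall c, k < c < b -> X a b < X c b) -> (forall c, a < c <= k -> X a b < X a c) ->
  exists2 s, rigorous n w k s & inc k s = 2.
Proof.
move=> ha hb h1 h2 h3 h4.
have [ra rb rk rk1] : [/\ 0 < a <= n.+1, 0 < b <= n.+1, 0 < k <= n.+1 & 0 < k.+1 <= n.+1] by split; lia.
have [nab nkb nak nk1b] : [/\ a != b, k != b, a != k & k.+1 != b] by split; lia.
have nak1 : a != k.+1 by lia.
have nkk1 : k != k.+1 by lia.
have f1 : X a b < X a k by apply: h4; lia.
have f2 : X a b < X k.+1 b by apply: h3; lia.
have f3 : X k k.+1 < X k b.
  by have := @between n w Hr k k.+1 b; lia.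
have [l1 o1 o2] := X_on2 rk rb nkb.
have [l2 o3 o4] := X_on2 ra rb nab.
have [l3 o5 o6] := X_on2 ra rk1 nak1.
have g1 c : k < c <= k -> ~~ (X k b < X k c < N) by lia.
have g2 c : k < c < b -> ~~ (X k b < X b c < X a b).
  by move=> hc; have := h3 c hc; rewrite (XC n w b); lia.
have g3 c : a < c <= k -> ~~ (X a k.+1 < X a c < X a b).
  by move=> hc; have := h4 c hc; lia.
have q1 : X k b < N <= N by rewrite l1 leqnn.
have q2 : X k b < X a b < N by rewrite h1 l2.
have q3 : X a k.+1 < X a b <= N by rewrite h2 ltnW.
have kb : k < b by lia.
have ak : a <= k by lia.
have ba : b != a by rewrite eq_sym.
have rig1 : 0 < k <= n by lia.
have ei : (k < b) + ((b < a) + ((a < k.+1) + 0)) = 2 by lia.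
clear h3 h4 ha hb.
have [s1 [w1 i1 u1 m1]] := leg_up (leqnn k) q1 o1 o2 nkb g1.
have [s2 [w2 i2 u2 m2]] := leg_dn kb q2 o4 o3 ba g2.
have [s3 [w3 i3 u3 m3]] := leg_up ak q3 o5 o6 nak1 g3.
have [s4 [w4 i4 u4 m4]] := leg_end k l3.
clear g1 g2 g3.
exists (s1 ++ s2 ++ s3 ++ s4); last by rewrite i1 i2 i3 i4.
split=> //; last by apply/w1/w2/w3.
clear w1 w2 w3 w4 i1 i2 i3 i4.
(* Legs on different wires can share only the crossing of these wires, and the order of the
   crossings puts it outside one of the legs. *)
rewrite !map_cat; apply: uniq_cat_disj => //; last first.
  move=> t /m1 /and3P [t1 t2 t3]; rewrite !mem_cat => /or3P [/m2|/m3|/m4] /and3P [t4 t5 t6].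
  - by have e := on_both t3 rk rb nkb t1 t4; rewrite e ltnn in t5.
  - by have e := on_both t3 ra rk nak t4 t1; move: t6; rewrite e ltnNge (ltnW f1).
  - by have e := on_both t3 rk rk1 nkk1 t1 t4; move: t2; rewrite e leqNgt f3.
apply: uniq_cat_disj => //; last first.
  move=> t /m2 /and3P [t1 t2 t3]; rewrite mem_cat; have tN := leq_ltn_trans t3 l2.
  case/orP => [/m3|/m4] /and3P [t4 t5 t6].
  - by have e := on_both tN ra rb nab t4 t1; rewrite e ltnn in t6.
  - by have e := on_both tN rk1 rb nk1b t4 t1; move: t3; rewrite e leqNgt f2.
apply: uniq_cat_disj => // t /m3 /and3P [t1 t2 t3] /m4 /and3P [t4 t5 t6].
by have e := on_both t6 ra rk1 nak1 t1 t4; rewrite e ltnn in t5.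
Qed.

(* The path follows c, a, b upwards and then d downwards. *)
Lemma zigzag_up a b c d : 0 < a -> b = a.+1 -> c = b.+1 -> d = c.+1 -> d <= n.+1 ->
  X b d < X a b -> X a b < X a c -> X a c < X b c -> X c d < X a c -> X a d < X a b ->
  exists2 s, rigorous n w c s & inc c s = 2.
Proof.
move=> ha eb ec ed hd h1 h2 h3 h4 h5.
have [ra rb rc rd] : [/\ 0 < a <= n.+1, 0 < b <= n.+1, 0 < c <= n.+1 & 0 < d <= n.+1] by split; lia.
have [nab nac nbd nbc] : [/\ a != b, a != c, b != d & b != c] by split; lia.
have [ncd nad nca] : [/\ c != d, a != d & c != a] by split; lia.
have [l1 o1 o2] := X_on2 ra rc nac.
have [l2 o3 o4] := X_on2 ra rb nab.
have [l3 o5 o6] := X_on2 rb rd nbd.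
have e1 := XC n w c a.
have g1 x : c < x <= c -> ~~ (X a c < X c x < N) by lia.
have g2 x : a < x <= c -> ~~ (X a b < X a x < X a c).
  move=> hx; have [->|->] : x = b \/ x = c by lia.
    by rewrite ltnn.
  by rewrite ltnn andbF.
have g3 x : b < x <= c -> ~~ (X b d < X b x < X a b).
  move=> hx; have -> : x = c by lia.
  by apply/negP => /andP [_]; rewrite ltnNge (ltnW (ltn_trans h2 h3)).
have [ac bc] : a <= c /\ b <= c by lia.
have rig1 : 0 < c <= n by lia.
have ei : (c < a) + ((a < b) + ((b < d) + 0)) = 2 by lia.
have q1 : X a c < N <= N by rewrite l1 leqnn.
have q2 : X a b < X a c <= N by rewrite h2 ltnW.
have q3 : X b d < X a b <= N by rewrite h1 ltnW.
have [s1 [w1 i1 u1 m1]] := leg_up (leqnn c) q1 o2 o1 nca g1.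
have [s2 [w2 i2 u2 m2]] := leg_up ac q2 o3 o4 nab g2.
have [s3 [w3 i3 u3 m3]] := leg_up bc q3 o5 o6 nbd g3.
have [s4 [w4 i4 u4 m4]] := leg_end c l3; rewrite -ed in w4 i4 m4.
exists (s1 ++ s2 ++ s3 ++ s4); last by rewrite i1 i2 i3 i4.
split=> //; last by apply/w1/w2/w3.
rewrite !map_cat; apply: uniq_cat_disj => //; last first.
  move=> t /m1 /and3P [t1 t2 t3]; rewrite !mem_cat => /or3P [/m2|/m3|/m4] /and3P [t4 t5 t6].
  - by have e := on_both t3 ra rc nac t4 t1; rewrite e ltnn in t6.
  - by have e := on_both t3 rb rc nbc t4 t1; move: t6; rewrite e ltnNge (ltnW (ltn_trans h2 h3)).
  - by have e := on_both t3 rc rd ncd t1 t4; move: t2; rewrite e leqNgt h4.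
apply: uniq_cat_disj => //; last first.
  move=> t /m2 /and3P [t1 t2 t3]; rewrite mem_cat; have tN := ltn_trans t3 l1.
  case/orP => [/m3|/m4] /and3P [t4 t5 t6].
  - by have e := on_both tN ra rb nab t1 t4; rewrite e ltnn in t6.
  - by have e := on_both tN ra rd nad t1 t4; move: t2; rewrite e leqNgt h5.
apply: uniq_cat_disj => // t /m3 /and3P [t1 t2 t3] /m4 /and3P [t4 t5 t6].
by have e := on_both t6 rb rd nbd t1 t4; rewrite e ltnn in t5.
Qed.

(* The path follows a upwards and then c, d, b downwards. *)
Lemma zigzag_dn a b c d : 0 < a -> b = a.+1 -> c = b.+1 -> d = c.+1 -> d <= n.+1 ->
  X a c < X c d -> X c d < X b d -> X b d < X b c -> X a b < X b d -> X a d < X c d ->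
  exists2 s, rigorous n w a s & inc a s = 2.
Proof.
move=> ha eb ec ed hd h1 h2 h3 h4 h5.
have [ra rb rc rd] : [/\ 0 < a <= n.+1, 0 < b <= n.+1, 0 < c <= n.+1 & 0 < d <= n.+1] by split; lia.
have [nab nac nbd nbc] : [/\ a != b, a != c, b != d & b != c] by split; lia.
have [ncd nad ndb] : [/\ c != d, a != d & d != b] by split; lia.
have [l1 o1 o2] := X_on2 ra rc nac.
have [l2 o3 o4] := X_on2 rc rd ncd.
have [l3 o5 o6] := X_on2 rb rd nbd.
have g1 x : a < x <= a -> ~~ (X a c < X a x < N) by lia.
have g2 x : a < x < c -> ~~ (X a c < X c x < X c d).
  move=> hx; have -> : x = b by lia.
  by apply/negP => /andP [_]; rewrite (XC n w c b) ltnNge (ltnW (ltn_trans h2 h3)).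
have g3 x : a < x < d -> ~~ (X c d < X d x < X b d).
  move=> hx; have [->|->] : x = b \/ x = c by lia.
    by rewrite (XC n w d b) ltnn andbF.
  by rewrite (XC n w d c) ltnn.
have [ac ad] : a < c /\ a < d by lia.
have rig1 : 0 < a <= n by lia.
have ei : (a < c) + ((c < d) + ((d < b) + 0)) = 2 by lia.
have q1 : X a c < N <= N by rewrite l1 leqnn.
have q2 : X a c < X c d < N by rewrite h1 l2.
have q3 : X c d < X b d < N by rewrite h2 l3.
have [s1 [w1 i1 u1 m1]] := leg_up (leqnn a) q1 o1 o2 nac g1.
have [s2 [w2 i2 u2 m2]] := leg_dn ac q2 o3 o4 ncd g2.
have [s3 [w3 i3 u3 m3]] := leg_dn ad q3 o6 o5 ndb g3.
have [s4 [w4 i4 u4 m4]] := leg_end a l3; rewrite -eb in w4 i4 m4.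
exists (s1 ++ s2 ++ s3 ++ s4); last by rewrite i1 i2 i3 i4.
split=> //; last by apply/w1/w2/w3.
rewrite !map_cat; apply: uniq_cat_disj => //; last first.
  move=> t /m1 /and3P [t1 t2 t3]; rewrite !mem_cat => /or3P [/m2|/m3|/m4] /and3P [t4 t5 t6].
  - by have e := on_both t3 ra rc nac t1 t4; rewrite e ltnn in t5.
  - by have e := on_both t3 ra rd nad t1 t4; move: t5; rewrite e ltnNge (ltnW h5).
  - by have e := on_both t3 ra rb nab t1 t4; move: t5; rewrite e ltnNge (ltnW h4).
apply: uniq_cat_disj => //; last first.
  move=> t /m2 /and3P [t1 t2 t3]; rewrite mem_cat; have tN := leq_ltn_trans t3 l2.
  case/orP => [/m3|/m4] /and3P [t4 t5 t6].
  - by have e := on_both tN rc rd ncd t1 t4; rewrite e ltnn in t5.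
  - by have e := on_both tN rb rc nbc t4 t1; move: t3; rewrite e leqNgt (ltn_trans h2 h3).
apply: uniq_cat_disj => // t /m3 /and3P [t1 t2 t3] /m4 /and3P [t4 t5 t6].
by have e := on_both t6 rb rd nbd t4 t1; rewrite e ltnn in t5.
Qed.

End Peak.

(** * Simplicial cones and the order of the crossings *)

(** A larger node index is lower in the diagram. Each comparison is between two crossings on a
    common wire, the kind that 2-moves preserve. *)
Definition bottomR (Y : nat -> nat -> nat) a b :=
  forall c d, a <= c -> c < d -> d < b -> Y c d < Y c b.
Definition bottomL (Y : nat -> nat -> nat) a b :=
  forall c d, a < c -> c < d -> d <= b -> Y c d < Y a d.
Fixpoint good Y m a : Prop :=
  if m is m'.+1 then
    (bottomR Y a (a + m) /\ good Y m' a) \/ (bottomL Y a (a + m) /\ good Y m' a.+1)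
  else True.

Section Good.
Variables (n : nat) (w : seq nat).
Hypothesis Hr : red n w.
Notation N := (size w).
Notation X := (crossing n w).
Hypothesis H1 : forall k s, rigorous n w k s -> inc k s = 1 /\
    forall k' s' p, rigorous n w k' s' -> lowest p s -> lowest p s' -> k' = k.

Lemma peak_uniq a b k k' : 0 < a -> b <= n.+1 ->
  peak_ok n w k a b -> peak_ok n w k' a b -> k' = k.
Proof.
move=> ha hb h h'; have [s [r _ l]] := peak_path Hr ha hb h.
have [s' [r' _ l']] := peak_path Hr ha hb h'.
have [_ hu] := H1 r; exact: hu r' l l'.
Qed.

(** Fix an admissible peak index k. A wire c up to k with the wrong sign would give another index
    below c, and one above k another index from c on; so k separates the two signs. If both signs
    occurred, k would lie strictly inside and [two_peaks] would apply. *)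
Lemma const_sign a b : 0 < a < b -> b <= n.+1 ->
  (forall c, a < c < b -> X a c < X a b) \/ (forall c, a < c < b -> X c b < X a b).
Proof.
move=> ha hb.
have sg c : a < c < b -> (X a b < X a c /\ X b c < X a b) \/ (X a c < X a b /\ X a b < X b c).
  by move=> hc; have := @between n w Hr a c b; rewrite (XC n w b c); lia.
have [|||||k hk hk1] := @peak_ok_ex n w Hr a b a b; rewrite ?eqxx //; try lia.
have [_ hk2 hk3] := hk.
have up c : a < c <= k -> X a b < X a c.
  move=> hc; have [|[]//|[s1 s2]] := sg c; first by lia.
  have [|||||k' hk' hk4] := @peak_ok_ex n w Hr a b a c; rewrite ?eqxx ?s2 ?orbT //; try lia.
  by have := @peak_uniq a b k k' _ hb hk hk'; lia.
have dn c : k < c < b -> X a b < X c b.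
  move=> hc; have [|[s1 s2]|[s1 s2]] := sg c; [by lia| |by rewrite (XC n w c)].
  have [|||||k' hk' hk4] := @peak_ok_ex n w Hr a b c b; rewrite ?eqxx ?s1 ?orbT //; try lia.
  by have := @peak_uniq a b k k' _ hb hk hk'; lia.
case: (leqP k a) => hka.
  left=> c hc; have hc' : k < c < b by lia.
  by have := dn c hc'; have := sg c hc; rewrite (XC n w b c); lia.
case: (leqP b k.+1) => hkb.
  right=> c hc; have hc' : a < c <= k by lia.
  by have := up c hc'; have := sg c hc; rewrite (XC n w b c); lia.
have [||||s r i2] := @two_peaks n w Hr a b k _ _ _ _ dn up; try lia.
- by have := up k; have := sg k; rewrite (XC n w b k); lia.
- by have := dn k.+1; have := sg k.+1; rewrite (XC n w b k.+1); lia.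
- by have [i1 _] := H1 r; rewrite i2 in i1.
Qed.

(** The intervals without the last or without the first wire are good by induction. Their shapes
    agree with the alternative given by [const_sign] for the two outer wires, or a contradiction
    arises. *)
Lemma good_all m a : 0 < a -> a + m <= n.+1 -> good X m a.
Proof.
elim: m a => [|m IH] a ha hm //.
have IHa : good X m a by apply: IH; lia.
have IHb : good X m a.+1 by apply: IH; lia.
have bt c d e := @between n w Hr c d e.
suff : bottomR X a (a + m.+1) \/ bottomL X a (a + m.+1) by case; [left|right].
case: m IH hm IHa IHb => [|[|m]] IH hm IHa IHb.
- by left=> c d; lia.
- have := bt a a.+1 a.+2; case: (ltnP (X a a.+1) (X a a.+2)) => h h'.
    left=> c d h1 h2 h3; have -> : c = a by lia.
    have -> : d = a.+1 by lia.
    by rewrite addn2.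
  right=> c d h1 h2 h3; have -> : c = a.+1 by lia.
  have -> : d = a.+2 by lia.
  by lia.
set b := a + m.+3 in hm *.
have ab3 : a.+3 <= b by rewrite /b; lia.
have eb : a + m.+2 = b.-1 by rewrite /b; lia.
have eb' : a.+1 + m.+2 = b by rewrite /b; lia.
have m0 : m = 0 -> b = a.+3 by rewrite /b; lia.
have m1 : 0 < m -> a.+2 < b.-1 by rewrite /b; lia.
have {IH} cs : (forall c, a < c < b -> X a c < X a b) \/ (forall c, a < c < b -> X c b < X a b).
  by apply: const_sign => //; lia.
have p1 := bt a a.+1 b.-1; have p2 := bt a.+1 b.-1 b; have p3 := bt a a.+1 b.
have p4 := bt a b.-1 b; have p5 := bt a.+1 a.+2 b.-1; clear bt.
move: IHa IHb; rewrite /= eb eb'; clearbody b; clear eb eb'.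
move=> [[ga _]|[ga _]] [[gb _]|[gb _]].
- left=> c d h1 h2 h3; case: (ltngtP a c) h1 => // [hc _|ec _]; first exact: gb.
  rewrite -{c}ec in h2 *; case: cs => cs; first by apply: cs; lia.
  exfalso; have := ga a a.+1; have := gb a.+1 b.-1; have := cs a.+1; have := cs b.-1.
  clear ga gb cs p5; lia.
(* With five or more wires, both shapes would hold on an overlap of at least three wires, against
   betweenness. With four wires the overlap has only two and gives no conflict; there a zigzag path
   has two increasing switches. *)
- exfalso; case: (posnP m) => [/m0 e|/m1 h]; last first.
    by have := ga a.+1 a.+2; have := gb a.+2 b.-1; clear p1 p2 p3 p4; lia.
  clear m0 m1; subst b; move: p1 p2 p3 p4 => /= p1 p2 p3 p4; rewrite /= in ga.
  have g1 := ga a a.+1; have g2 := gb a.+2 a.+3; clear ga gb p5.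
  case: cs => cs; have c1 := cs a.+1; have c2 := cs a.+2; clear cs.
    have [s r i2] : exists2 s, rigorous n w a s & inc a s = 2.
      by apply: (@zigzag_dn n w Hr a a.+1 a.+2 a.+3) => //; lia.
    by have [i1 _] := H1 r; rewrite i2 in i1.
  have [s r i2] : exists2 s, rigorous n w a.+2 s & inc a.+2 s = 2.
      by apply: (@zigzag_up n w Hr a a.+1 a.+2 a.+3) => //; lia.
  by have [i1 _] := H1 r; rewrite i2 in i1.
(* Both shapes are compatible with the subintervals; [const_sign] decides between them. *)
- case: cs => cs; [left|right] => c d h1 h2 h3.
    case: (ltngtP a c) h1 => // [hc _|ec _]; first exact: gb.
    by rewrite -{c}ec in h2 *; apply: cs; lia.
  case: (ltngtP d b) h3 => // [hd _|ed _]; last by rewrite ed; apply: cs; lia.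
  by apply: ga; lia.
- right=> c d h1 h2 h3.
  case: (ltngtP d b) h3 => // [hd _|ed _]; [by apply: ga; lia | rewrite ed].
  case: cs => cs; last by apply: cs; lia.
  exfalso; have := ga a.+1 b.-1; have := gb b.-1 b; have := cs a.+1; have := cs b.-1.
  clear ga gb cs p5; lia.
Qed.
End Good.

(** * Invariance under 2-moves *)

Lemma tau_comm a b i : 0 < a -> 0 < b -> (a.+1 < b) || (b.+1 < a) ->
  tau a.-1 a (tau b.-1 b i) = tau b.-1 b (tau a.-1 a i).
Proof.
move=> ha hb hab.
have [[e1 ->]|[[_ [e1 ->]]|[n1 [n2 ->]]]] := tauP b.-1 b i;
have [[e2 ->]|[[_ [e2 ->]]|[n3 [n4 ->]]]] := tauP a.-1 a i; try lia.
- by have := tauP a.-1 a b; have := tauP b.-1 b i; lia.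
- by have := tauP a.-1 a b.-1; have := tauP b.-1 b i; lia.
- by have := tauP a.-1 a i; have := tauP b.-1 b a; lia.
- by have := tauP a.-1 a i; have := tauP b.-1 b a.-1; lia.
- by have := tauP a.-1 a i; have := tauP b.-1 b i; lia.
Qed.

Lemma swap_pos_comm c a b : 0 < a < size c -> 0 < b < size c -> (a.+1 < b) || (b.+1 < a) ->
  swap_pos (swap_pos c b.-1 b) a.-1 a = swap_pos (swap_pos c a.-1 a) b.-1 b.
Proof.
move=> ha hb hab; apply: (@eq_from_nth _ 0); rewrite !size_swap_pos // => i _.
by rewrite !nth_swap_pos ?size_swap_pos 1?tau_comm //; lia.
Qed.

Section Move.
Variables (n : nat) (u v : seq nat) (a b : nat).
Hypothesis Hab : (a.+1 < b) || (b.+1 < a).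
Let w := u ++ a :: b :: v.
Let w2 := u ++ b :: a :: v.
Let j0 := size u.
Notation T := (tau j0 j0.+1).
Hypothesis Hw : letters_ok n w.

Lemma move_size : size w2 = size w.
Proof. by rewrite !size_cat. Qed.

Lemma move_perm : perm_eq w2 w.
Proof. by rewrite perm_cat2l (perm_catCA [:: b] [:: a] v). Qed.

Lemma move_letters : letters_ok n w2.
Proof. by rewrite /letters_ok (perm_all _ move_perm). Qed.

Lemma move_j0 : j0.+1 < size w.
Proof. by rewrite size_cat /= /j0; lia. Qed.

Lemma move_a : nth 0 w j0 = a. Proof. by rewrite nth_cat ltnn subnn. Qed.
Lemma move_b : nth 0 w j0.+1 = b.
Proof. by rewrite nth_cat ltnNge leqnSn /= subSnn. Qed.

Lemma move_nth t : nth 0 w2 (T t) = nth 0 w t.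
Proof.
have := tauP j0 j0.+1 t; rewrite /w /w2 !nth_cat -/j0.
case=> [[-> ->]|[[_ [-> ->]]|[h1 [h2 ->]]]].
- by rewrite [j0.+1 < j0]ltnNge leqnSn /= ltnn subSnn subnn.
- by rewrite [j0.+1 < j0]ltnNge leqnSn /= ltnn subSnn subnn.
case: ltnP => // h; have -> : t - j0 = (t - j0).-2.+2 by lia.
by [].
Qed.

Lemma move_ranges : (0 < a <= n) && (0 < b <= n).
Proof.
have h1 := letter_ok Hw (ltnW move_j0); have h2 := letter_ok Hw move_j0.
by rewrite move_a in h1; rewrite move_b in h2; rewrite h1 h2.
Qed.

Lemma conf_lo t : t <= j0 -> conf n w2 t = conf n w t.
Proof. by move=> h; rewrite !conf_catl. Qed.

Lemma conf_hi t : j0.+2 <= t -> conf n w2 t = conf n w t.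
Proof.
move=> h; have hr := move_ranges; have szc : size (conf n u (size u)) = n.+1.
  by rewrite -(conf_catl n (a :: b :: v) (leqnn _)) size_conf.
have : t = size u + (t - j0.+2).+2 by rewrite -/j0; lia.
move: (t - j0.+2) => d ->.
by rewrite !conf_cat /= swap_pos_comm ?szc //; lia.
Qed.

(** The configurations differ only between the two exchanged nodes, and each letter leaves the
    positions of the other one alone. *)
Lemma move_conf t : t < size w ->
  forall i, i = (nth 0 w t).-1 \/ i = nth 0 w t ->
  nth 0 (conf n w2 (T t)) i = nth 0 (conf n w t) i.
Proof.
move=> ht i hi; have hr := move_ranges; have hj := move_j0.
have hl := letter_ok Hw ht.
have w2j : nth 0 w2 j0 = b by rewrite -move_b -move_nth /T eqn_leq ltnn eqxx.
have [[e ->]|[[_ [e ->]]|[h1 [h2 ->]]]] := tauP j0 j0.+1 t.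
- rewrite e move_a in hi *; rewrite confS ?move_size ?(ltnW hj) // w2j conf_lo //.
  rewrite nth_swap_pos ?size_conf //; try lia.
  by congr nth; have := tauP b.-1 b i; lia.
- rewrite e move_b in hi *; rewrite (@confS n w j0) ?(ltnW hj) // move_a conf_lo //.
  rewrite nth_swap_pos ?size_conf //; try lia.
  by congr nth; have := tauP a.-1 a i; lia.
- by case: (ltngtP t j0) => h; [rewrite conf_lo // ltnW | rewrite conf_hi //; lia | lia].
Qed.

Lemma move_wireL t : t < size w -> wireL n w2 (T t) = wireL n w t.
Proof. by move=> ht; rewrite /wireL move_nth move_conf //; left. Qed.

Lemma move_wireR t : t < size w -> wireR n w2 (T t) = wireR n w t.
Proof. by move=> ht; rewrite /wireR move_nth move_conf //; right. Qed.

Lemma move_on x t : t < size w -> on_wire n w2 x (T t) = on_wire n w x t.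
Proof. by move=> ht; rewrite /on_wire move_wireL // move_wireR. Qed.

Lemma move_other x t : t < size w -> other_wire n w2 x (T t) = other_wire n w x t.
Proof. by move=> ht; rewrite /other_wire move_wireL // move_wireR. Qed.

Lemma move_not_both x : on_wire n w x j0 -> on_wire n w x j0.+1 -> False.
Proof.
move=> o1 o2; have hj := move_j0; have hj' := ltnW hj; have hr := move_ranges.
have rx := on_wire_range Hw hj o2.
move: o1 o2; rewrite !on_wire_ix // move_a move_b ixS // move_a.
by have := tauP a.-1 a (ix n w j0 x); lia.
Qed.

Lemma move_lt t : (T t < size w) = (t < size w).
Proof. by have := tauP j0 j0.+1 t; have := move_j0; lia. Qed.

(** [T] inverts a single pair of nodes, and no wire passes through both of them. *)
Lemma move_mono x t t' : t < size w -> t' < size w -> on_wire n w x t -> on_wire n w x t' ->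
  (T t < T t') = (t < t').
Proof.
move=> ht ht' o o'.
have nb : ~ (t = j0 /\ t' = j0.+1) by case=> e e'; rewrite e e' in o o'; apply: move_not_both o o'.
have nb' : ~ (t' = j0 /\ t = j0.+1) by case=> e e'; rewrite e e' in o o'; apply: move_not_both o' o.
by have := tauP j0 j0.+1 t; have := tauP j0 j0.+1 t'; lia.
Qed.

Lemma move_red : red n w -> red n w2.
Proof.
move=> [h1 h2 h3]; split; [by rewrite move_size | exact: move_letters |].
by rewrite move_size conf_hi // move_j0.
Qed.

Lemma move_X x y : red n w -> 0 < x <= n.+1 -> 0 < y <= n.+1 -> x != y ->
  crossing n w2 x y = T (crossing n w x y).
Proof.
move=> Hr rx ry xy; have hX := X_lt Hr rx ry xy; have /andP [o1 o2] := X_on Hr rx ry xy.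
by apply: (X_uniq (move_red Hr)); rewrite ?move_on ?move_size ?move_lt.
Qed.

Lemma move_X_lt x y z : red n w -> 0 < x <= n.+1 -> 0 < y <= n.+1 -> 0 < z <= n.+1 ->
  x != y -> x != z -> (crossing n w2 x y < crossing n w2 x z) = (crossing n w x y < crossing n w x z).
Proof.
move=> Hr rx ry rz xy xz; rewrite !move_X //.
have /andP [o1 _] := X_on Hr rx ry xy; have /andP [o2 _] := X_on Hr rx rz xz.
by apply: move_mono o1 o2; apply: X_lt.
Qed.

Definition move_path (s : seq (nat * nat)) := [seq (T e.1, e.2) | e <- s].

Lemma move_next k x p j : p < size w /\ on_wire n w x p \/ p = size w /\ x <= k ->
  next_node n w k x p = Some j -> next_node n w2 k x (T p) = Some (T j).
Proof.
move=> hp hn; have hpN : p <= size w by lia.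
have [hj oj] := next_some hpN hn; have hj0 := move_j0.
have TN : T (size w) = size w by have := tauP j0 j0.+1 (size w); lia.
have hTp : T p <= size w by case: hp => [[h4 _]|[-> _]]; [rewrite ltnW // move_lt | rewrite TN].
case: (leqP x k) => h.
  have := next_upP n w p h; rewrite hn => -[h1 _ h3].
  have m t : t < size w -> on_wire n w x t -> (T t < T p) = (t < p).
    move=> ht ot; case: hp => [[h4 h5]|[-> _]]; first exact: move_mono h5.
    by rewrite TN move_lt.
  apply: next_up_some; rewrite ?m ?move_on // => t ht.
  apply/negP; rewrite -(tauK j0 j0.+1 t) in ht * => ot.
  have ht' : T t < size w by rewrite -move_lt; lia.
  rewrite move_on // in ot; have := h3 (T t); rewrite ot.
  rewrite m // (move_mono hj ht' oj ot) in ht; lia.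
have {hp} [hp op] : p < size w /\ on_wire n w x p by case: hp => // -[_]; lia.
have := next_dnP n w p h; rewrite hn => -[h1 _ h3].
apply: next_dn_some; rewrite ?move_size ?move_lt ?hj ?(move_mono hp hj op oj) ?move_on //; first by lia.
move=> t ht; apply/negP; rewrite -(tauK j0 j0.+1 t) in ht * => ot.
have ht' : T t < size w by rewrite -move_lt; have := move_lt j; lia.
rewrite move_on // in ot; have := h3 (T t); rewrite ot.
rewrite (move_mono hp ht' op ot) (move_mono ht' hj ot oj) in ht; lia.
Qed.

Lemma move_next_none k x p : p < size w /\ on_wire n w x p \/ p = size w /\ x <= k ->
  next_node n w k x p = None -> next_node n w2 k x (T p) = None.
Proof.
move=> hp hn; have hpN : p <= size w by lia.
have hj0 := move_j0.
have TN : T (size w) = size w by have := tauP j0 j0.+1 (size w); lia.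
have hTp : T p <= size w by case: hp => [[h4 _]|[-> _]]; [rewrite ltnW // move_lt | rewrite TN].
case: (leqP x k) => h.
  have := next_upP n w p h; rewrite hn => h3.
  have m t : t < size w -> on_wire n w x t -> (T t < T p) = (t < p).
    move=> ht ot; case: hp => [[h4 h5]|[-> _]]; first exact: move_mono h5.
    by rewrite TN move_lt.
  apply: next_up_none => // t ht.
  apply/negP; rewrite -(tauK j0 j0.+1 t) in ht * => ot.
  have ht' : T t < size w by rewrite -move_lt; lia.
  rewrite move_on // in ot; have := h3 (T t); rewrite ot.
  by rewrite m // in ht; lia.
have {hp} [hp op] : p < size w /\ on_wire n w x p by case: hp => // -[_]; lia.
have := next_dnP n w p h; rewrite hn => h3.
apply: next_dn_none => // t ht; rewrite move_size in ht.
apply/negP; rewrite -(tauK j0 j0.+1 t) in ht * => ot.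
have ht' : T t < size w by rewrite -move_lt; lia.
rewrite move_on // in ot; have := h3 (T t); rewrite ot.
by rewrite (move_mono hp ht' op ot) in ht; lia.
Qed.

Lemma move_walk k x p s : red n w -> p < size w /\ on_wire n w x p \/ p = size w /\ x <= k ->
  rig_walk n w k x p s -> rig_walk n w2 k x (T p) (move_path s).
Proof.
move=> Hr; elim: s x p => [|[j x'] s IH] x p hp /=.
  by case=> e hn; split=> //; apply: move_next_none.
move=> [h1 h2 h3 h4]; have hpN : p <= size w by lia.
have [hj oj] := next_some hpN h1.
split; rewrite ?move_other //; first exact: move_next.
  by move=> e; have := h3 e; rewrite /forbidden_straight move_other.
by apply: IH => //; left; split=> //; apply: (LR_other Hr) oj h2.
Qed.

Lemma move_rigorous k s : red n w -> rigorous n w k s -> rigorous n w2 k (move_path s).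
Proof.
move=> Hr [h1 h2 h3]; split=> //.
  by rewrite -map_comp (map_comp T) map_inj_uniq //; apply: (can_inj (@tauK _ _)).
have hj0 := move_j0.
have TN : T (size w) = size w by have := tauP j0 j0.+1 (size w); lia.
by rewrite move_size -{1}TN; apply: move_walk => //; right.
Qed.

Lemma gs_move (R : zmodType) (f : nat -> R) k s : gs f k (move_path s) = gs (fun t => f (T t)) k s.
Proof. by elim: s k => [|[j a'] s IH] k //=; rewrite IH. Qed.


Lemma move_perm_iota : perm_eq [seq T k | k <- iota 0 (size w)] (iota 0 (size w)).
Proof.
apply: uniq_perm; rewrite ?map_inj_uniq ?iota_uniq //; try exact: (can_inj (@tauK _ _)).
move=> t; apply/mapP/idP => [[t' + ->]|]; rewrite !mem_iota ?move_lt // => h.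
by exists (T t); rewrite ?tauK // mem_iota move_lt.
Qed.

Lemma sum_iota_if (R : nmodType) (N j : nat) (F : nat -> R) :
  (\sum_(j.+1 <= k < N) F k = \sum_(k <- iota 0 N) (if (j < k)%N then F k else 0))%R.
Proof.
have -> : iota 0 N = index_iota 0 N by rewrite /index_iota subn0.
by rewrite -big_mkcond /= (big_nat_widenl _ 0).
Qed.

Lemma lam_sum_move (R : realFieldType) (f : nat -> R) j : j < size w ->
  (\sum_((T j).+1 <= k < size w) lam_coef R w2 (T j) k * f k
   = \sum_(j.+1 <= k < size w) lam_coef R w j k * f (T k))%R.
Proof.
move=> hj; rewrite !sum_iota_if -(perm_big _ move_perm_iota) /= big_map.
apply: eq_big_seq => k; rewrite mem_iota => hk.
have -> : lam_coef R w2 (T j) (T k) = lam_coef R w j k by rewrite /lam_coef !move_nth.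
(* The only pair of nodes whose order changes has coefficient zero. *)
have cz : lam_coef R w j0 j0.+1 = 0%R /\ lam_coef R w j0.+1 j0 = 0%R.
  by rewrite /lam_coef move_a move_b; split; do ! case: ifP => //; lia.
have [t1 t2] := (tauP j0 j0.+1 j, tauP j0 j0.+1 k).
have [[e1 e2]|[[e1 e2]|->]] : (j = j0 /\ k = j0.+1) \/ (j = j0.+1 /\ k = j0) \/
  (T j < T k) = (j < k) by lia.
- by rewrite e1 e2 (proj1 cz) mul0r !if_same.
- by rewrite e1 e2 (proj2 cz) mul0r !if_same.
- by [].
Qed.

End Move.

(** The weight is an arbitrary function with values in [R], because removing a block replaces it by
    an expression in the block coordinates. *)
Definition rlam_ineqs (R : realFieldType) (w : seq nat) (L f : nat -> R) : Prop :=
  forall j, j < size w ->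
    (f j <= L (nth 0%N w j) + \sum_(j.+1 <= k < size w) lam_coef R w j k * f k)%R.

Definition fcone (R : realFieldType) n w (f : nat -> R) : Prop :=
  forall k s, rigorous n w k s -> (0 <= gs f k s)%R.

Lemma move2_spec n w w2 : move2 w w2 -> red n w ->
  [/\ red n w2,
      forall x y z, 0 < x <= n.+1 -> 0 < y <= n.+1 -> 0 < z <= n.+1 -> x != y -> x != z ->
        (crossing n w2 x y < crossing n w2 x z) = (crossing n w x y < crossing n w x z) &
      exists T : nat -> nat, [/\ involutive T, forall t, (T t < size w) = (t < size w) &
        forall (R : realFieldType) (L f : nat -> R),
          (fcone n w2 f <-> fcone n w (fun t => f (T t))) /\
          (rlam_ineqs w2 L f <-> rlam_ineqs w L (fun t => f (T t)))]].
Proof.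
case=> u v a b h Hr; have Hw : letters_ok n (u ++ a :: b :: v) by case: Hr.
have Hr2 := move_red h Hw Hr.
split=> // [x y z rx ry rz xy xz|]; first exact: move_X_lt.
exists (tau (size u) (size u).+1); split; [exact: tauK | exact: (move_lt h Hw) | move=> R L f].
have h' : (b.+1 < a) || (a.+1 < b) by rewrite orbC.
have Hw2 : letters_ok n (u ++ b :: a :: v) by case: Hr2.
split; split=> H.
- by move=> k s /(move_rigorous h Hw Hr) /H; rewrite gs_move.
- move=> k s /(move_rigorous h' Hw2 Hr2) /H; rewrite gs_move.
  by congr (_ <= _)%R; apply: eq_gs => j a' _; rewrite tauK.
- move=> j hj; rewrite -(lam_sum_move h Hw) // -(move_nth h Hw).
  by have := H (tau (size u) (size u).+1 j); rewrite move_size (move_lt h Hw); apply.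
- move=> j; rewrite move_size => hj; rewrite -(tauK (size u) (size u).+1 j).
  set j' := tau _ _ j; have hj' : j' < size (u ++ a :: b :: v) by rewrite (move_lt h Hw).
  by rewrite (move_nth h Hw) (lam_sum_move h Hw) //; apply: H.
Qed.

(** * Words ending with a block D or A *)

Lemma equiv2_trans x y z : equiv2 x y -> equiv2 y z -> equiv2 x z.
Proof. by elim=> // {}x u {}y h _ IH /IH; apply: E2step. Qed.

Lemma equiv2_catl p x y : equiv2 x y -> equiv2 (p ++ x) (p ++ y).
Proof.
elim=> [u|u v x' h _ IH]; first exact: E2refl.
by apply: E2step IH; case: h => u' v' a b h; rewrite !catA; apply: M2.
Qed.

Lemma equiv2_pass i u r : all (fun j => (i.+1 < j) || (j.+1 < i)) u ->
  equiv2 (i :: u ++ r) (u ++ i :: r).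
Proof.
elim: u => [|j u IH] /=; first by move=> _; apply: E2refl.
move=> /andP [h /IH h']; apply: (E2step (v := j :: i :: u ++ r)).
  exact: (@M2 [::] (u ++ r) i j h).
exact: (@equiv2_catl [:: j]).
Qed.

Lemma equiv2_spec n w w2 : equiv2 w w2 -> red n w ->
  red n w2 /\ forall x y z, 0 < x <= n.+1 -> 0 < y <= n.+1 -> 0 < z <= n.+1 ->
    x != y -> x != z -> (crossing n w2 x y < crossing n w2 x z) = (crossing n w x y < crossing n w x z).
Proof.
elim=> [//|u v x h _ IH] Hr; have [Hr' hX _] := move2_spec h Hr.
have [Hr2 hX2] := IH Hr'; split=> // a b c ra rb rc ab ac.
by rewrite hX2 // hX.
Qed.

(** Wire z at position p among the wires [c]: each letter of a block D or A moves z by one place and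
    keeps the order of [c]. *)
Definition ins (z : nat) c p := take p c ++ z :: drop p c.

Lemma nth_ins z c p i : p <= size c ->
  nth 0 (ins z c p) i = if i < p then nth 0 c i else if i == p then z else nth 0 c i.-1.
Proof.
move=> hp; rewrite /ins nth_cat size_takel //.
case: ltngtP => h; last by rewrite h subnn.
  by rewrite nth_take.
have -> : i - p = (i.-1 - p).+1 by lia.
by rewrite /= nth_drop; congr nth; lia.
Qed.

Lemma size_ins z c p : size (ins z c p) = (size c).+1.
Proof. by rewrite -[in RHS](cat_take_drop p c) /ins !size_cat /= addnS. Qed.

Lemma swap_ins z c p : p < size c ->
  swap_pos (ins z c p.+1) p p.+1 = ins z c p /\ swap_pos (ins z c p) p p.+1 = ins z c p.+1.
Proof.
move=> hp; split; apply: (@eq_from_nth _ 0); rewrite !size_swap_pos ?size_ins // => i hi;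
  rewrite nth_swap_pos ?size_ins ?nth_ins //; try lia;
  have [[e ->]|[[_ [e ->]]|[h1 [h2 ->]]]] := tauP p p.+1 i.
all: by do ! case: ifP; rewrite ?e //=; try lia; move=> *; congr nth; lia.
Qed.

Lemma DwS m : Dw m.+1 = m.+1 :: Dw m.
Proof. by rewrite /Dw -{1}(addn1 m) iotaD rev_cat /= add1n. Qed.

Lemma size_Dw m : size (Dw m) = m.
Proof. by rewrite size_rev size_iota. Qed.

Lemma nth_Dw m i : i < m -> nth 0 (Dw m) i = m - i.
Proof. by move=> h; rewrite nth_rev ?size_iota // nth_iota; lia. Qed.

Definition run := foldl (fun c a => swap_pos c a.-1 a).

Lemma run_Dw z c i : i <= size c -> run (ins z c (size c)) (take i (Dw (size c))) = ins z c (size c - i).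
Proof.
elim: i => [|i IH] hi; first by rewrite take0 subn0.
rewrite (take_nth 0) ?size_Dw // /run foldl_rcons -/(run _ _) IH ?(ltnW hi) // nth_Dw //.
have -> : size c - i = (size c - i.+1).+1 by lia.
have hp : size c - i.+1 < size c by lia.
by have [-> _] := swap_ins z hp.
Qed.

Lemma run_Aw z c i : i <= size c -> run (ins z c 0) (take i (Aw (size c))) = ins z c i.
Proof.
elim: i => [|i IH] hi; first by rewrite take0.
rewrite (take_nth 0) ?size_iota // /run foldl_rcons -/(run _ _) IH ?(ltnW hi) // nth_iota // add1n.
by have [_ ->] := @swap_ins z c i hi.
Qed.

Lemma ins_last z c : ins z c (size c) = rcons c z.
Proof. by rewrite /ins take_size drop_size cats1. Qed.

(** * Collecting the crossings of an outer wire into a final block *)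

Section Sort.
Variables (n : nat) (w : seq nat).
Hypothesis Hr : red n w.
Let Hw : letters_ok n w. Proof. by case: Hr. Qed.
Notation N := (size w).
Notation X := (crossing n w).
Notation on := (on_wire n w).
Notation ix := (ix n w).

Lemma ixS_off t z : t < N -> 0 < z <= n.+1 -> ~~ on z t -> ix t.+1 z = ix t z.
Proof.
move=> ht rz; rewrite on_wire_ix // ixS //.
by have := tauP (nth 0 w t).-1 (nth 0 w t) (ix t z); lia.
Qed.

(** Sweep from the bottom. A node on wire n+1 prolongs the block, as its letter commutes with all
    letters of [u]. At a node off this wire, [bottomR] and betweenness show that both wires have yet
    to cross n+1, so they lie to its left and the letter is small. *)
Lemma sort_D t : bottomR X 1 n.+1 -> t <= N ->
  exists u, equiv2 (drop t w) (u ++ Dw (ix t n.+1)) /\ all (fun j => j < ix t n.+1) u.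
Proof.
move=> hb; have rz : 0 < n.+1 <= n.+1 by rewrite leqnn.
move: {2}(N - t) (erefl (N - t)) => d; elim: d t => [|d IH] t hd ht.
  have -> : t = N by lia.
  by exists [::]; rewrite drop_size ixN // subnn; split=> //; apply: E2refl.
have ht' : t < N by lia.
have [|//|u [h1 h2]] := IH t.+1; first by lia.
have hl := letter_ok Hw ht'; rewrite (drop_nth 0) //.
case: (boolP (on n.+1 t)) => oz.
  have [rL rR _] := wire_range Hw ht'; have lr := ltLR Hr ht'.
  have eR : wireR n w t = n.+1 by move: oz; rewrite /on_wire; lia.
  have e1 := ixR Hw ht'; rewrite eR in e1.
  have e2 : ix t.+1 n.+1 = (nth 0 w t).-1.
    rewrite ixS // e1; have := tauP (nth 0 w t).-1 (nth 0 w t) (nth 0 w t); lia.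
  exists u; split; last by apply: sub_all h2 => j; rewrite e1 e2; lia.
  rewrite e1 e2 in h1 h2 *.
  have -> : Dw (nth 0 w t) = nth 0 w t :: Dw (nth 0 w t).-1 by case: (nth 0 w t) hl => // k _; rewrite DwS.
  apply: equiv2_trans (@equiv2_catl [:: nth 0 w t] _ _ h1) _.
  by apply: equiv2_pass; apply: sub_all h2 => j; lia.
exists (nth 0 w t :: u); rewrite ixS_off // in h1 h2; split.
  exact: (@equiv2_catl [:: nth 0 w t]).
rewrite /= h2 andbT.
have [rL rR _] := wire_range Hw ht'; have lr := ltLR Hr ht'.
have nR : wireR n w t != n.+1 by apply: contraNneq oz => <-; rewrite /on_wire eqxx orbT.
rewrite -(ixR Hw ht') ltnNge leq_eqVlt negb_or; apply/andP; split.
  by apply: contraNneq nR => e; apply/eqP/esym; apply: (ix_inj Hw _ _ e).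
have hX := @hb (wireL n w t) (wireR n w t); rewrite X_LR // in hX.
have bt := @between n w Hr (wireL n w t) (wireR n w t) n.+1; rewrite X_LR // in bt.
rewrite -(@X_ix n w Hr) //; lia.
Qed.

Lemma sort_A t : bottomL X 1 n.+1 -> t <= N ->
  exists u, equiv2 (drop t w) (u ++ iota (ix t 1).+1 (n - ix t 1)) /\
    all (fun j => (ix t 1).+1 < j) u.
Proof.
move=> hb; have rz : 0 < 1 <= n.+1 by [].
move: {2}(N - t) (erefl (N - t)) => d; elim: d t => [|d IH] t hd ht.
  have -> : t = N by lia.
  by exists [::]; rewrite drop_size ixN // subn1 subnn; split=> //; apply: E2refl.
have ht' : t < N by lia.
have [|//|u [h1 h2]] := IH t.+1; first by lia.
have hl := letter_ok Hw ht'; rewrite (drop_nth 0) //.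
case: (boolP (on 1 t)) => oz.
  have [rL rR _] := wire_range Hw ht'; have lr := ltLR Hr ht'.
  have eL : wireL n w t = 1 by move: oz; rewrite /on_wire; lia.
  have e1 := ixL Hw ht'; rewrite eL in e1.
  have e2 : ix t.+1 1 = nth 0 w t.
    rewrite ixS // e1; have := tauP (nth 0 w t).-1 (nth 0 w t) (nth 0 w t).-1; lia.
  exists u; split; last by apply: sub_all h2 => j; rewrite e1 e2; lia.
  rewrite e2 in h1 h2; rewrite e1 prednK; last by lia.
  have -> : n - (nth 0 w t).-1 = (n - nth 0 w t).+1 by lia.
  apply: equiv2_trans (@equiv2_catl [:: nth 0 w t] _ _ h1) _.
  by apply: equiv2_pass; apply: sub_all h2 => j; lia.
exists (nth 0 w t :: u); rewrite ixS_off // in h1 h2; split.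
  exact: (@equiv2_catl [:: nth 0 w t]).
rewrite /= h2 andbT.
have [rL rR _] := wire_range Hw ht'; have lr := ltLR Hr ht'.
have nL : 1 != wireL n w t by apply: contraNneq oz => e; rewrite /on_wire -e eqxx.
have hX := @hb (wireL n w t) (wireR n w t); rewrite X_LR // in hX.
have bt := @between n w Hr 1 (wireL n w t) (wireR n w t); rewrite X_LR // in bt.
have e1 := ixL Hw ht'.
have hx := @X_ix n w Hr 1 (wireL n w t) t.
have nx : ix t 1 <> ix t (wireL n w t) by move=> e; case/eqP: nL; apply: (ix_inj Hw _ _ e).
lia.
Qed.

End Sort.

Lemma swap_rcons c z p q : p < size c -> q < size c ->
  swap_pos (rcons c z) p q = rcons (swap_pos c p q) z.
Proof.
move=> hp hq; apply: (@eq_from_nth _ 0); rewrite ?size_rcons !size_swap_pos ?size_rcons // => i hi.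
rewrite nth_swap_pos ?size_rcons ?(ltn_trans hp) ?(ltn_trans hq) //.
rewrite !nth_rcons size_swap_pos nth_swap_pos //.
by have [[e ->]|[[_ [e ->]]|[h1 [h2 ->]]]] := tauP p q i; rewrite ?e ?hp ?hq.
Qed.

Lemma swap_cons c z p q : p < size c -> q < size c ->
  swap_pos (z :: map S c) p.+1 q.+1 = z :: map S (swap_pos c p q).
Proof.
move=> hp hq; apply: (@eq_from_nth _ 0) => [|i hi].
  by rewrite size_swap_pos /= !size_map size_iota.
rewrite size_swap_pos /= size_map in hi.
rewrite nth_swap_pos /= ?size_map //.
case: i hi => [|i] hi.
  by have := tauP p.+1 q.+1 0; case: (tau _ _ 0) => //=; lia.
have -> : tau p.+1 q.+1 i.+1 = (tau p q i).+1.
  by have := tauP p q i; have := tauP p.+1 q.+1 i.+1; lia.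
have hi' : i < size c by [].
have ht := tau_lt hp hq hi'.
have hs : i < size (swap_pos c p q) by rewrite size_swap_pos.
by rewrite /= (nth_map 0 0 S ht) (nth_map 0 0 S hs) nth_swap_pos.
Qed.

Lemma conf0 n u : conf n u 0 = iota 1 n.+1.
Proof. by rewrite /conf take0. Qed.

Lemma conf_D n u t : letters_ok n u -> conf n.+1 u t = rcons (conf n u t) n.+2.
Proof.
move=> hu; elim: t => [|t IH].
  by rewrite !conf0 -[in LHS](addn1 n.+1) iotaD cats1.
case: (ltnP t (size u)) => ht; last first.
  have e m : conf m u t.+1 = conf m u t by rewrite /conf !take_oversize // ltnW.
  by rewrite !e.
have hl := letter_ok hu ht.
by rewrite !confS // IH swap_rcons // size_conf //; lia.
Qed.

Lemma conf_A n u t : letters_ok n u -> conf n.+1 (map S u) t = 1 :: map S (conf n u t).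
Proof.
move=> hu; elim: t => [|t IH].
  by rewrite !conf0 (iotaD 1 1 n.+1) (iotaDl 1 1).
case: (ltnP t (size u)) => ht; last first.
  have e m v : size v = size u -> conf m v t.+1 = conf m v t.
    by move=> ev; rewrite /conf !take_oversize // ev // ltnW.
  by rewrite !e ?size_map.
have hl := letter_ok hu ht.
rewrite !confS ?size_map // IH (nth_map 0) //.
by rewrite -swap_cons ?size_conf ?prednK //; lia.
Qed.

Lemma NNS n : NN n.+1 = NN n + n.+1.
Proof. by rewrite /NN; lia. Qed.

Lemma conf_run n u v i : i <= size v -> conf n (u ++ v) (size u + i) = run (conf n u (size u)) (take i v).
Proof. by move=> _; rewrite conf_cat. Qed.

(** * Diagrams containing a full block *)

Section BlockD.
Variables (m : nat) (u v : seq nat).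
Hypothesis m0 : 0 < m.
Let w := u ++ Dw m ++ v.
Hypothesis Hr : red m w.
Let Hw : letters_ok m w. Proof. by case: Hr. Qed.
Notation M := (size u).

Lemma blockD_lt : M + m <= size w.
Proof. by rewrite !size_cat size_Dw; lia. Qed.

Lemma blockD_conf : exists c z, [/\ size c = m, conf m w M = rcons c z &
  forall i, i <= m -> conf m w (M + i) = ins z c (m - i)].
Proof.
have szc : size (conf m u M) = m.+1.
  by rewrite -(conf_catl m (Dw m ++ v) (leqnn M)) size_conf.
have ec : conf m w M = conf m u M by rewrite /w conf_catl.
case/lastP: (conf m u M) szc ec => // c z; rewrite size_rcons => -[szc] ec.
exists c, z; split=> // i hi.
have e : conf m u M = rcons c z by rewrite -ec /w conf_catl.
rewrite /w conf_run ?size_cat ?size_Dw ?(leq_trans hi) ?leq_addr //.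
rewrite take_cat size_Dw e -ins_last szc; case: ltnP => h.
  by have := @run_Dw z c i; rewrite szc => ->.
have -> : i - m = 0 by lia.
rewrite take0 cats0 -[in Dw m]szc; have := @run_Dw z c (size c) (leqnn _).
rewrite take_oversize ?size_Dw // subnn -[in ins z c m]szc => ->.
by have -> : m - i = 0 by lia.
Qed.

(** The block carries some wire z from the last to the first position. If z were smaller than m+1,
    wire m+1 would be to its left, hence already have crossed it, and the block would undo that
    crossing. *)
Lemma blockD_top : ix m w M m.+1 = m /\ ix m w (M + m) m.+1 = 0.
Proof.
have [c [z [szc e1 e2]]] := blockD_conf.
have e3 := e2 m (leqnn _); rewrite subnn in e3.
have i1 : ix m w M z = m.
  have -> : z = nth 0 (conf m w M) m by rewrite e1 nth_rcons szc ltnn eqxx.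
  by rewrite ix_nth.
have i2 : ix m w (M + m) z = 0.
  have -> : z = nth 0 (conf m w (M + m)) 0 by rewrite e3 nth_ins.
  by rewrite ix_nth.
have rz : 0 < z <= m.+1.
  by rewrite -(mem_conf Hw M) e1 mem_rcons mem_head.
suff -> : m.+1 = z by [].
have rm : 0 < m.+1 <= m.+1 by rewrite leqnn.
case: (ltngtP z m.+1) => // h; last by lia.
have hlt := blockD_lt.
have h1 := @X_ix m w Hr z m.+1 M; have h2 := @X_ix m w Hr z m.+1 (M + m).
have h3 := ix_lt Hw M rm.
have h4 : ix m w M m.+1 <> ix m w M z by move=> e; have := ix_inj Hw rm rz e; lia.
lia.
Qed.

Lemma blockD_X y : 0 < y <= m -> M <= crossing m w y m.+1 < M + m.
Proof.
move=> hy; have [e1 e2] := blockD_top; have hlt := blockD_lt.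
have ry : 0 < y <= m.+1 by lia.
have rm : 0 < m.+1 <= m.+1 by rewrite leqnn.
have h1 := @X_ix m w Hr y m.+1 M; have h2 := @X_ix m w Hr y m.+1 (M + m).
have h3 := ix_lt Hw M ry.
have h4 : ix m w (M + m) m.+1 <> ix m w (M + m) y by move=> e; have := ix_inj Hw rm ry e; lia.
lia.
Qed.

Lemma blockD_on i : i < m -> on_wire m w m.+1 (M + i).
Proof.
move=> hi; have [c [z [szc e1 e2]]] := blockD_conf.
have hlt := blockD_lt; have [e3 _] := blockD_top.
have ez : z = m.+1.
  have <- : nth 0 (conf m w M) (ix m w M m.+1) = m.+1 by apply: (nth_ix Hw); lia.
  by rewrite e3 e1 nth_rcons szc ltnn eqxx.
have el : nth 0 w (M + i) = m - i.
  by rewrite /w nth_cat ltnNge leq_addr /= addKn nth_cat size_Dw hi nth_Dw.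
rewrite /on_wire /wireR el e2 ?(ltnW hi) // nth_ins ?szc ?leq_subr // ltnn eqxx ez.
by rewrite eqxx orbT.
Qed.

(** All crossings of wire m+1 lie in the block, so before it this wire stays last and the letter m
    does not occur. *)
Lemma blockD_letters : letters_ok m.-1 u.
Proof.
have hlt := blockD_lt; have rm : 0 < m.+1 <= m.+1 by rewrite leqnn.
have off t : t < M -> ~~ on_wire m w m.+1 t.
  move=> ht; apply/negP => o; have ht' : t < size w by lia.
  have [rb nb ob eX] := other_wireP Hr ht' o.
  have := @blockD_X (other_wire m w m.+1 t); rewrite XC eX; lia.
have top t : t <= M -> ix m w t m.+1 = m.
  elim: t => [|t IH] ht; first by rewrite ix0.
  by rewrite ixS_off ?off ?IH //; lia.
apply/(all_nthP 0) => t ht; have ht' : t < size w by lia.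
have := letter_ok Hw ht'; have el : nth 0 w t = nth 0 u t by rewrite /w nth_cat ht.
have := off t ht; rewrite on_wire_ix // top ?(ltnW ht) // el; lia.
Qed.
End BlockD.

Section BlockA.
Variables (m : nat) (u v : seq nat).
Hypothesis m0 : 0 < m.
Let w := u ++ Aw m ++ v.
Hypothesis Hr : red m w.
Let Hw : letters_ok m w. Proof. by case: Hr. Qed.
Notation M := (size u).

Lemma blockA_lt : M + m <= size w.
Proof. by rewrite !size_cat size_iota; lia. Qed.

Lemma blockA_conf : exists c z, [/\ size c = m, conf m w M = z :: c &
  forall i, i <= m -> conf m w (M + i) = ins z c i].
Proof.
have szc : size (conf m u M) = m.+1.
  by rewrite -(conf_catl m (Aw m ++ v) (leqnn M)) size_conf.
have ec : conf m w M = conf m u M by rewrite /w conf_catl.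
case: (conf m u M) szc ec => // z c [szc] ec.
exists c, z; split=> // i hi.
have e : conf m u M = z :: c by rewrite -ec /w conf_catl.
rewrite /w conf_run ?size_cat ?size_iota ?(leq_trans hi) ?leq_addr //.
have e0 : z :: c = ins z c 0 by rewrite /ins take0 drop0.
rewrite take_cat size_iota e e0; case: ltnP => h.
  by have := @run_Aw z c i; rewrite szc => ->.
have -> : i - m = 0 by lia.
rewrite take0 cats0 -[in Aw m]szc; have := @run_Aw z c (size c) (leqnn _).
rewrite take_oversize ?size_iota // => ->.
by congr ins; lia.
Qed.

Lemma blockA_top : ix m w M 1 = 0 /\ ix m w (M + m) 1 = m.
Proof.
have [c [z [szc e1 e2]]] := blockA_conf.
have e3 := e2 m (leqnn _).
have i1 : ix m w M z = 0.
  have -> : z = nth 0 (conf m w M) 0 by rewrite e1.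
  by rewrite ix_nth.
have i2 : ix m w (M + m) z = m.
  have -> : z = nth 0 (conf m w (M + m)) m by rewrite e3 nth_ins ?szc // ltnn eqxx.
  by rewrite ix_nth.
have rz : 0 < z <= m.+1.
  by rewrite -(mem_conf Hw M) e1 mem_head.
suff e : 1 = z by rewrite e.
have rm : 0 < 1 <= m.+1 by [].
case: (ltngtP 1 z) => // h; last by lia.
have hlt := blockA_lt.
have h1 := @X_ix m w Hr 1 z M; have h2 := @X_ix m w Hr 1 z (M + m).
have h3 := ix_lt Hw (M + m) rm.
have h4 : ix m w M 1 <> ix m w M z by move=> e; have := ix_inj Hw rm rz e; lia.
lia.
Qed.

Lemma blockA_X y : 1 < y <= m.+1 -> M <= crossing m w 1 y < M + m.
Proof.
move=> hy; have [e1 e2] := blockA_top; have hlt := blockA_lt.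
have ry : 0 < y <= m.+1 by lia.
have rm : 0 < 1 <= m.+1 by [].
have h1 := @X_ix m w Hr 1 y M; have h2 := @X_ix m w Hr 1 y (M + m).
have h3 := ix_lt Hw (M + m) ry.
have h4 : ix m w (M + m) 1 <> ix m w (M + m) y by move=> e; have := ix_inj Hw rm ry e; lia.
lia.
Qed.

Lemma blockA_on i : i < m -> on_wire m w 1 (M + i).
Proof.
move=> hi; have [c [z [szc e1 e2]]] := blockA_conf.
have hlt := blockA_lt; have [e3 _] := blockA_top.
have ez : z = 1.
  have <- : nth 0 (conf m w M) (ix m w M 1) = 1 by apply: (nth_ix Hw); lia.
  by rewrite e3 e1.
have el : nth 0 w (M + i) = i.+1.
  by rewrite /w nth_cat ltnNge leq_addr /= addKn nth_cat size_iota hi nth_iota.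
rewrite /on_wire /wireL el e2 ?(ltnW hi) // nth_ins ?szc ?(ltnW hi) // ltnn eqxx ez.
by rewrite eqxx.
Qed.

Lemma blockA_letters : exists u', u = map S u' /\ letters_ok m.-1 u'.
Proof.
have hlt := blockA_lt; have rm : 0 < 1 <= m.+1 by [].
have off t : t < M -> ~~ on_wire m w 1 t.
  move=> ht; apply/negP => o; have ht' : t < size w by lia.
  have [rb nb ob eX] := other_wireP Hr ht' o.
  have := @blockA_X (other_wire m w 1 t); rewrite eX; lia.
have top t : t <= M -> ix m w t 1 = 0.
  elim: t => [|t IH] ht; first by rewrite ix0.
  by rewrite ixS_off ?off ?IH //; lia.
have ge2 : all (fun a => 1 < a <= m) u.
  apply/(all_nthP 0) => t ht; have ht' : t < size w by lia.
  have := letter_ok Hw ht'; have el : nth 0 w t = nth 0 u t by rewrite /w nth_cat ht.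
  have := off t ht; rewrite on_wire_ix // top ?(ltnW ht) // el; lia.
exists (map predn u); split.
  rewrite -map_comp -[LHS]map_id; apply/eq_in_map => a /(allP ge2) /andP [ha _] /=; rewrite prednK //; exact: ltnW.
by rewrite /letters_ok all_map; apply: sub_all ge2 => a /=; lia.
Qed.
End BlockA.

Lemma bottomR_D m u : 0 < m -> red m (u ++ Dw m) -> bottomR (crossing m (u ++ Dw m)) 1 m.+1.
Proof.
move=> m0; rewrite -[Dw m]cats0 => Hr c d hc hcd hd.
have h1 := @blockD_X m u [::] m0 Hr c; rewrite ltnNge; apply/negP => h.
have [rc rd] : 0 < c <= m.+1 /\ 0 < d <= m.+1 by lia.
have cd : c != d by lia.
have hX := X_lt Hr rc rd cd; have /andP [oc od] := X_on Hr rc rd cd.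
have hs : size (u ++ Dw m ++ [::]) = size u + m by rewrite cats0 size_cat size_Dw.
have := @blockD_on m u [::] m0 Hr (crossing m (u ++ Dw m ++ [::]) c d - size u).
rewrite subnKC; last by lia.
by move=> /(_ ltac:(lia)) o; have := on_two oc od cd o; lia.
Qed.

Lemma bottomL_A m u : 0 < m -> red m (u ++ Aw m) -> bottomL (crossing m (u ++ Aw m)) 1 m.+1.
Proof.
move=> m0; rewrite -[Aw m]cats0 => Hr c d hc hcd hd.
have h1 := @blockA_X m u [::] m0 Hr d; rewrite ltnNge; apply/negP => h.
have [rc rd] : 0 < c <= m.+1 /\ 0 < d <= m.+1 by lia.
have cd : c != d by lia.
have hX := X_lt Hr rc rd cd; have /andP [oc od] := X_on Hr rc rd cd.
have hs : size (u ++ Aw m ++ [::]) = size u + m by rewrite cats0 size_cat size_iota.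
have := @blockA_on m u [::] m0 Hr (crossing m (u ++ Aw m ++ [::]) c d - size u).
rewrite subnKC; last by lia.
by move=> /(_ ltac:(lia)) o; have := on_two oc od cd o; lia.
Qed.

(** A node after the block is a crossing of two other wires that lies below their crossings with
    wire m+1. *)
Lemma tail_D m u v : 0 < m -> red m (u ++ Dw m ++ v) ->
  bottomR (crossing m (u ++ Dw m ++ v)) 1 m.+1 -> v = [::].
Proof.
case: v => // x v m0; set v' := x :: v => Hr hb; exfalso.
have ht : size u + m < size (u ++ Dw m ++ v') by rewrite !size_cat size_Dw /=; lia.
have Hw : letters_ok m (u ++ Dw m ++ v') by case: Hr.
have [rL rR _] := wire_range Hw ht; have lr := ltLR Hr ht; have eX := X_LR Hr ht.
set L := wireL _ _ _ in rL lr eX; set R := wireR _ _ _ in rR lr eX.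
have h1 := @blockD_X m u v' m0 Hr L.
case: (eqVneq R m.+1) => [eR|nR]; first by rewrite eR in eX; lia.
by have := hb L R; lia.
Qed.

Lemma tail_A m u v : 0 < m -> red m (u ++ Aw m ++ v) ->
  bottomL (crossing m (u ++ Aw m ++ v)) 1 m.+1 -> v = [::].
Proof.
case: v => // x v m0; set v' := x :: v => Hr hb; exfalso.
have ht : size u + m < size (u ++ Aw m ++ v') by rewrite !size_cat size_iota /=; lia.
have Hw : letters_ok m (u ++ Aw m ++ v') by case: Hr.
have [rL rR _] := wire_range Hw ht; have lr := ltLR Hr ht; have eX := X_LR Hr ht.
set L := wireL _ _ _ in rL lr eX; set R := wireR _ _ _ in rR lr eX.
have h1 := @blockA_X m u v' m0 Hr R.
case: (eqVneq L 1) => [eL|nL]; first by rewrite eL in eX; lia.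
by have := hb L R; lia.
Qed.

(** * Deleting the wire of a final block *)

Section LiftD.
Variables (n : nat) (u v : seq nat).
Hypothesis Hu : letters_ok n u.
Let w := u ++ v.

Lemma wireL_D t : t < size u -> wireL n.+1 w t = wireL n u t.
Proof.
move=> h; have hl := letter_ok Hu h.
rewrite /wireL /w conf_catl ?(ltnW h) // conf_D // nth_cat h nth_rcons size_conf //.
by case: ltnP => //; lia.
Qed.

Lemma wireR_D t : t < size u -> wireR n.+1 w t = wireR n u t.
Proof.
move=> h; have hl := letter_ok Hu h.
rewrite /wireR /w conf_catl ?(ltnW h) // conf_D // nth_cat h nth_rcons size_conf //.
by case: ltnP => //; lia.
Qed.

Lemma on_wire_D t a : t < size u -> on_wire n.+1 w a t = on_wire n u a t.
Proof. by move=> h; rewrite /on_wire wireL_D // wireR_D. Qed.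

End LiftD.

Section LiftA.
Variables (n : nat) (u v : seq nat).
Hypothesis Hu : letters_ok n u.
Let w := map S u ++ v.

Lemma wireL_A t : t < size u -> wireL n.+1 w t = (wireL n u t).+1.
Proof.
move=> h; have hl := letter_ok Hu h.
rewrite /wireL /w conf_catl ?size_map ?(ltnW h) // conf_A // nth_cat size_map h (nth_map 0) //.
rewrite -[in LHS](@prednK (nth 0 u t)) /=; last by lia.
by rewrite (nth_map 0) // size_conf //; lia.
Qed.

Lemma wireR_A t : t < size u -> wireR n.+1 w t = (wireR n u t).+1.
Proof.
move=> h; have hl := letter_ok Hu h.
rewrite /wireR /w conf_catl ?size_map ?(ltnW h) // conf_A // nth_cat size_map h (nth_map 0) //=.
by rewrite (nth_map 0) // size_conf //; lia.
Qed.

Lemma on_wire_A t a : t < size u -> on_wire n.+1 w a.+1 t = on_wire n u a t.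
Proof. by move=> h; rewrite /on_wire wireL_A // wireR_A. Qed.

Lemma on_wire_A1 t : t < size u -> on_wire n.+1 w 1 t = false.
Proof.
move=> h; rewrite /on_wire wireL_A // wireR_A //.
by have [/andP [h1 _] /andP [h2 _] _] := wire_range Hu h; lia.
Qed.
End LiftA.

Section RedD.
Variables (n : nat) (u : seq nat).
Hypothesis Hu : letters_ok n u.
Let w := u ++ Dw n.+1.
Hypothesis Hr : red n.+1 w.

Lemma size_D : size w = size u + n.+1.
Proof. by rewrite size_cat size_Dw. Qed.

Lemma conf_blockD i : i <= n.+1 -> conf n.+1 w (size u + i) = ins n.+2 (conf n u (size u)) (n.+1 - i).
Proof.
move=> hi; have szc : size (conf n u (size u)) = n.+1 by rewrite size_conf.
rewrite /w conf_run ?size_Dw // conf_D // -ins_last -szc.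
by rewrite run_Dw ?szc.
Qed.

Lemma red_D : red n u.
Proof.
have [h1 h2 h3] := Hr; split=> //.
  by rewrite size_D NNS in h1; lia.
move: h3; rewrite size_D conf_blockD // subnn /ins take0 drop0 cat0s.
have -> : iota 1 n.+2 = iota 1 n.+1 ++ [:: n.+2] by rewrite -[in LHS](addn1 n.+1) iotaD.
by rewrite rev_cat => -[].
Qed.

Lemma X_D a b : 0 < a <= n.+1 -> 0 < b <= n.+1 -> a != b -> crossing n.+1 w a b = crossing n u a b.
Proof.
move=> ra rb ab; have hX := X_lt red_D ra rb ab; have /andP [oa ob] := X_on red_D ra rb ab.
by apply: (X_uniq Hr); rewrite ?on_wire_D // size_D; lia.
Qed.

Lemma blockD_wires i : i <= n -> wireL n.+1 w (size u + i) = i.+1 /\ wireR n.+1 w (size u + i) = n.+2.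
Proof.
move=> hi; have [_ _ h3] := red_D.
have el : nth 0 w (size u + i) = n.+1 - i.
  by rewrite /w nth_cat ltnNge leq_addr /= addKn nth_Dw.
have szc : size (conf n u (size u)) = n.+1 by rewrite size_conf.
rewrite /wireL /wireR el conf_blockD ?leqW // !nth_ins ?szc ?leq_subr // ltnn eqxx; split=> //.
rewrite h3; case: ltnP => h; last by lia.
by rewrite nth_rev size_iota ?nth_iota; lia.
Qed.
End RedD.

Section RedA.
Variables (n : nat) (u : seq nat).
Hypothesis Hu : letters_ok n u.
Let w := map S u ++ Aw n.+1.
Hypothesis Hr : red n.+1 w.

Lemma size_A : size w = size u + n.+1.
Proof. by rewrite size_cat size_map size_iota. Qed.

Lemma conf_blockA i : i <= n.+1 ->
  conf n.+1 w (size u + i) = ins 1 (map S (conf n u (size u))) i.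
Proof.
move=> hi; have szc : size (map S (conf n u (size u))) = n.+1 by rewrite size_map size_conf.
rewrite /w -{1}(size_map S u) conf_run ?size_iota // conf_A //.
have -> : 1 :: map S (conf n u (size (map S u))) = ins 1 (map S (conf n u (size u))) 0.
  by rewrite /ins take0 drop0 size_map.
by have := @run_Aw 1 (map S (conf n u (size u))) i; rewrite szc; apply.
Qed.

Lemma red_A : red n u.
Proof.
have [h1 h2 h3] := Hr; split=> //.
  by rewrite size_A NNS in h1; lia.
move: h3; rewrite size_A conf_blockA //.
have szc : size (map S (conf n u (size u))) = n.+1 by rewrite size_map size_conf.
rewrite -[in ins _ _ n.+1]szc ins_last.
have -> : rev (iota 1 n.+2) = rcons (map S (rev (iota 1 n.+1))) 1.
  by rewrite (iotaD 1 1 n.+1) (iotaDl 1 1) rev_cat cats1 map_rev.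
by move=> /rcons_inj [/(inj_map succn_inj)].
Qed.

Lemma X_A a b : 0 < a <= n.+1 -> 0 < b <= n.+1 -> a != b -> crossing n.+1 w a.+1 b.+1 = crossing n u a b.
Proof.
move=> ra rb ab; have hX := X_lt red_A ra rb ab; have /andP [oa ob] := X_on red_A ra rb ab.
by apply: (X_uniq Hr); rewrite ?on_wire_A // size_A; lia.
Qed.

Lemma blockA_wires i : i <= n ->
  wireL n.+1 w (size u + i) = 1 /\ wireR n.+1 w (size u + i) = n.+2 - i.
Proof.
move=> hi; have [_ _ h3] := red_A.
have el : nth 0 w (size u + i) = i.+1.
  by rewrite /w -(size_map S u) nth_cat ltnNge leq_addr /= addKn nth_iota.
have szc : size (map S (conf n u (size u))) = n.+1 by rewrite size_map size_conf.
rewrite /wireL /wireR el conf_blockA ?leqW // !nth_ins ?szc ?leqW // ltnn eqxx; split=> //.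
rewrite ltnNge leqnSn /= eqn_leq ltnn /= (nth_map 0) ?size_conf //.
by rewrite h3 nth_rev size_iota ?nth_iota; lia.
Qed.
End RedA.

(** The shift [e] is 0 after deleting the last wire and 1 after deleting the first, which renumbers
    the others. *)
Lemma good_ext e Y Y' m a :
  (forall c d, Y c d = Y d c) -> (forall c d, Y' c d = Y' d c) ->
  (forall x y z, a <= x <= a + m -> a <= y <= a + m -> a <= z <= a + m ->
     x != y -> x != z -> (Y' x y < Y' x z) = (Y (x + e) (y + e) < Y (x + e) (z + e))) ->
  good Y m (a + e) -> good Y' m a.
Proof.
move=> sY sY'; elim: m a => [//|m IH] a h /=.
case=> [[hb hg]|[hb hg]]; [left|right]; split.
- move=> c d h1 h2 h3; rewrite h; try lia.
  by have := hb (c + e) (d + e); have -> : a + e + m.+1 = a + m.+1 + e; [lia|apply]; lia.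
- by apply: IH hg => x y z *; apply: h; lia.
- move=> c d h1 h2 h3; rewrite sY' [X in _ < X]sY' h; try lia.
  rewrite sY [X in _ < X]sY; apply: hb; lia.
- by apply: IH; rewrite ?addSn // => x y z *; apply: h; lia.
Qed.

(** Condition (4) in a form suited to induction, with index and contraction read from one
    decomposition. *)
Fixpoint chainw (n : nat) (w : seq nat) : Prop :=
  if n is n'.+1 then exists u, [/\ letters_ok n' u, chainw n' u &
    equiv2 w (u ++ Dw n'.+1) \/ equiv2 w (map S u ++ Aw n'.+1)]
  else True.

Lemma good_cond4 n w : red n w -> good (crossing n w) n 1 -> cond4 n w.
Proof.
elim: n w => [|n IH] w Hr; first by exists [::].
case=> [[hb hg]|[hb hg]].
- have [u [h1 h2]] := @sort_D n.+1 w Hr 0 hb (leq0n _).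
  rewrite drop0 ix0 ?leqnn // in h1 h2.
  have [Hr2 hX] := equiv2_spec h1 Hr.
  have Hu : letters_ok n u.
    have [_ l _] := Hr2; rewrite /letters_ok all_cat in l; case/andP: l => l _.
    by apply/allP => a ha; have := allP l a ha; have := allP h2 a ha => /=; lia.
  have Hru := red_D Hu Hr2.
  have [|ss [s1 s2]] := IH u Hru.
    apply: (@good_ext 0 (crossing n.+1 w)) => [c d|c d|x y z rx ry rz xy xz|]; rewrite ?addn0 //;
      try exact: XC.
    by rewrite -!(X_D Hu Hr2) ?hX //; lia.
  exists (SD :: ss); split; first by rewrite /= s1.
  split; first by exists u, [::]; rewrite cats0.
  by exists u; split=> //; exists u, [::]; split; [rewrite cats0 | exact/esym/cats0].
- have [u0 [h1 h2]] := @sort_A n.+1 w Hr 0 hb (leq0n _).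
  rewrite drop0 ix0 // subn0 in h1 h2.
  have [Hr2 hX] := equiv2_spec h1 Hr.
  have Hr3 : red n.+1 (u0 ++ Aw n.+1 ++ [::]) by rewrite cats0.
  have [u [eu Hu]] := @blockA_letters n.+1 u0 [::] isT Hr3.
  rewrite eu in h1 h2 Hr2 hX.
  have Hru := red_A Hu Hr2.
  have [|ss [s1 s2]] := IH u Hru.
    apply: (@good_ext 1 (crossing n.+1 w)) => [c d|c d|x y z rx ry rz xy xz|]; rewrite ?addn1 //;
      try exact: XC.
    by rewrite -!(X_A Hu Hr2) ?hX //; lia.
  exists (SA :: ss); split; first by rewrite /= s1.
  split; first by exists (map S u), [::]; rewrite cats0.
  exists u; split=> //; exists (map S u), [::]; split; first by rewrite cats0.
  by rewrite [RHS]cats0 -map_comp map_id_in // => a.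
Qed.

(** The decomposition showing that the index is 0 need not be the one used for the contraction. The
    first yields [bottomR] or [bottomL], whose comparisons are invariant under 2-moves, and this
    forces the tail of the second to be empty. *)
Lemma cond4_chainw n w : red n w -> cond4 n w -> chainw n w.
Proof.
elim: n w => [//|n IH] w Hr [[|s ss] [//= [hs] [hi [w' [hc hg]]]]].
case: hi => u0 [v0 [h0 /size0nil ev0]]; rewrite {v0}ev0 cats0 in h0.
case: hc => u1 [v1 [h1 ew']].
have [Hr0 hX0] := equiv2_spec h0 Hr; have [Hr1 hX1] := equiv2_spec h1 Hr.
case: s hg h0 h1 ew' Hr0 hX0 Hr1 hX1 => /= hg h0 h1 ew' Hr0 hX0 Hr1 hX1.
- have hb := @bottomL_A n.+1 u0 isT Hr0.
  have ev1 : v1 = [::].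
    apply: (@tail_A n.+1 u1 v1 isT Hr1) => c d h2 h3 h4.
    rewrite (XC _ _ c) (XC _ _ 1) hX1 -?hX0; try lia.
    by rewrite (XC _ _ d) (XC _ _ d 1); apply: hb.
  rewrite ev1 cats0 in h1 ew'; rewrite ev1 in Hr1.
  have [u [eu Hu]] := @blockA_letters n.+1 u1 [::] isT Hr1.
  rewrite cats0 in Hr1; rewrite eu in h1 ew' Hr1.
  have e : w' = u by rewrite ew' cats0 -map_comp map_id_in // => a.
  have Hru := red_A Hu Hr1.
  exists u; split=> //; last by right.
  by apply: IH => //; exists ss; rewrite -e; split=> //.
- have hb := @bottomR_D n.+1 u0 isT Hr0.
  have ev1 : v1 = [::].
    apply: (@tail_D n.+1 u1 v1 isT Hr1) => c d h2 h3 h4.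
    rewrite hX1 -?hX0; try lia.
    by apply: hb.
  rewrite ev1 cats0 in h1 ew'; rewrite ev1 in Hr1.
  have Hu := @blockD_letters n.+1 u1 [::] isT Hr1.
  rewrite !cats0 in ew' Hr1.
  have Hru := red_D Hu Hr1.
  exists u1; split=> //; last by left.
  by apply: IH => //; exists ss; rewrite -ew'; split=> //.
Qed.

(** * The string cone of a word ending with a block *)

Lemma gs_straight (R : zmodType) (f : nat -> R) a j s : gs f a ((j, a) :: s) = gs f a s.
Proof. by rewrite /= eqxx add0r. Qed.

Section ConeD.
Variables (n : nat) (u : seq nat) (R : realFieldType) (f : nat -> R).
Hypothesis Hu : letters_ok n u.
Let w := u ++ Dw n.+1.
Hypothesis Hr : red n.+1 w.
Let Hru : red n u := red_D Hu Hr.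
Let Hw : letters_ok n.+1 w. Proof. by case: Hr. Qed.
Notation M := (size u).
Notation on := (on_wire n.+1 w).
Notation next := (next_node n.+1 w).

Lemma szD : size w = M + n.+1. Proof. exact: size_D. Qed.

Lemma onD_lo t x : t < M -> on x t = on_wire n u x t.
Proof. exact: on_wire_D. Qed.

Lemma onD_hi i x : i <= n -> on x (M + i) = (x == i.+1) || (x == n.+2).
Proof. by move=> hi; have [e1 e2] := blockD_wires Hu Hr hi; rewrite /on_wire e1 e2. Qed.

Lemma onD_hi' t x : M <= t < M + n.+1 -> on x t = (x == (t - M).+1) || (x == n.+2).
Proof. by move=> ht; rewrite -[in LHS](@subnKC M t) ?onD_hi //; lia. Qed.

Lemma otherD_lo t x : t < M -> other_wire n.+1 w x t = other_wire n u x t.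
Proof. by move=> h; rewrite /other_wire wireL_D // wireR_D. Qed.

Lemma otherD_hi i x : i <= n -> x = i.+1 \/ x = n.+2 ->
  other_wire n.+1 w x (M + i) = if x == n.+2 then i.+1 else n.+2.
Proof.
move=> hi hx; have [e1 e2] := blockD_wires Hu Hr hi; rewrite /other_wire e1 e2.
by case: hx => ->; do ! case: eqP => //; lia.
Qed.

Lemma nextD_up k a p : a <= k -> p <= M -> next k a p = next_node n u k a p.
Proof.
move=> hk hp; have := next_upP n u p hk; case: next_node => [j [h1 h2 h3]|h1].
  apply: next_up_some; rewrite ?onD_lo //; first by lia.
  by move=> t ht; rewrite onD_lo ?h3 //; lia.
by apply: next_up_none => // t ht; rewrite onD_lo ?h1 //; lia.
Qed.

Lemma nextD_dn k a p : k < a -> 0 < a <= n.+1 -> p < M ->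
  next k a p = if next_node n u k a p is Some j then Some j else Some (M + a.-1).
Proof.
move=> hk ha hp; have := next_dnP n u p hk; case: next_node => [j [h1 h2 h3]|h1].
  apply: next_dn_some; rewrite ?onD_lo ?szD //; try lia.
  by move=> t ht; rewrite onD_lo ?h3 //; lia.
apply: next_dn_some; rewrite ?onD_hi ?szD //; try lia.
move=> t ht; case: (ltnP t M) => h; first by rewrite onD_lo // h1 //; lia.
by rewrite onD_hi' //; lia.
Qed.

Lemma nextD_end k a : k < a -> 0 < a <= n.+1 -> next k a (M + a.-1) = None.
Proof.
move=> hk ha; apply: next_dn_none => // t; rewrite szD => ht.
by rewrite onD_hi' //; lia.
Qed.

Lemma nextD_start k : 0 < k <= n.+1 -> next k k (size w) = Some (M + k.-1).
Proof.
move=> hk; rewrite szD; apply: next_up_some; rewrite ?onD_hi //; try lia.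
by move=> t ht; rewrite onD_hi' //; lia.
Qed.

Lemma nextD_top k i : k <= n.+1 -> i <= n ->
  next k n.+2 (M + i) = if i < n then Some (M + i.+1) else None.
Proof.
move=> hk hi; case: (ltnP i n) => h.
  apply: next_dn_some; rewrite ?onD_hi ?szD //; try lia.
apply: next_dn_none; first by rewrite ltnS.
by move=> t; rewrite szD; lia.
Qed.

Lemma walkD_lift k a p s : a <= n.+1 -> 0 < a -> (if a <= k then p <= M else p < M) ->
  rig_walk n u k a p s -> rig_walk n.+1 w k a p (s ++ [:: (M + k, k.+1)]).
Proof.
elim: s a p => [|[j a'] s IH] a p ha ha0 hp /=.
  case=> ea hn; rewrite ea ltnn in ha ha0 hp hn *; split.
  - by rewrite nextD_dn // ?hn.
  - by left.
  - by move=> _; rewrite /forbidden_straight (@otherD_hi k) ?ltn_eqF //; try lia; left.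
  - by split=> //; apply: (@nextD_end k k.+1); lia.
move=> [h1 h2 h3 h4].
have hpM : p <= M by move: hp; case: ifP => // _; apply: ltnW.
have [hj oj] := next_some hpM h1.
have [rb _ _ _] := other_wireP Hru hj oj.
have ra : 0 < a' <= n.+1 by case: h2 => ->; lia.
split; rewrite ?otherD_lo //.
- case: (leqP a k) hp => hk hp; first by rewrite nextD_up.
  by rewrite nextD_dn ?h1 //; lia.
- by move=> e; have := h3 e; rewrite /forbidden_straight otherD_lo.
- by apply: IH => //; try lia; case: ifP => _ //; lia.
Qed.

(** A walk coming from above the block can use it only for one straight step on wire k+1. Switching
    from wire a > k to n+2 would force a switch to a+1 at the next node, or lead to the end of n+2;
    neither is the goal. *)
Lemma walkD_proj k a p s : 0 < a <= n.+1 -> (if a <= k then p <= M else p < M) ->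
  rig_walk n.+1 w k a p s ->
  exists s', [/\ s = s' ++ [:: (M + k, k.+1)], rig_walk n u k a p s', k <= n &
    gs f a s = gs f a s'].
Proof.
elim: s a p => [|[j a'] s IH] a p ra hp /=.
  case=> ea; rewrite ea ltnn in ra hp *; rewrite nextD_dn //.
  by case: next_node.
move=> [h1 h2 h3 h4].
have hpM : p <= M by move: hp; case: ifP => // _; apply: ltnW.
have step : next_node n u k a p = Some j -> exists s',
    [/\ (j, a') :: s = s' ++ [:: (M + k, k.+1)], rig_walk n u k a p s', k <= n &
    gs f a ((j, a') :: s) = gs f a s'].
  move=> hn; have [hj oj] := next_some hpM hn.
  have [rb _ _ _] := other_wireP Hru hj oj.
  rewrite otherD_lo // in h2.
  have ra' : 0 < a' <= n.+1 by case: h2 => ->.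
  have [|s' [e1 e2 e3 e4]] := IH a' j ra' _ h4; first by case: ifP => _ //; lia.
  exists ((j, a') :: s'); split=> //; first by rewrite e1.
    split=> // e; have := h3 e; by rewrite /forbidden_straight otherD_lo.
  by rewrite /= e4.
case: (leqP a k) hp => hk hp; first by apply: step; rewrite -nextD_up.
move: h1; rewrite nextD_dn //; case en: next_node => [j'|] [ej]; first by apply: step; rewrite en ej.
rewrite -{j}ej in h2 h3 h4 step *.
rewrite (@otherD_hi a.-1) in h2; [|by lia|by left; lia].
rewrite ltn_eqF // in h2; last by lia.
case: h2 => ea'.
  rewrite ea' in h4 *; case: s h4 {IH step} => [|[j1 a1] s] /=; last first.
    by rewrite nextD_end //; case.
  case=> ea _; exists [::]; rewrite ea in ra en *; split.
  - by [].
  - by split.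
  - by lia.
  - by rewrite /= eqxx addr0.
exfalso; rewrite {}ea' in h4; have hk' : k <= n.+1 by lia.
have e1 : a.-1 <= n by lia.
case: s h4 {IH step} => [|[j1 a1] s] /=; first by case; lia.
rewrite nextD_top //; case: (ltnP a.-1 n) => h; last by case.
case=> [[ej1]] h5 h6 h7; rewrite -{j1}ej1 in h5 h6 h7.
have eo : other_wire n.+1 w n.+2 (M + a.-1.+1) = a.+1.
  by rewrite (otherD_hi h (or_intror erefl)) eqxx; lia.
case: h5 => ea1; first by have := h6 ea1; rewrite /forbidden_straight eo; lia.
rewrite ea1 eo in h7; case: s h7 => [|[j2 a2] s] /=; first by case; lia.
have -> : M + a.-1.+1 = M + a.+1.-1 by lia.
by rewrite nextD_end //; [case | lia | lia].
Qed.

Lemma next_startD k : 0 < k <= n.+1 -> next k k (M + k.-1) = next k k M.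
Proof.
move=> hk;  rewrite [RHS]nextD_up //; have := next_upP n u M (leqnn k).
  case: next_node => [j [h1 h2 h3]|h1].
    apply: next_up_some; rewrite ?onD_lo //; first by lia.
    move=> t ht; case: (ltnP t M) => h; first by rewrite onD_lo ?h3 //; lia.
    by rewrite onD_hi' //; lia.
  apply: next_up_none => // t ht; case: (ltnP t M) => h; first by rewrite onD_lo ?h1 //; lia.
  by rewrite onD_hi' //; lia.
Qed.

Lemma rigD_lift k s : rigorous n u k s ->
  rigorous n.+1 w k ((M + k.-1, k) :: s ++ [:: (M + k, k.+1)]).
Proof.
move=> [hk hu hw]; have hn := walk_nodes Hru (leqnn M) hw.
have hk' : 0 < k <= n.+1 by lia.
have lo t : t \in map fst s -> t < M.
  by case/mapP => -[t' a] h ->; have [] := hn t' a h.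
split; first by lia.
  have n1 : M + k.-1 \notin map fst s by apply/negP => /lo; lia.
  have n2 : M + k \notin map fst s by apply/negP => /lo; lia.
  by rewrite /= map_cat mem_cat cat_uniq hu (negPf n1) /= (negPf n2) inE /=; lia.
split.
- by apply: nextD_start; lia.
- by left.
- by move=> _; rewrite /forbidden_straight otherD_hi ?ltn_eqF; try lia; left; lia.
have : rig_walk n.+1 w k k M (s ++ [:: (M + k, k.+1)]).
  by apply: walkD_lift => //; rewrite ?leqnn //; lia.
have e := next_startD hk'.
by case: (s ++ _) => [|[j a] s'] /=; rewrite e.
Qed.

(** Besides the lifts of paths of [u] there is one path for each k that leaves wire k for n+2 at its
    first node. Going straight on n+2 is forbidden, so it turns to k+1 at the next node, which gives
    one link of the chain; for k = n+1 it just runs to its end and gives the last coordinate. *)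
Lemma coneD_iff : fcone n.+1 w f <->
  [/\ forall i, i < n -> (f (M + i.+1) <= f (M + i))%R, (0 <= f (M + n))%R & fcone n u f].
Proof.
split=> [h|[h1 h2 h3] k s [hk hu hw]].
  split.
  - move=> i hi; have := h i.+1 [:: (M + i, n.+2); (M + i.+1, i.+2)].
    rewrite /= gtn_eqF; last by lia.
    rewrite ltn_eqF; last by lia.
    rewrite [X in if X then f (M + i) else _](_ : _ = true); last by lia.
    rewrite [X in if X then f (M + i.+1) else _](_ : _ = false); last by lia.
    rewrite addr0 subr_ge0; apply; split; first by lia.
      by rewrite /= inE; lia.
    split.
    + by rewrite nextD_start //; lia.
    + by right; rewrite otherD_hi; [rewrite ltn_eqF //; lia | lia | left].
    + by lia.
    split.
    + by rewrite nextD_top ?hi //; lia.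
    + by right; rewrite (@otherD_hi i.+1) ?eqxx //; right.
    + by lia.
    + by split=> //; apply: (@nextD_end i.+1 i.+2); lia.
  - have := h n.+1 [:: (M + n, n.+2)].
    rewrite /= gtn_eqF; last by lia.
    rewrite ltnSn addr0; apply; split=> //; first by lia.
    split.
    + by rewrite nextD_start //; lia.
    + by right; rewrite otherD_hi; [rewrite ltn_eqF //; lia | lia | left].
    + by lia.
    + by split=> //; rewrite nextD_top ?ltnn.
  - move=> k s hks; have hw : rig_walk n u k k M s by case: hks.
    have hk : 0 < k <= n by case: hks.
    have := h _ _ (rigD_lift hks); rewrite gs_straight.
    have [|||s' [e _ _ ->]] := @walkD_proj k k M (s ++ [:: (M + k, k.+1)]).
    + by lia.
    + by rewrite leqnn.
    + by apply: walkD_lift => //; rewrite ?leqnn //; lia.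
    + by move: e; rewrite !cats1 => /rcons_inj [->].
case: s hu hw => [|[j a'] s] hu hw; first by case: hw; lia.
case: hw; rewrite nextD_start // => -[ej]; rewrite -{j}ej in hu *.
rewrite otherD_hi; [|by lia|by left; lia].
rewrite ltn_eqF; last by lia.
case=> -> _ hw; last first.
  have ne : (n.+2 == k) = false by lia.
  have lt : (k < n.+2) by lia.
  rewrite /= ne lt; case: s hu hw => [|[j1 a1] s] hu /=.
    case=> ek _; have -> : M + k.-1 = M + n by lia.
    by rewrite addr0.
  have kn : k.-1 <= n by lia.
  have kn' : k <= n.+1 by lia.
  rewrite nextD_top //; case: (ltnP k.-1 n) => hkn; last by case.
  case=> -[ej1]; rewrite -{j1}ej1 in hu *.
  rewrite (otherD_hi hkn (or_intror erefl)) eqxx => h5 h6 h7.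
  case: h5 => ea1.
    have := h6 ea1; rewrite /forbidden_straight (otherD_hi hkn (or_intror erefl)) eqxx; lia.
  rewrite ea1 in h7 *.
  have -> : (k.-1.+2 == n.+2) = false by lia.
  have -> : (n.+2 < k.-1.+2) = false by lia.
  case: s h7 {hu} => [|[j2 a2] s] /=.
    by move=> _; rewrite addr0 subr_ge0; apply: h1.
  have e2 : next k k.-1.+2 (M + k.-1.+2.-1) = None by apply: nextD_end; lia.
  by rewrite e2; case.
rewrite gs_straight.
have e : next k k (M + k.-1) = next k k M.
  by apply: next_startD; lia.
have hw' : rig_walk n.+1 w k k M s by move: hw; case: (s) => [|[j1 a1] s1] /=; rewrite e.
have hM : if k <= k then M <= M else M < M by rewrite leqnn.
have [s' [es hs' hkn eg]] := walkD_proj hk hM hw'.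
rewrite eg; apply: h3; split=> //; first by lia.
by move: hu; rewrite es /= map_cat cat_uniq => /andP [_ /andP [-> _]].
Qed.
End ConeD.

Section ConeA.
Variables (n : nat) (u : seq nat) (R : realFieldType) (f : nat -> R).
Hypothesis Hu : letters_ok n u.
Let w := map S u ++ Aw n.+1.
Hypothesis Hr : red n.+1 w.
Let Hru : red n u := red_A Hu Hr.
Let Hw : letters_ok n.+1 w. Proof. by case: Hr. Qed.
Notation M := (size u).
Notation on := (on_wire n.+1 w).
Notation next := (next_node n.+1 w).

Lemma szA : size w = M + n.+1. Proof. exact: size_A. Qed.

Lemma onA_lo t x : t < M -> on x.+1 t = on_wire n u x t.
Proof. exact: on_wire_A. Qed.

Lemma onA_lo1 t : t < M -> on 1 t = false.
Proof. exact: on_wire_A1. Qed.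

Lemma onA_hi i x : i <= n -> on x (M + i) = (x == 1) || (x == n.+2 - i).
Proof. by move=> hi; have [e1 e2] := blockA_wires Hu Hr hi; rewrite /on_wire e1 e2. Qed.

Lemma onA_hi' t x : M <= t < M + n.+1 -> on x t = (x == 1) || (x == n.+2 - (t - M)).
Proof. by move=> ht; rewrite -[in LHS](@subnKC M t) ?onA_hi //; lia. Qed.

Lemma otherA_lo t x : t < M -> other_wire n.+1 w x.+1 t = (other_wire n u x t).+1.
Proof. by move=> h; rewrite /other_wire wireL_A // wireR_A // eqSS; case: ifP. Qed.

Lemma otherA_hi i x : i <= n -> x = 1 \/ x = n.+2 - i ->
  other_wire n.+1 w x (M + i) = if x == 1 then n.+2 - i else 1.
Proof.
by move=> hi hx; have [e1 e2] := blockA_wires Hu Hr hi; rewrite /other_wire e1 e2.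
Qed.

Lemma nextA_up k a p : a <= k -> p <= M -> next k.+1 a.+1 p = next_node n u k a p.
Proof.
move=> hk hp; have := next_upP n u p hk; case: next_node => [j [h1 h2 h3]|h1].
  apply: next_up_some; rewrite ?onA_lo //; first by lia.
  by move=> t ht; rewrite onA_lo ?h3 //; lia.
by apply: next_up_none => // t ht; rewrite onA_lo ?h1 //; lia.
Qed.

Lemma nextA_dn k a p : k < a -> 0 < a <= n.+1 -> p < M ->
  next k.+1 a.+1 p = if next_node n u k a p is Some j then Some j else Some (M + (n.+1 - a)).
Proof.
move=> hk ha hp; have := next_dnP n u p hk; case: next_node => [j [h1 h2 h3]|h1].
  apply: next_dn_some; rewrite ?onA_lo ?szA //; try lia.
  by move=> t ht; rewrite onA_lo ?h3 //; lia.
apply: next_dn_some; rewrite ?onA_hi ?szA //; try lia.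
move=> t ht; case: (ltnP t M) => h; first by rewrite onA_lo // h1 //; lia.
by rewrite onA_hi' //; lia.
Qed.

Lemma nextA_end k a : k < a -> 0 < a <= n.+1 -> next k.+1 a.+1 (M + (n.+1 - a)) = None.
Proof.
move=> hk ha; apply: next_dn_none => // t; rewrite szA => ht.
by rewrite onA_hi' //; lia.
Qed.

Lemma nextA_start k : 0 < k <= n.+1 -> next k.+1 k.+1 (size w) = Some (M + (n.+1 - k)).
Proof.
move=> hk; rewrite szA; apply: next_up_some; rewrite ?onA_hi //; try lia.
by move=> t ht; rewrite onA_hi' //; lia.
Qed.

Lemma nextA_startD k : 0 < k <= n.+1 -> next k.+1 k.+1 (M + (n.+1 - k)) = next k.+1 k.+1 M.
Proof.
move=> hk; rewrite [RHS]nextA_up //; have := next_upP n u M (leqnn k).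
case: next_node => [j [h1 h2 h3]|h1].
  apply: next_up_some; rewrite ?onA_lo //; first by lia.
  move=> t ht; case: (ltnP t M) => h; first by rewrite onA_lo ?h3 //; lia.
  by rewrite onA_hi' //; lia.
apply: next_up_none => // t ht; case: (ltnP t M) => h; first by rewrite onA_lo ?h1 //; lia.
by rewrite onA_hi' //; lia.
Qed.

Lemma nextA_one k i : 0 < k -> i <= n.+1 ->
  next k 1 (M + i) = if i is i'.+1 then Some (M + i') else None.
Proof.
move=> hk; case: i => [|i] hi.
  by rewrite addn0; apply: next_up_none => // t ht; rewrite onA_lo1.
apply: next_up_some; rewrite ?onA_hi //; try lia.
Qed.

(** From there on wire 1 crosses only wires with labels beyond k+1, whose lower ends are not the
    goal; nor is its own upper end. *)
Lemma one_up k i s : 0 < k -> i <= n.+1 -> k.+1 < n.+3 - i -> ~ rig_walk n.+1 w k 1 (M + i) s.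
Proof.
move=> hk; elim: i s => [|i IH] s hi hki.
  by case: s => [|[j a] s] /=; rewrite nextA_one //; [case; lia | case].
case: s => [|[j a] s] /=; rewrite nextA_one //; first by case.
case=> -[<-]; rewrite otherA_hi ?eqxx //; last by left.
case=> -> _; first by apply: IH; lia.
have en : next k (n.+2 - i) (M + i) = None.
  have e1 : n.+2 - i = (n.+1 - i).+1 by lia.
  have e2 : n.+1 - (n.+1 - i) = i by lia.
  have := @nextA_end k.-1 (n.+1 - i); rewrite prednK // e2 -e1.
  by apply; lia.
case: s => [|[j2 a2] s] /=; first by case; lia.
by rewrite en; case.
Qed.

Definition sh (s : seq (nat * nat)) := [seq (e.1, e.2.+1) | e <- s].

Lemma fst_sh s : map fst (sh s) = map fst s.
Proof. by rewrite /sh -map_comp; apply: eq_map. Qed.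

Lemma forbA_lo k a j : j < M ->
  forbidden_straight n.+1 w k.+1 a.+1 j = forbidden_straight n u k a j.
Proof. by move=> hj; rewrite /forbidden_straight otherA_lo // !ltnS. Qed.

Lemma walkA_lift k a p s : 0 < a <= n.+1 -> (if a <= k then p <= M else p < M) ->
  rig_walk n u k a p s -> rig_walk n.+1 w k.+1 a.+1 p (sh s ++ [:: (M + (n - k), k.+2)]).
Proof.
elim: s a p => [|[j a'] s IH] a p ha hp /=.
  case=> ea hn; rewrite ea ltnn in ha hp hn *; split.
  - by rewrite nextA_dn // hn subSS.
  - by left.
  - move=> _; rewrite /forbidden_straight (@otherA_hi (n - k)); [|lia|right; lia].
    by rewrite gtn_eqF //; lia.
  - by split=> //; have := @nextA_end k k.+1; rewrite subSS; apply; lia.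
move=> [h1 h2 h3 h4].
have hpM : p <= M by move: hp; case: ifP => // _; apply: ltnW.
have [hj oj] := next_some hpM h1.
have [rb _ _ _] := other_wireP Hru hj oj.
have ra : 0 < a' <= n.+1 by case: h2 => ->; lia.
split; rewrite ?otherA_lo ?forbA_lo //.
- case: (leqP a k) hp => hk hp; first by rewrite nextA_up.
  by rewrite nextA_dn ?h1 //; lia.
- by case: h2 => ->; [left|right].
- by case=> e; apply: h3.
- by apply: IH => //; try lia; case: ifP => _ //; lia.
Qed.

Lemma walkA_proj k a p s : 0 < a <= n.+1 -> (if a <= k then p <= M else p < M) ->
  rig_walk n.+1 w k.+1 a.+1 p s ->
  exists s', [/\ s = sh s' ++ [:: (M + (n - k), k.+2)], rig_walk n u k a p s', k <= n &
    gs f a.+1 s = gs f a s'].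
Proof.
elim: s a p => [|[j a'] s IH] a p ra hp /=.
  case=> -[ea]; rewrite ea ltnn in ra hp *; rewrite nextA_dn //.
  by case: next_node.
move=> [h1 h2 h3 h4].
have hpM : p <= M by move: hp; case: ifP => // _; apply: ltnW.
have step : next_node n u k a p = Some j -> exists s',
    [/\ (j, a') :: s = sh s' ++ [:: (M + (n - k), k.+2)], rig_walk n u k a p s', k <= n &
    gs f a.+1 ((j, a') :: s) = gs f a s'].
  move=> hn; have [hj oj] := next_some hpM hn.
  have [rb _ _ _] := other_wireP Hru hj oj.
  rewrite otherA_lo // in h2; rewrite forbA_lo // in h3.
  have [a'' ea'] : exists a'', a' = a''.+1 by case: h2 => ->; eexists.
  rewrite {a'}ea' in h2 h3 h4 *.
  have {}h2 : a'' = a \/ a'' = other_wire n u a j by case: h2 => -[->]; [left|right].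
  have ra' : 0 < a'' <= n.+1 by case: h2 => ->.
  have [|s' [e1 e2 e3 e4]] := IH a'' j ra' _ h4; first by case: ifP => _ //; lia.
  exists ((j, a'') :: s'); split=> //; first by rewrite e1.
    by split=> // e; apply: h3; rewrite e.
  by rewrite /= e4 eqSS ltnS.
case: (leqP a k) hp => hk hp; first by apply: step; rewrite -nextA_up.
move: h1; rewrite nextA_dn //; case en: next_node => [j'|] [ej]; first by apply: step; rewrite en ej.
rewrite -{j}ej in h2 h3 h4 step *.
have hi : n.+1 - a <= n by lia.
have hx : a.+1 = n.+2 - (n.+1 - a) by lia.
rewrite (otherA_hi hi (or_intror hx)) gtn_eqF // in h2; last by lia.
case: h2 => ea'.
  rewrite ea' in h4 *; case: s h4 {IH step} => [|[j1 a1] s] /=; last first.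
    by rewrite nextA_end //; case.
  case=> -[ea] _; exists [::]; rewrite ea in ra en *; split.
  - by rewrite subSS.
  - by split.
  - by lia.
  - by rewrite /= eqxx addr0.
exfalso; rewrite {}ea' in h4; apply: one_up h4; lia.
Qed.

Lemma rigA_lift k s : rigorous n u k s ->
  rigorous n.+1 w k.+1 ((M + (n.+1 - k), k.+1) :: sh s ++ [:: (M + (n - k), k.+2)]).
Proof.
move=> [hk hu hw]; have hn := walk_nodes Hru (leqnn M) hw.
have hk' : 0 < k <= n.+1 by lia.
have lo t : t \in map fst s -> t < M.
  by case/mapP => -[t' a] h ->; have [] := hn t' a h.
split; first by lia.
  have n1 : M + (n.+1 - k) \notin map fst s by apply/negP => /lo; lia.
  have n2 : M + (n - k) \notin map fst s by apply/negP => /lo; lia.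
  by rewrite /= map_cat fst_sh mem_cat cat_uniq hu (negPf n1) /= (negPf n2) inE /=; lia.
split.
- by apply: nextA_start; lia.
- by left.
- move=> _; rewrite /forbidden_straight otherA_hi; [|lia|right; lia].
  by rewrite gtn_eqF; lia.
have : rig_walk n.+1 w k.+1 k.+1 M (sh s ++ [:: (M + (n - k), k.+2)]).
  by apply: walkA_lift => //; rewrite ?leqnn //; lia.
have e := nextA_startD hk'.
by case: (sh s ++ _) => [|[j a] s'] /=; rewrite e.
Qed.

(** The additional path switches from wire k to wire 1, climbs to the next node and turns down wire
    k+1; for k = 1 it starts on wire 1 and gives the last coordinate. *)
Lemma coneA_iff : fcone n.+1 w f <->
  [/\ forall i, i < n -> (f (M + i.+1) <= f (M + i))%R, (0 <= f (M + n))%R & fcone n u f].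
Proof.
split=> [h|[h1 h2 h3] k s [hk hu hw]].
  split.
  - move=> i hi; have := h (n.+1 - i) [:: (M + i.+1, 1); (M + i, n.+2 - i)].
    rewrite /= ltn_eqF; last by lia.
    rewrite [X in if X then f (M + i.+1) else _](_ : _ = false); last by lia.
    rewrite gtn_eqF; last by lia.
    rewrite [X in if X then f (M + i) else _](_ : _ = true); last by lia.
    rewrite addr0 addrC subr_ge0; apply; split; first by lia.
      by rewrite /= inE; lia.
    have ek : n.+1 - i = (n - i).+1 by lia.
    split.
    + by rewrite ek nextA_start; [congr (Some (_ + _)); lia | lia].
    + by right; rewrite otherA_hi; [rewrite gtn_eqF //; lia | lia | right; lia].
    + by lia.
    split.
    + by rewrite nextA_one //; lia.
    + by right; rewrite otherA_hi ?eqxx //; [lia | left].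
    + by lia.
    + split; first by lia.
      have -> : n.+2 - i = (n.+1 - i).+1 by lia.
      have := @nextA_end (n - i) (n.+1 - i); rewrite ek.
      have -> : n.+1 - (n - i).+1 = i by lia.
      by apply; lia.
  - have := h 1 [:: (M + n, 2)].
    rewrite /= addr0; apply; split=> //.
    split.
    + by rewrite szA nextA_one.
    + by right; rewrite otherA_hi ?eqxx //; [lia | left].
    + by lia.
    + by split=> //; have := @nextA_end 0 1; rewrite subSS subn0; apply.
  - move=> k s hks; have hw : rig_walk n u k k M s by case: hks.
    have hk : 0 < k <= n.+1 by case: hks; lia.
    have hM : if k <= k then M <= M else M < M by rewrite leqnn.
    have := h _ _ (rigA_lift hks); rewrite gs_straight.
    have [s' [e _ _ ->]] := walkA_proj hk hM (walkA_lift hk hM hw).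
    have /(inj_map _) -> // : sh s = sh s'.
      by move: e; rewrite !cats1 => /rcons_inj [].
    by move=> [x1 x2] [y1 y2] /= [-> ->].
case: k hk hu hw => // k hk hu hw.
case: s hu hw => [|[j a'] s] hu hw; first by case: hw; lia.
case: (posnP k) => k0.
  rewrite {}k0 in hk hu hw *; case: hw; rewrite szA nextA_one // => -[ej]; rewrite -{j}ej in hu *.
  rewrite otherA_hi ?eqxx //; last by left.
  case=> -> _ hw; first by exfalso; apply: one_up hw; lia.
  have e2 : n.+2 - n = 2 by lia.
  rewrite e2 in hw *; case: s hw {hu} => [|[j1 a1] s] /=; first by rewrite addr0.
  have := @nextA_end 0 1; rewrite subSS subn0 => -> //; by case.
have hk' : 0 < k <= n.+1 by lia.
case: hw; rewrite nextA_start // => -[ej]; rewrite -{j}ej in hu *.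
rewrite otherA_hi; [|lia|right; lia].
rewrite gtn_eqF; last by lia.
case=> -> _ hw; last first.
  have ei : n.+1 - k = (n - k).+1 by lia.
  rewrite ei in hu hw *; case: s hu hw => [|[j1 a1] s] hu /=; first by case; lia.
  rewrite nextA_one; [|lia|lia] => -[[ej1]]; rewrite -{j1}ej1 in hu *.
  rewrite otherA_hi ?eqxx; [|lia|by left].
  case=> -> _ hw; first by exfalso; apply: one_up hw; lia.
  have e2 : n.+2 - (n - k) = k.+2 by lia.
  rewrite e2 in hw *.
  rewrite (_ : (1 == k.+1) = false); last by lia.
  case: s hw {hu} => [|[j2 a2] s] /=.
    by move=> _; rewrite addr0 addrC subr_ge0; apply: h1; lia.
  by have := @nextA_end k k.+1; rewrite subSS => -> //; case.
rewrite gs_straight.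
have e := nextA_startD hk'.
have hw' : rig_walk n.+1 w k.+1 k.+1 M s by move: hw; case: (s) => [|[j1 a1] s1] /=; rewrite e.
have hM : if k <= k then M <= M else M < M by rewrite leqnn.
have [s' [es hs' hkn eg]] := walkA_proj hk' hM hw'.
rewrite eg; apply: h3; split=> //; first by lia.
by move: hu; rewrite es /= map_cat fst_sh cat_uniq => /andP [_ /andP [-> _]].
Qed.
End ConeA.

(** * The map to the Gelfand-Cetlin polytope *)

Local Open Scope ring_scope.

(** * The lambda-inequalities of a word with a final block *)

Definition lcoef (R : realFieldType) (a b : nat) : R :=
  if a == b then -2 else if (a == b.+1) || (b == a.+1) then 1 else 0.

(** [lcoef] is the negated Cartan matrix of type A. The hypotheses on [G] make the neighbours
    outside the range contribute zero. *)
Lemma sum_lcoef (R : realFieldType) m a (G : nat -> R) : (0 < a <= m)%N ->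
  (1 < a)%N || (G 0%N == 0) -> (a < m)%N || (G m.+1 == 0) ->
  \sum_(1 <= c < m.+1) lcoef R a c * G c = G a.-1 + G a.+1 - 2 * G a.
Proof.
move=> ha g0 gm.
have e c : lcoef R a c * G c = (if c == a.-1 then G c else 0) + (if c == a.+1 then G c else 0)
    - 2 * (if c == a then G c else 0).
  have [e1 e2 e3 e4] : [/\ (a == c) = (c == a), (a == c.+1) = (c == a.-1),
      (c == a) ==> ~~ (c == a.-1) && ~~ (c == a.+1) & ~~ ((c == a.-1) && (c == a.+1))].
    by split; lia.
  rewrite /lcoef e1 e2; move: e3 e4.
  by case: (c == a); case: (c == a.-1); case: (c == a.+1) => //= _ _; ring.
under eq_bigr do rewrite e.
rewrite sumrB big_split /= -mulr_sumr -!big_mkcond /= !big_nat1_eq.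
have -> : (1 <= a < m.+1)%N by lia.
have -> : (if (1 <= a.-1 < m.+1)%N then G a.-1 else 0) = G a.-1.
  case: ifP => // h; have a1 : a = 1%N by lia.
  by move: g0; rewrite a1 => /eqP.
have -> : (if (1 <= a.+1 < m.+1)%N then G a.+1 else 0) = G a.+1.
  case: ifP => // h; have am : a = m by lia.
  by move: gm; rewrite am ltnn => /eqP.
by [].
Qed.

Section LamBlock.
Variables (n : nat) (u : seq nat) (R : realFieldType) (L f : nat -> R).
Hypothesis Hu : letters_ok n u.
Notation M := (size u).

Lemma lam_sum_split w (a : nat) j : size w = (M + n.+1)%N -> (j <= M)%N ->
  \sum_(j <= k < size w) lcoef R a (nth 0%N w k) * f k =
  \sum_(j <= k < M) lcoef R a (nth 0%N w k) * f k +
  \sum_(0 <= i < n.+1) lcoef R a (nth 0%N w (M + i)) * f (M + i)%N.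
Proof.
move=> -> hj; rewrite (@big_cat_nat _ _ _ M) //=; last by rewrite leq_addr.
congr (_ + _); rewrite -[X in \sum_(X <= _ < _) _]add0n big_addn addKn.
by apply: eq_bigr => i _; rewrite addnC.
Qed.

(** Block coordinates indexed by letter: in a block D the letter a has offset n+1-a. The value 0 at
    letter 0 stands for the missing neighbour; [VA] has it beyond n+1. *)
Definition UD a : R := if a is a'.+1 then f (M + (n - a'))%N else 0.
Definition VA a : R := if (a <= n.+1)%N then f (M + a.-1)%N else 0.

(** Inside the block, only letter a-1 among the neighbours of a comes later. For a node above the
    block all block coordinates come later and merely change the weight. *)
Lemma lamD_iff : rlam_ineqs (u ++ Dw n.+1) L f <->
  (forall a, (0 < a <= n.+1)%N -> UD a - UD a.-1 <= L a) /\
  rlam_ineqs u (fun a => L a + (UD a.-1 + UD a.+1 - 2 * UD a)) f.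
Proof.
set w := u ++ Dw n.+1.
have szw : size w = (M + n.+1)%N by rewrite size_cat size_Dw.
have el i : (i <= n)%N -> nth 0%N w (M + i) = (n.+1 - i)%N.
  by move=> hi; rewrite nth_cat ltnNge leq_addr /= addKn nth_Dw.
have blk i : (i <= n)%N -> \sum_((M + i).+1 <= k < M + n.+1) lam_coef R w (M + i) k * f k = UD (n - i).
  move=> hi; case: (eqVneq i n) => [->|ne].
    by rewrite subnn big_geq // addnS.
  rewrite big_ltn; last by lia.
  rewrite [X in _ + X]big_nat_cond big1 ?addr0; last first.
    move=> k /andP [hk _]; rewrite /lam_coef el // -(@subnKC M k); last by lia.
    by rewrite el; [do ! case: ifP; try (by rewrite mul0r); lia | lia].
  rewrite /lam_coef el // -addnS el; last by lia.
  have e1 : (n.+1 - i == n.+1 - i.+1)%N = false by lia.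
  have e2 : (n.+1 - i == (n.+1 - i.+1).+1)%N by lia.
  rewrite e1 e2 /=.
  have -> : (n - i = (n - i.+1).+1)%N by lia.
  by rewrite mul1r; congr f; lia.
have lo j : (j < M)%N -> \sum_(j.+1 <= k < M + n.+1) lam_coef R w j k * f k =
    \sum_(j.+1 <= k < M) lam_coef R u j k * f k +
    (UD (nth 0%N u j).-1 + UD (nth 0%N u j).+1 - 2 * UD (nth 0%N u j)).
  move=> hj; have hl := letter_ok Hu hj.
  have ej : nth 0%N w j = nth 0%N u j by rewrite nth_cat hj.
  rewrite /lam_coef -/(lcoef R _ _) ej -szw (@lam_sum_split w) //; congr (_ + _).
    by apply: eq_big_nat => k hk; rewrite nth_cat; case: ltnP => //; lia.
  have -> : \sum_(0 <= i < n.+1) lcoef R (nth 0%N u j) (nth 0%N w (M + i)) * f (M + i)%N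
      = \sum_(1 <= c < n.+2) lcoef R (nth 0%N u j) c * UD c.
    rewrite [RHS]big_nat_rev big_add1 /=; apply: eq_big_nat => i hi.
    have -> : (1 + n.+2 - i.+2 = (n - i).+1)%N by lia.
    rewrite el; last by lia.
    by rewrite /= -subSn; [congr (_ * f _); lia | lia].
  by rewrite sum_lcoef ?eqxx ?orbT //; lia.
split=> [h|[h1 h2]].
  split=> [a ha|j hj].
    have hi : (n.+1 - a <= n)%N by lia.
    have := h (M + (n.+1 - a))%N; rewrite szw => /(_ ltac:(lia)).
    rewrite blk // el //; have -> : (n.+1 - (n.+1 - a) = a)%N by lia.
    have -> : (n - (n.+1 - a) = a.-1)%N by lia.
    case: a ha hi => // a ha hi; rewrite /= subSS; lra.
  have := h j; rewrite szw => /(_ ltac:(lia)); rewrite lo // nth_cat hj; lra.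
move=> j; rewrite szw => hj; case: (ltnP j M) => hjM.
  by rewrite lo // nth_cat hjM; have := h2 j hjM; lra.
have ej : j = (M + (j - M))%N by lia.
have hi : (j - M <= n)%N by lia.
rewrite ej blk // el //.
have := h1 (n.+1 - (j - M))%N ltac:(lia).
have -> : (n.+1 - (j - M) = (n - (j - M)).+1)%N by lia.
rewrite /=; have -> : (n - (n - (j - M)) = j - M)%N by lia.
lra.
Qed.

Lemma VA_S a : (a <= n)%N -> VA a.+1 = f (M + a)%N.
Proof. by move=> ha; rewrite /VA ltnS ha. Qed.

Lemma lamA_iff : rlam_ineqs (map S u ++ Aw n.+1) L f <->
  (forall a, (0 < a <= n.+1)%N -> VA a - VA a.+1 <= L a) /\
  rlam_ineqs u (fun a => L a.+1 + (VA a + VA a.+2 - 2 * VA a.+1)) f.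
Proof.
set w := map S u ++ Aw n.+1.
have szw : size w = (M + n.+1)%N by rewrite size_cat size_map size_iota.
have el i : (i <= n)%N -> nth 0%N w (M + i) = i.+1.
  by move=> hi; rewrite nth_cat size_map ltnNge leq_addr /= addKn nth_iota.
have blk i : (i <= n)%N -> \sum_((M + i).+1 <= k < M + n.+1) lam_coef R w (M + i) k * f k = VA i.+2.
  move=> hi; case: (eqVneq i n) => [->|ne].
    by rewrite big_geq ?addnS // /VA ltnn.
  rewrite big_ltn; last by lia.
  rewrite [X in _ + X]big_nat_cond big1 ?addr0; last first.
    move=> k /andP [hk _]; rewrite /lam_coef el // -(@subnKC M k); last by lia.
    by rewrite el; [do ! case: ifP; try (by rewrite mul0r); lia | lia].
  rewrite /lam_coef el // -addnS el; last by lia.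
  have e1 : (i.+1 == i.+2)%N = false by lia.
  rewrite e1 eqxx orbT mul1r /VA (_ : (i.+1 < n.+1)%N) //; lia.
have lo j : (j < M)%N -> \sum_(j.+1 <= k < M + n.+1) lam_coef R w j k * f k =
    \sum_(j.+1 <= k < M) lam_coef R u j k * f k +
    (VA (nth 0%N u j) + VA (nth 0%N u j).+2 - 2 * VA (nth 0%N u j).+1).
  move=> hj; have hl := letter_ok Hu hj.
  have ej k : (k < M)%N -> nth 0%N w k = (nth 0%N u k).+1.
    by move=> hk; rewrite nth_cat size_map hk (nth_map 0%N).
  rewrite /lam_coef -/(lcoef R _ _) ej // -szw (@lam_sum_split w) //; congr (_ + _).
    by apply: eq_big_nat => k hk; rewrite ej ?/lcoef ?eqSS //; lia.
  have -> : \sum_(0 <= i < n.+1) lcoef R (nth 0%N u j).+1 (nth 0%N w (M + i)) * f (M + i)%N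
      = \sum_(1 <= c < n.+2) lcoef R (nth 0%N u j).+1 c * VA c.
    rewrite [RHS]big_add1 /=; apply: eq_big_nat => i hi.
    by rewrite el /VA //; have -> : (i.+1 <= n.+1)%N by lia.
  rewrite sum_lcoef //; try lia.
  by rewrite /VA ltnn eqxx orbT.
split=> [h|[h1 h2]].
  split=> [a ha|j hj].
    have := h (M + a.-1)%N; rewrite szw => /(_ ltac:(lia)).
    rewrite blk ?el; try lia.
    case: a ha => // a ha; rewrite /= -(VA_S ha); lra.
  have := h j; rewrite szw => /(_ ltac:(lia)); rewrite lo // nth_cat size_map hj (nth_map 0%N) //; lra.
move=> j; rewrite szw => hj; case: (ltnP j M) => hjM.
  by rewrite lo // nth_cat size_map hjM (nth_map 0%N) //; have := h2 j hjM; lra.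
have ej : j = (M + (j - M))%N by lia.
have hi : (j - M <= n)%N by lia.
rewrite ej blk // el //.
have := h1 (j - M).+1 ltac:(lia).
rewrite (VA_S hi); lra.
Qed.
End LamBlock.

Local Close Scope ring_scope.

Local Open Scope ring_scope.

(** * Integral affine forms and patterns with variable top row *)

Section Form.
Variable R : realFieldType.

(* The same affine form with integral coefficients, read over int and over R. *)
Inductive intform : ((nat -> int) -> (nat -> int) -> int) -> ((nat -> R) -> (nat -> R) -> R) -> Prop :=
  | form_x i : intform (fun x _ => x i) (fun x _ => x i)
  | form_X i : intform (fun _ X => X i) (fun _ X => X i)
  | form_0 : intform (fun _ _ => 0) (fun _ _ => 0)
  | form_D f g f' g' : intform f g -> intform f' g' ->
      intform (fun x X => f x X + f' x X) (fun x X => g x X + g' x X)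
  | form_N f g : intform f g -> intform (fun x X => - f x X) (fun x X => - g x X).

Lemma form_B f g f' g' : intform f g -> intform f' g' ->
  intform (fun x X => f x X - f' x X) (fun x X => g x X - g' x X).
Proof. by move=> h /form_N; apply: form_D. Qed.

Lemma form_comp f g (Fx FX : nat -> (nat -> int) -> (nat -> int) -> int)
    (Gx GX : nat -> (nat -> R) -> (nat -> R) -> R) :
  intform f g -> (forall i, intform (Fx i) (Gx i)) -> (forall i, intform (FX i) (GX i)) ->
  intform (fun x X => f (fun i => Fx i x X) (fun i => FX i x X))
       (fun x X => g (fun i => Gx i x X) (fun i => GX i x X)).
Proof.
move=> h hx hX; elim: h => [i|i||f1 g1 f2 g2 _ h1 _ h2|f1 g1 _ h1] //.
- exact: form_0.
- exact: form_D h1 h2.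
- exact: form_N h1.
Qed.

(** With an integral top row fixed, the same integers are the coefficients of both readings. *)
Lemma form_coef N f g (X : nat -> int) : intform f g ->
  exists (c : nat -> int) (h : int),
    (forall x : nat -> int, (forall i, (N <= i)%N -> x i = 0) ->
       f x X = \sum_(i < N) x i * c i + h) /\
    (forall x : nat -> R, (forall i, (N <= i)%N -> x i = 0) ->
       g x (fun a => (X a)%:~R) = \sum_(i < N) x i * (c i)%:~R + h%:~R).
Proof.
elim=> [i|i||f1 g1 f2 g2 _ [c1 [h1 [e1 e1']]] _ [c2 [h2 [e2 e2']]]|f1 g1 _ [c1 [h1 [e1 e1']]]].
- exists (fun k => (k == i)%:R), 0.
  suff aux (S : pzRingType) (x : nat -> S) : (forall i, (N <= i)%N -> x i = 0) ->
      x i = \sum_(k < N) x k * (k == i :> nat)%:R.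
    split=> x hx; rewrite addr0 [LHS](aux _ _ hx) //.
    by apply: eq_bigr => k _; congr (_ * _); case: (_ == _).
  move=> hx; case: (ltnP i N) => hi.
    rewrite (bigD1 (Ordinal hi)) //= eqxx mulr1 big1 ?addr0 // => k hk.
    by rewrite (_ : (k == i :> nat) = false) ?mulr0 //; apply: contraNF hk => /eqP e; apply/eqP/val_inj.
  by rewrite hx // big1 // => k _; rewrite (_ : (k == i :> nat) = false) ?mulr0 //; have := ltn_ord k; lia.
- exists (fun=> 0), (X i); split=> x hx; rewrite big1 ?add0r // => k _; by rewrite mulr0.
- exists (fun=> 0), 0; split=> x hx; rewrite big1 ?add0r // => k _; by rewrite mulr0.
- exists (fun k => c1 k + c2 k), (h1 + h2); split=> x hx.
    rewrite e1 // e2 // addrACA -big_split /=; congr (_ + _).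
    by apply: eq_bigr => k _; rewrite mulrDr.
  rewrite e1' // e2' // rmorphD /= addrACA -big_split /=; congr (_ + _).
  by apply: eq_bigr => k _; rewrite rmorphD mulrDr.
- exists (fun k => - c1 k), (- h1); split=> x hx.
    by rewrite e1 // opprD -sumrN; congr (_ + _); apply: eq_bigr => k _; rewrite mulrN.
  rewrite e1' // rmorphN /= opprD -sumrN; congr (_ + _).
  by apply: eq_bigr => k _; rewrite rmorphN mulrN.
Qed.

(** The top row is a parameter: deleting it leaves a pattern whose own top row consists of
    coordinates. *)
Definition gct n (X y : nat -> R) : Prop := forall k j, (1 <= j <= k)%N -> (k <= n)%N ->
  let y' k j := if k == n.+1 then X j else y (gcidx k j) in
  y' k j <= y' k.+1 j /\ y' k.+1 j.+1 <= y' k j.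

Lemma gcidx_top n a : gcidx n.+1 a = (NN n + a.-1)%N.
Proof. by rewrite /gcidx /NN /= mulnC. Qed.

Lemma NN_mono m n : (m <= n)%N -> (NN m <= NN n)%N.
Proof. by elim: n => [|n IH]; [case: m | rewrite NNS leq_eqVlt ltnS => /orP [/eqP ->|/IH]; rewrite ?NNS; lia]. Qed.

Lemma gcidx_lt n k j : (1 <= j <= k)%N -> (k <= n)%N -> (gcidx k j < NN n)%N.
Proof.
move=> hj hk; apply: leq_trans (NN_mono hk).
by case: k hj {hk} => [|k] hj; [lia | rewrite gcidx_top NNS; lia].
Qed.

Lemma gctS n (X y : nat -> R) : gct n.+1 X y <->
  (forall a, (1 <= a <= n.+1)%N -> y (NN n + a.-1)%N <= X a /\ X a.+1 <= y (NN n + a.-1)%N) /\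
  gct n (fun a => y (NN n + a.-1)%N) y.
Proof.
split=> [h|[h1 h2] k j hj hk /=].
  split=> [a ha|k j hj hk /=].
    have := h n.+1 a ha (leqnn _); rewrite /= eqxx ltn_eqF // gcidx_top //.
  have [f1 f2 f3] : [/\ (k == n.+2) = false, (k.+1 == n.+2) = false & (k == n.+1) = false].
    by split; lia.
  have := h k j hj (leqW hk); rewrite /= f1 f2 f3.
  by case: (k.+1 =P n.+1) => [ek|//]; rewrite ek !gcidx_top.
have [f1 f2] : (k == n.+2) = false /\ (k.+1 == n.+1) = (k == n) by split; lia.
case: (k =P n.+1) => [ek|nk].
  have hj' : (1 <= j <= n.+1)%N by rewrite -ek.
  by have := h1 j hj'; rewrite f1 ek eqxx gcidx_top.
have [f3 f4] : (k == n.+1) = false /\ (k.+1 == n.+2) = false by split; lia.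
have := h2 k j hj ltac:(lia); rewrite /= f1 f3 f4.
by case: (k.+1 =P n.+1) => [ek|//]; rewrite ek !gcidx_top.
Qed.

Lemma gct_ext n (X y y' : nat -> R) : (forall j, (j < NN n)%N -> y j = y' j) ->
  gct n X y -> gct n X y'.
Proof.
move=> e h k j hj hk /=; have := h k j hj hk => /=.
rewrite (_ : (k == n.+1) = false); last by lia.
rewrite -!(e (gcidx k j)) ?gcidx_lt //.
case: (k.+1 =P n.+1) => // ne; have hk1 : (k.+1 <= n)%N by lia.
by rewrite -!e //; apply: gcidx_lt => //; lia.
Qed.

(** Solvability over the integers for every integral top row stands for unimodularity and can be
    checked block by block. The forms depend on [X], since in the induction the top row is itself a
    form in the point. *)
Definition gc_map n w : Prop :=
  exists F G, [/\ forall j : nat, intform (F j) (G j),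
    forall (X y : nat -> int), exists x : nat -> int,
      (forall i, (NN n <= i)%N -> x i = 0) /\ (forall j, (j < NN n)%N -> F j x X = y j) &
    forall (X x : nat -> R),
      (fcone n w x /\ rlam_ineqs w (fun a => X a - X a.+1) x) <-> gct n X (fun j => G j x X)].

Lemma gc_map_move n w w2 : red n w -> move2 w w2 -> gc_map n w2 -> gc_map n w.
Proof.
move=> Hr hm [F [G [h1 h2 h3]]].
have [Hr2 _ [T [TK Tlt HT]]] := move2_spec hm Hr.
exists (fun j x X => F j (fun i => x (T i)) X), (fun j x X => G j (fun i => x (T i)) X); split.
- move=> j; apply: (@form_comp _ _ _ (fun i _ X => X i) _ (fun i _ X => X i) (h1 j)) => i;
    [exact: form_x | exact: form_X].
- move=> X y; have [x [e1 e2]] := h2 X y; exists (fun i => x (T i)); split=> [i hi|j hj].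
    apply: e1; rewrite leqNgt; have [<- _ _] := Hr; rewrite Tlt -leqNgt.
    by have [-> _ _] := Hr.
  rewrite -e2 //; congr F; apply: functional_extensionality => i; by rewrite TK.
- move=> X x; rewrite -h3.
  have [c1 c2] := HT R (fun a => X a - X a.+1) (fun i => x (T i)).
  have e : (fun t => x (T (T t))) = x by apply: functional_extensionality => i; rewrite TK.
  by rewrite e in c1 c2; tauto.
Qed.

Lemma gc_map_equiv n w w2 : red n w -> equiv2 w w2 -> gc_map n w2 -> gc_map n w.
Proof.
move=> Hr he; elim: he Hr => [//|x y z hm _ IH] Hr hz.
by apply: (gc_map_move Hr hm); apply: IH => //; have [] := move2_spec hm Hr.
Qed.


Lemma gct_extX n (X X' y : nat -> R) : (forall a, (0 < a)%N -> X a = X' a) ->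
  gct n X y -> gct n X' y.
Proof.
move=> e h k j hj hk /=; have := h k j hj hk => /=; rewrite !e //; by case/andP: hj.
Qed.

Lemma rlam_ext w (L L' f f' : nat -> R) : (forall a, L a = L' a) ->
  (forall j, (j < size w)%N -> f j = f' j) -> rlam_ineqs w L f -> rlam_ineqs w L' f'.
Proof.
move=> eL ef h j hj; rewrite -ef // -eL; apply: le_trans (h j hj) _.
rewrite lerD2l le_eqVlt; apply/orP; left; apply/eqP; apply: eq_big_nat => k hk.
by rewrite ef //; case/andP: hk.
Qed.

Lemma fcone_ext n w (f f' : nat -> R) : red n w -> (forall j, (j < size w)%N -> f j = f' j) ->
  fcone n w f -> fcone n w f'.
Proof.
move=> Hr ef h k s hks; have := h k s hks; congr (_ <= _); apply: eq_gs => j a hin.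
by apply: ef; case: hks => _ _ hw; have [] := walk_nodes Hr (leqnn _) hw hin.
Qed.

(** Hides the block coordinates from the forms of the shorter word, whose solutions are supported
    below [NN n]. *)
Definition trunc (S : zmodType) N (x : nat -> S) i := if (i < N)%N then x i else 0.

(** [YZ] and [YR] read the row below the top. As they depend on block coordinates only, one can
    solve for the block first and then for the shorter word with this row on top. *)
Lemma gc_map_block n u w (YZ : (nat -> int) -> (nat -> int) -> nat -> int)
    (YR : (nat -> R) -> (nat -> R) -> nat -> R) :
  red n u ->
  (forall a, intform (fun x X => YZ x X a) (fun x X => YR x X a)) ->
  (forall x x' X, (forall i, (NN n <= i)%N -> x i = x' i) -> YZ x X = YZ x' X) ->
  (forall X y : nat -> int, exists x : nat -> int,
     (forall i, (NN n.+1 <= i)%N -> x i = 0) /\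
     (forall a, (0 < a <= n.+1)%N -> YZ x X a = y a)) ->
  (forall X x : nat -> R, (fcone n.+1 w x /\ rlam_ineqs w (fun a => X a - X a.+1) x) <->
     (forall a, (0 < a <= n.+1)%N -> YR x X a <= X a /\ X a.+1 <= YR x X a) /\
     fcone n u x /\ rlam_ineqs u (fun a => YR x X a - YR x X a.+1) x) ->
  gc_map n u -> gc_map n.+1 w.
Proof.
move=> Hr fY locY srj eqv [F [G [h1 h2 h3]]].
have eM : size u = NN n by case: Hr.
exists (fun j => if (j < NN n)%N then fun x X => F j (trunc (NN n) x) (YZ x X)
          else fun x X => YZ x X (j - NN n).+1),
       (fun j => if (j < NN n)%N then fun x X => G j (trunc (NN n) x) (YR x X)
          else fun x X => YR x X (j - NN n).+1); split.
- move=> j; case: ifP => _; last exact: fY.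
  apply: (@form_comp _ _ (fun i x X => trunc (NN n) x i) (fun i x X => YZ x X i)
    (fun i x X => trunc (NN n) x i) (fun i x X => YR x X i) (h1 j)) => // i.
  by rewrite /trunc; case: (i < NN n)%N; [exact: form_x | exact: form_0].
- move=> X y; have [xb [b1 b2]] := srj X (fun a => y (NN n + a.-1)%N).
  have [x0 [c1 c2]] := h2 (YZ xb X) y.
  pose x i := if (i < NN n)%N then x0 i else xb i.
  have eY : YZ x X = YZ xb X by apply: locY => i hi; rewrite /x ltnNge hi.
  have et : trunc (NN n) x = x0.
    by apply: functional_extensionality => i; rewrite /trunc /x; case: ltnP => // /c1 ->.
  exists x; split=> [i hi|j hj].
    by rewrite /x ltnNge (leq_trans (NN_mono (leqnSn n)) hi) /= b1.
  case: ltnP => hjn; first by rewrite et eY c2.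
  by rewrite eY b2 /= ?subnKC //; rewrite NNS in hj; lia.
- move=> X x; rewrite eqv gctS.
  have tx j : (j < size u)%N -> trunc (NN n) x j = x j by rewrite /trunc eM => ->.
  have tx' j : (j < size u)%N -> x j = trunc (NN n) x j by move=> hj; rewrite tx.
  have e1 a : (0 < a)%N -> (if (NN n + a.-1 < NN n)%N
        then fun x X => G (NN n + a.-1)%N (trunc (NN n) x) (YR x X)
        else fun x X => YR x X (NN n + a.-1 - NN n).+1) x X = YR x X a.
    by move=> ha; rewrite ltnNge leq_addr /= addKn prednK.
  have e2 j : (j < NN n)%N -> (if (j < NN n)%N then fun x X => G j (trunc (NN n) x) (YR x X)
          else fun x X => YR x X (j - NN n).+1) x X = G j (trunc (NN n) x) (YR x X).
    by move=> ->.
  split=> [[k1 [k2 k3]]|[k1 k2]].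
    split; first by move=> a ha; rewrite e1; [apply: k1 | case/andP: ha].
    apply: gct_extX (fun a ha => esym (e1 a ha)) _.
    apply: gct_ext (fun j hj => esym (e2 j hj)) _.
    by apply/h3; split; [exact: fcone_ext tx' k2 | exact: rlam_ext tx' k3].
  split; first by move=> a ha; rewrite -e1; [apply: k1 | case/andP: ha].
  have := gct_extX e1 (gct_ext e2 k2).
  by case/h3 => k3 k4; split; [exact: fcone_ext tx k3 | exact: rlam_ext tx k4].
Qed.

Definition ud (S : zmodType) n (x : nat -> S) a : S :=
  if a is a'.+1 then x (NN n + (n - a'))%N else 0.
Definition va (S : zmodType) n (x : nat -> S) a : S :=
  if (a <= n.+1)%N then x (NN n + a.-1)%N else 0.

(** Write Y for the next row. The chain of the cone says Y_a <= X_a, the lambda-inequalities of the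
    block say X_(a+1) <= Y_a, and the weight left for [u] is Y_a - Y_(a+1). *)
Lemma gc_map_D n u : letters_ok n u -> red n.+1 (u ++ Dw n.+1) ->
  gc_map n u -> gc_map n.+1 (u ++ Dw n.+1).
Proof.
move=> Hu Hr; have Hru := red_D Hu Hr; have eM : size u = NN n by case: Hru.
apply: (@gc_map_block n u _ (fun x X a => X a - (ud n x a - ud n x a.-1))
  (fun x X a => X a - (ud n x a - ud n x a.-1))) => //.
- have fu a : intform (fun x _ => ud n x a) (fun x _ => ud n x a).
    by case: a => [|a]; [exact: form_0 | exact: form_x].
  by move=> a; apply: form_B (form_X a) (form_B (fu a) (fu a.-1)).
- move=> x x' X e; apply: functional_extensionality => a.
  have eu b : ud n x b = ud n x' b by case: b => //= b; rewrite e // leq_addr.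
  by rewrite !eu.
(* The equations prescribe the increments of [ud] from [ud 0 = 0], so the solution consists of
   partial sums. *)
- move=> X y; pose q a := \sum_(1 <= b < a.+1) (X b - y b).
  pose x i := if (NN n <= i < NN n.+1)%N then q (n.+1 - (i - NN n))%N else 0.
  have xq a : (a <= n.+1)%N -> ud n x a = q a.
    case: a => [_|a ha] /=; first by rewrite /q big_geq.
    rewrite /x NNS (_ : (_ && _) = true); last by lia.
    by congr q; lia.
  exists x; split=> [i hi|[//|a] ha].
    by rewrite /x (_ : (_ && _) = false) //; lia.
  rewrite !xq /=; [|lia|lia].
  by rewrite {1}/q big_nat_recr //= -/(q a) addrAC subrr add0r subKr.
- move=> X x; rewrite (coneD_iff x Hu Hr) (lamD_iff _ x Hu).
  have eU a : UD n u x a = ud n x a by case: a => //= a; rewrite eM.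
  have eL a : X a - X a.+1 + (UD n u x a.-1 + UD n u x a.+1 - 2 * UD n u x a) =
      X a - (ud n x a - ud n x a.-1) - (X a.+1 - (ud n x a.+1 - ud n x a.+1.-1)).
    by rewrite !eU /=; ring.
  split=> [[[c1 c2 c3] [l1 l2]]|[k1 [k2 k3]]].
    split; last by split=> //; apply: rlam_ext eL _ l2.
    move=> a ha; have := l1 a ha; rewrite !eU.
    have : 0 <= ud n x a - ud n x a.-1; last by lra.
    case: a ha => [//|[|a]] ha /=; rewrite -eM; first by rewrite subn0 subr0.
    rewrite subr_ge0; have -> : (n - a = (n - a.+1).+1)%N by lia.
    by apply: c1; lia.
  split; last split.
  - split=> //.
    + move=> i hi; have := k1 (n - i).+1 ltac:(lia).
      have -> : (n - i = (n - i.+1).+1)%N by lia.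
      rewrite /= -eM; have -> : (n - (n - i.+1) = i.+1)%N by lia.
      have -> : (n - (n - i.+1).+1 = i)%N by lia.
      lra.
    + by have := k1 1%N isT; rewrite /= -eM subn0; lra.
  - by move=> a ha; have := k1 a ha; rewrite !eU; lra.
  - by apply: rlam_ext k3 => // a; rewrite eL.
Qed.

(** Here the roles are exchanged: the chain says X_(a+1) <= Y_a and the lambda-inequalities of the
    block say Y_a <= X_a. *)
Lemma gc_map_A n u : letters_ok n u -> red n.+1 (map S u ++ Aw n.+1) ->
  gc_map n u -> gc_map n.+1 (map S u ++ Aw n.+1).
Proof.
move=> Hu Hr; have Hru := red_A Hu Hr; have eM : size u = NN n by case: Hru.
apply: (@gc_map_block n u _ (fun x X a => X a.+1 + (va n x a - va n x a.+1))
  (fun x X a => X a.+1 + (va n x a - va n x a.+1))) => //.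
- have fu a : intform (fun x _ => va n x a) (fun x _ => va n x a).
    by rewrite /va; case: (a <= n.+1)%N; [exact: form_x | exact: form_0].
  by move=> a; apply: form_D (form_X a.+1) (form_B (fu a) (fu a.+1)).
- move=> x x' X e; apply: functional_extensionality => a.
  have eu b : va n x b = va n x' b by rewrite /va; case: ifP => // _; rewrite e // leq_addr.
  by rewrite !eu.
- move=> X y; pose q a := \sum_(a <= b < n.+2) (y b - X b.+1).
  pose x i := if (NN n <= i < NN n.+1)%N then q (i - NN n).+1 else 0.
  have xq a : (0 < a <= n.+2)%N -> va n x a = q a.
    move=> ha; rewrite /va; case: ifP => h; last by rewrite /q big_geq //; lia.
    rewrite /x NNS (_ : (_ && _) = true); last by lia.
    by congr q; lia.
  exists x; split=> [i hi|a ha].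
    by rewrite /x (_ : (_ && _) = false) //; lia.
  rewrite !xq; [|lia|lia].
  by rewrite {1}/q big_ltn -/(q a.+1); [ring | lia].
- move=> X x; rewrite (coneA_iff x Hu Hr) (lamA_iff _ x Hu).
  have eU a : VA n u x a = va n x a by rewrite /VA /va eM.
  have eL a : X a.+1 - X a.+2 + (VA n u x a + VA n u x a.+2 - 2 * VA n u x a.+1) =
      X a.+1 + (va n x a - va n x a.+1) - (X a.+2 + (va n x a.+1 - va n x a.+2)).
    by rewrite !eU; ring.
  have vS i : (i <= n)%N -> va n x i.+1 = x (NN n + i)%N by move=> hi; rewrite /va ltnS hi.
  have v0 : va n x n.+2 = 0 by rewrite /va ltnn.
  split=> [[[c1 c2 c3] [l1 l2]]|[k1 [k2 k3]]].
    split; last by split=> //; apply: rlam_ext eL _ l2.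
    move=> a ha; have := l1 a ha; rewrite !eU.
    have : 0 <= va n x a - va n x a.+1; last by lra.
    case: a ha => [//|a] ha; rewrite vS; last by lia.
    case: (eqVneq a n) => [->|ne]; first by rewrite v0 subr0 -eM.
    by rewrite vS ?subr_ge0 -?eM; [apply: c1|]; lia.
  split; last split.
  - split=> //.
    + move=> i hi; have := k1 i.+1 ltac:(lia).
      by rewrite !vS -?eM; [lra|lia|lia].
    + by have := k1 n.+1 ltac:(lia); rewrite vS // v0 -eM; lra.
  - by move=> a ha; have := k1 a ha; rewrite !eU; lra.
  - by apply: rlam_ext k3 => // a; rewrite eL.
Qed.

Lemma chainw_gc_map n w : red n w -> chainw n w -> gc_map n w.
Proof.
elim: n w => [|n IH] w Hr.
  move=> _; exists (fun _ _ _ => 0), (fun _ _ _ => 0); split.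
  - by move=> _; apply: form_0.
  - by move=> X y; exists (fun=> 0).
  - move=> X x; have sw : size w = 0%N by case: Hr.
    split=> _; first by move=> k j; lia.
    by split=> [k s [] | j]; [lia | rewrite sw].
case=> u [Hu hc [he|he]]; have [Hr2 _] := equiv2_spec he Hr; apply: (gc_map_equiv Hr he).
  by apply: gc_map_D => //; apply: IH hc; apply: red_D Hr2.
by apply: gc_map_A => //; apply: IH hc; apply: red_A Hr2.
Qed.

End Form.

Local Close Scope ring_scope.

Local Open Scope ring_scope.

(** * From integral forms to a unimodular equivalence *)

Lemma tc_ord (R : realFieldType) m (x : 'rV[R]_m) (i : 'I_m) : tc x i = x 0 i.
Proof. by rewrite /tc valK. Qed.

Lemma tc_out (R : realFieldType) m (x : 'rV[R]_m) i : (m <= i)%N -> tc x i = 0.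
Proof. by rewrite /tc leqNgt; case: insubP => // u hu _; rewrite hu. Qed.

Section Final.
Variables (R : realFieldType) (n : nat) (w : seq nat) (lam : nat -> nat).
Hypothesis Hr : red n w.

Definition topZ a : int := \sum_(a <= i < n.+1) (lam i)%:R.

Lemma topZ_R a : (topZ a)%:~R = \sum_(a <= i < n.+1) (lam i)%:R :> R.
Proof. by rewrite /topZ rmorph_sum; apply: eq_bigr => i _; rewrite rmorph_nat. Qed.

Lemma topZ_diff a : (0 < a <= n)%N -> (topZ a)%:~R - (topZ a.+1)%:~R = (lam a)%:R :> R.
Proof. by move=> ha; rewrite !topZ_R big_ltn ?addrK //; lia. Qed.

Lemma gct_GC (x : 'rV[R]_(NN n)) : GC lam x <-> gct n (fun a => (topZ a)%:~R : R) (tc x).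
Proof.
split=> h k j hj hk; have := h k j hj hk; rewrite /gcval /=.
  by case: (k == n.+1); case: (k.+1 == n.+1); rewrite ?topZ_R.
by case: (k == n.+1); case: (k.+1 == n.+1); rewrite ?topZ_R.
Qed.

Lemma polytope_rlam (x : 'rV[R]_(NN n)) : string_polytope w lam x <->
  fcone n w (tc x) /\ rlam_ineqs w (fun a => (topZ a)%:~R - (topZ a.+1)%:~R) (tc x).
Proof.
have [sz Hw _] := Hr.
have eL j : (j < NN n)%N -> (topZ (nth 0%N w j))%:~R - (topZ (nth 0%N w j).+1)%:~R
    = (lam (nth 0%N w j))%:R :> R.
  by move=> hj; rewrite topZ_diff //; apply: (letter_ok Hw); rewrite sz.
split=> -[h1 h2]; split.
- by move=> k s hks; rewrite -sval_gs; apply: h1.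
- by move=> j; rewrite sz => hj; rewrite eL //; apply: h2.
- by move=> k s hks; rewrite sval_gs; apply: h1.
- by move=> j hj; have := h2 j; rewrite sz eL //; apply.
Qed.

Lemma unimod_of_gc_map : gc_map R n w -> unimod_equiv (@string_polytope R n w lam) (@GC R n lam).
Proof.
case=> F [G [h1 h2 h3]].
have /fin_all_exists [ch hch] (j : 'I_(NN n)) : exists ch : (nat -> int) * int,
    (forall x : nat -> int, (forall i, (NN n <= i)%N -> x i = 0) ->
       F j x topZ = \sum_(i < NN n) x i * ch.1 i + ch.2) /\
    (forall x : nat -> R, (forall i, (NN n <= i)%N -> x i = 0) ->
       G j x (fun a => (topZ a)%:~R) = \sum_(i < NN n) x i * (ch.1 i)%:~R + ch.2%:~R).
  by have [c [h hh]] := form_coef (NN n) topZ (h1 j); exists (c, h).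
pose M := \matrix_(i < NN n, j < NN n) (ch j).1 i.
pose v := \row_(j < NN n) (ch j).2.
have unitM : M \in unitmx.
  have /fin_all_exists [B hB] (k : 'I_(NN n)) : exists x : 'rV[int]_(NN n), x *m M = row k 1%:M.
    (* Adding the translation part to the target cancels it, so the solution is a preimage of a unit
       vector under the linear part. *)
    pose y (j : nat) : int := if (insub j : option 'I_(NN n)) is Some j' then (k == j' :> nat)%:R + (ch j').2 else 0.
    have [x [x0 hx]] := h2 topZ y; exists (\row_i x i); apply/rowP => j.
    have := hx j (ltn_ord j); rewrite (proj1 (hch j)) // /y valK => /addIr e.
    rewrite !mxE -[RHS]e; apply: eq_bigr => i _; by rewrite !mxE.
  have e : (\matrix_k B k) *m M = 1%:M by apply/row_matrixP => k; rewrite row_mul rowK hB.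
  by have [_] := mulmx1_unit e.
have phi (x : 'rV[R]_(NN n)) j :
    (x *m map_mx (fun z : int => z%:~R) M + map_mx (fun z : int => z%:~R) v) 0 j
    = G j (tc x) (fun a => (topZ a)%:~R).
  rewrite (proj2 (hch j)); last by move=> i; apply: tc_out.
  rewrite !mxE; congr (_ + _); apply: eq_bigr => i _; by rewrite !mxE tc_ord.
have inP (x y : 'rV[R]_(NN n)) :
    y = x *m map_mx (fun z : int => z%:~R) M + map_mx (fun z : int => z%:~R) v ->
    string_polytope w lam x <-> GC lam y.
  move=> ey; rewrite polytope_rlam h3 gct_GC.
  have e j : (j < NN n)%N -> G j (tc x) (fun a => (topZ a)%:~R) = tc y j.
    by move=> hj; rewrite -(phi x (Ordinal hj)) -ey -tc_ord.
  by split; apply: gct_ext => j hj; rewrite e.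
exists M, v; split=> // y; split=> [hy|[x [hx ey]]]; last exact: (inP x y ey).1.
have uM : map_mx (fun z : int => z%:~R) M \in @unitmx R (NN n).
  have := congr1 (map_mx (intmul (1 : R))) (mulmxV unitM).
  by rewrite map_mxM map_mx1 => /mulmx1_unit [].
pose x := (y - map_mx (fun z : int => z%:~R) v) *m invmx (map_mx (fun z : int => z%:~R) M).
have ex : y = x *m map_mx (fun z : int => z%:~R) M + map_mx (fun z : int => z%:~R) v.
  by rewrite /x mulmxKV // subrK.
by exists x; split=> //; apply/(inP x y ex).
Qed.

End Final.

Local Close Scope ring_scope.

(** * Facets of the Gelfand-Cetlin polytope *)

Local Open Scope ring_scope.
Lemma gcidx_inj k j k' j' : (1 <= j <= k)%N -> (1 <= j' <= k')%N ->
  gcidx k j = gcidx k' j' -> k = k' /\ j = j'.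
Proof.
case: k => [|k]; first by lia.
case: k' => [|k'] hj hj'; first by lia.
have lt a b i i' : (1 <= i <= a.+1)%N -> (1 <= i')%N -> (a < b)%N -> (gcidx a.+1 i < gcidx b.+1 i')%N.
  move=> hi hi' ab; rewrite !gcidx_top; have := NN_mono ab; rewrite NNS; lia.
move=> e; case: (ltngtP k k') => h.
- by have := lt k k' j j' hj (proj1 (andP hj')) h; rewrite e ltnn.
- by have := lt k' k j' j hj' (proj1 (andP hj)) h; rewrite e ltnn.
- by move: e; rewrite h !gcidx_top; lia.
Qed.

Lemma gcidx_onto n i : (i < NN n)%N -> exists k j, [/\ (1 <= j <= k)%N, (k <= n)%N & gcidx k j = i].
Proof.
elim: n => [//|n IH]; rewrite NNS => hi; case: (ltnP i (NN n)) => h.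
  by have [k [j [h1 h2 h3]]] := IH h; exists k, j; split=> //; apply: leqW.
exists n.+1, (i - NN n).+1; rewrite gcidx_top /= subnKC //; split=> //; lia.
Qed.

Lemma NN_double n : (NN n).*2 = (n * n.+1)%N.
Proof. by rewrite -[RHS]odd_double_half oddM /= andbN. Qed.

Section GCFacets.
Variables (R : realFieldType) (n : nat) (lam : nat -> nat).
Hypothesis n_gt0 : (0 < n)%N.
Hypothesis lam_gt0 : forall i, (1 <= i <= n)%N -> (0 < lam i)%N.

Definition topR a : R := \sum_(a <= i < n.+1) (lam i)%:R.

(* Row [n.+1 - d] of a pattern: the entry (k, j) divides the interval of row
   [k.+1] containing it in the ratio [th k j]; a facet has one ratio 0 or 1. *)
Fixpoint gcrow (th : nat -> nat -> R) (d j : nat) : R :=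
  if d is d'.+1 then th (n - d')%N j * gcrow th d' j + (1 - th (n - d')%N j) * gcrow th d' j.+1
  else topR j.

(** The last clause keeps neighbours apart: ratio 0 at (k, j) and ratio 1 at (k, j+1) would put both
    entries at the same entry of row k+1. *)
Definition ratio_ok (th : nat -> nat -> R) := forall k j,
  [/\ 0 <= th k j, th k j <= 1 & 0 < th k j \/ th k j.+1 < 1].

Lemma gcrow_decr th d j : ratio_ok th -> (1 <= j)%N -> (j + d <= n)%N ->
  gcrow th d j.+1 < gcrow th d j.
Proof.
move=> ok; elim: d j => [|d IH] j hj hd /=.
  rewrite /topR [X in _ < X]big_ltn; last by lia.
  by rewrite -subr_gt0 addrK ltr0n lam_gt0 //; lia.
have [a1 a2 a3] := ok (n - d)%N j; have [b1 b2 _] := ok (n - d)%N j.+1.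
have h1 := IH j hj ltac:(lia); have h2 := IH j.+1 isT ltac:(lia).
move: (th _ j) (th _ j.+1) a1 a2 a3 b1 b2 (gcrow th d j) (gcrow th d j.+1) (gcrow th d j.+2) h1 h2.
move=> s t a1 a2 a3 b1 b2 p q r h1 h2; rewrite -subr_gt0.
have -> : s * p + (1 - s) * q - (t * q + (1 - t) * r) = s * (p - q) + (1 - t) * (q - r) by ring.
have pq : 0 < p - q by lra.
have qr : 0 < q - r by lra.
case: a3 => h.
  by apply: ltr_pwDl; [apply: mulr_gt0 | apply: mulr_ge0; lra].
by apply: ltr_wpDl; [apply: mulr_ge0; lra | apply: mulr_gt0; lra].
Qed.

Definition gcgap (k j : nat) (b : bool) (x : 'rV[R]_(NN n)) : R :=
  if b then gcval lam x k.+1 j - gcval lam x k j else gcval lam x k j - gcval lam x k.+1 j.+1.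

Lemma gcval_affine k j : exists (a : 'rV[R]_(NN n)) b, forall x, gcval lam x k j = b + dotv a x.
Proof.
rewrite /gcval; case: (k == n.+1); first by exists 0; eexists => x; rewrite dotv0l addr0.
by have [u hu] := tc_dotv R (NN n) (gcidx k j); exists u, 0 => x; rewrite hu add0r.
Qed.

Lemma gcgap_affine k j b : affine (gcgap k j b).
Proof.
have [a1 [b1 h1]] := gcval_affine k j.
rewrite /gcgap; case: b.
  have [a2 [b2 h2]] := gcval_affine k.+1 j.
  exists (a1 + (-1) *: a2), (b2 - b1) => x; rewrite h1 h2 dotvDl dotvZl; ring.
have [a2 [b2 h2]] := gcval_affine k.+1 j.+1.
exists (a2 + (-1) *: a1), (b1 - b2) => x; rewrite h1 h2 dotvDl dotvZl; ring.
Qed.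

Lemma gcrow_point th : exists x : 'rV[R]_(NN n), forall k j, (1 <= j <= k)%N -> (k <= n.+1)%N ->
  gcval lam x k j = gcrow th (n.+1 - k) j.
Proof.
have ex (i : 'I_(NN n)) : exists p : nat * nat,
    [/\ (1 <= p.2 <= p.1)%N, (p.1 <= n)%N & gcidx p.1 p.2 = i].
  by have [k [j h]] := gcidx_onto (ltn_ord i); exists (k, j).
have [p hp] := fin_all_exists ex.
exists (\row_i gcrow th (n.+1 - (p i).1) (p i).2) => k j hj hk.
rewrite /gcval; case: eqP => [->|ne]; first by rewrite subnn.
have hk' : (k <= n)%N by lia.
have hi := gcidx_lt hj hk'; have [p1 p2 p3] := hp (Ordinal hi).
have [e1 e2] := gcidx_inj p1 hj p3.
by rewrite -[gcidx k j]/(val (Ordinal hi)) tc_ord mxE e1 e2.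
Qed.

Lemma gcgap_row th (x : 'rV[R]_(NN n)) k j b :
  (forall k j, (1 <= j <= k)%N -> (k <= n.+1)%N -> gcval lam x k j = gcrow th (n.+1 - k) j) ->
  (1 <= j <= k)%N -> (k <= n)%N ->
  gcgap k j b x = (if b then 1 - th k j else th k j) * (gcrow th (n - k) j - gcrow th (n - k) j.+1).
Proof.
move=> hx hj hk; rewrite /gcgap !hx; try lia.
rewrite subSS subSn //= subKn //; case: b; ring.
Qed.

(** The facets are counted on [P] itself, with the interlacing inequalities pulled back along the
    affine bijection [phi]. *)
Lemma unimod_facets (P : 'rV[R]_(NN n) -> Prop) k : unimod_equiv P (@GC R n lam) ->
  has_facets P k <-> k = (n * n.+1)%N.
Proof.
case=> M [v [uM hPQ]].
pose MR : 'M[R]_(NN n) := map_mx (fun z : int => z%:~R) M.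
pose vR : 'rV[R]_(NN n) := map_mx (fun z : int => z%:~R) v.
have uMR : MR \in unitmx.
  have := congr1 (map_mx (intmul (1 : R))) (mulmxV uM).
  by rewrite map_mxM map_mx1 => /mulmx1_unit [].
pose phi x := x *m MR + vR.
pose psi y := (y - vR) *m invmx MR.
have psiK y : phi (psi y) = y by rewrite /phi /psi mulmxKV // subrK.
have phiK x : psi (phi x) = x by rewrite /phi /psi addrK mulmxK.
have PQ x : P x <-> GC lam (phi x).
  split=> [h|/hPQ [x' [h e]]]; first by apply/hPQ; exists x.
  by rewrite -(phiK x) e phiK.
have ex (i : 'I_(NN n)) : exists p : nat * nat,
    [/\ (1 <= p.2 <= p.1)%N, (p.1 <= n)%N & gcidx p.1 p.2 = i].
  by have [k0 [j h]] := gcidx_onto (ltn_ord i); exists (k0, j).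
have [p hp] := fin_all_exists ex.
pose half : R := 1 / 2.
have half_ok : 0 < half /\ half < 1 by rewrite /half; split; lra.
(* All entries are midpoints except the one of the facet: ratio 1 makes it equal to its upper bound,
   ratio 0 to its lower bound. *)
pose thI (I : 'I_(NN n) * bool) k j : R :=
  if (k == (p I.1).1) && (j == (p I.1).2) then (if I.2 then 1 else 0) else half.
have okI I : ratio_ok (thI I).
  move=> k0 j; rewrite /thI; split; try by case: ifP => _; [case: (I.2)|]; lra.
  case: ifP => [/andP [/eqP -> /eqP ->]|_]; last by left; lra.
  by right; rewrite eqxx gtn_eqF //=; lra.
have okh : ratio_ok (fun _ _ => half) by move=> k0 j; split; [lra | lra | left; lra].
have pos th x i b : ratio_ok th ->
    (forall k j, (1 <= j <= k)%N -> (k <= n.+1)%N -> gcval lam x k j = gcrow th (n.+1 - k) j) ->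
    0 < (if b then 1 - th (p i).1 (p i).2 else th (p i).1 (p i).2) ->
    0 < gcgap (p i).1 (p i).2 b x.
  move=> ok hx h; have [p1 p2 p3] := hp i; rewrite (gcgap_row _ hx) //.
  by rewrite mulr_gt0 // subr_gt0 gcrow_decr //; lia.
have [xh hxh] := gcrow_point (fun _ _ => half).
have [z hz] := fin_all_exists (fun I => gcrow_point (thI I)).
have := @polyhedron_has_facets R (NN n) ('I_(NN n) * bool)%type
  (fun I x => gcgap (p I.1).1 (p I.1).2 I.2 (phi x)) P (psi xh) (fun I => psi (z I)).
have -> : #|{: 'I_(NN n) * bool}| = (n * n.+1)%N.
  by rewrite card_prod card_ord card_bool muln2 NN_double.
apply.
- by rewrite /NN; case: n n_gt0 => // m _; rewrite mulSn; lia.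
- move=> [i b]; have [a [c h]] := gcgap_affine (p i).1 (p i).2 b.
  exists (a *m MR^T), (c - dotv a vR) => x.
  rewrite /= h /phi dotvDr !dotvE trmx_mul trmxK !mulmxA; ring.
- move=> x; rewrite PQ; split=> [h [i b]|h k0 j hj hk0] /=.
    have [p1 p2 _] := hp i; have h' : GC lam (phi x) := h; have [h1 h2] := h' _ _ p1 p2.
    by rewrite /gcgap; case: b; rewrite subr_ge0.
  have hi := gcidx_lt hj hk0; have [p1 p2 p3] := hp (Ordinal hi).
  have [e1 e2] := gcidx_inj p1 hj p3.
  have := h (Ordinal hi, true); have := h (Ordinal hi, false).
  by rewrite /= e1 e2 /gcgap !subr_ge0.
- move=> [i b] /=; rewrite psiK; apply: (pos _ _ _ _ okh hxh).
  by case: b; lra.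
- move=> [i b] /=; rewrite psiK; have [p1 p2 p3] := hp i.
  rewrite (gcgap_row _ (hz (i, b))) // /thI /= !eqxx /=.
  by case: b; rewrite ?subrr mul0r.
- move=> [i b] [i' b'] ne /=; rewrite psiK; apply: (pos _ _ _ _ (okI (i, b)) (hz (i, b))).
  rewrite /thI /=; case: (boolP (((p i').1 == (p i).1) && ((p i').2 == (p i).2))) =>
    [/andP [/eqP e1 /eqP e2]|_]; last by case: b' {ne}; lra.
  have ei : i' = i.
    by apply: val_inj => /=; have [_ _ <-] := hp i'; have [_ _ <-] := hp i; rewrite e1 e2.
  by move: ne; rewrite ei xpair_eqE eqxx /=; case: b; case: b' => //= _; lra.
Qed.
End GCFacets.

(** * Reduced words as permutations and as diagrams *)

Lemma conf_perm_word n w : letters_ok n w -> forall i, (i <= n)%N ->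
  nth 0%N (conf n w (size w)) i
  = (nat_of_ord ((foldr (fun a p => (sgen n a * p)%g) 1%g w)^-1%g (inord i))).+1.
Proof.
(* A new last letter multiplies the product on the right, so in the inverse it acts first, on
   positions, as [swap_pos] does. *)
elim/last_ind: w => [_ i hi|w a IH].
  by rewrite /= invg1 perm1 inordK // conf0 nth_iota.
rewrite /letters_ok all_rcons => /andP [/= ha hw] i hi.
have -> : foldr (fun a p => (sgen n a * p)%g) 1%g (rcons w a)
    = ((foldr (fun a p => (sgen n a * p)%g) 1%g w) * sgen n a)%g.
  elim: (w) => [|b s IHs] /=; first by rewrite mulg1 mul1g.
  by rewrite IHs mulgA.
rewrite invMg permM size_rcons confS ?size_rcons // -cats1 conf_catl // nth_cat ltnn subnn /=.
rewrite nth_swap_pos ?size_conf //; try lia.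
rewrite IH //; last by have := tauP a.-1 a i; lia.
congr (nat_of_ord _).+1; congr (_ _); rewrite /sgen tpermV.
have inj x y : (x <= n)%N -> (y <= n)%N -> (inord x == inord y :> 'I_n.+1) = (x == y).
  by move=> hx hy; rewrite -val_eqE /= !inordK.
rewrite permE /= !inj //; try lia.
rewrite /tau; by do ! case: eqP.
Qed.

Lemma reduced_w0_red n w : reduced_w0 n w -> red n w.
Proof.
move=> [h1 h2 h3]; split=> //; apply: (@eq_from_nth _ 0%N).
  by rewrite size_conf // size_rev size_iota.
move=> i; rewrite size_conf // ltnS => hi.
rewrite conf_perm_word // h3.
have -> : ((w0perm n)^-1%g (inord i)) = rev_ord (inord i).
  by apply: (@perm_inj _ (w0perm n)); rewrite permKV permE rev_ordK.
have -> : nat_of_ord (rev_ord (inord i : 'I_n.+1)) = (n - i)%N by rewrite /= inordK // subSS.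
by rewrite nth_rev ?size_iota // nth_iota; lia.
Qed.

Local Close Scope ring_scope.

Theorem theoremA (R : realFieldType) (n : nat) (w : seq nat) (lam : nat -> nat) :
  (1 <= n)%N -> reduced_w0 n w -> (forall i, (1 <= i <= n)%N -> (0 < lam i)%N) ->
  [/\ unimod_equiv (@string_polytope R n w lam) (@GC R n lam) <->
        has_facets (@string_polytope R n w lam) (n * n.+1),
      has_facets (@string_polytope R n w lam) (n * n.+1) <->
        simplicial (@string_cone R n w) &
      simplicial (@string_cone R n w) <-> cond4 n w].
Proof.
move=> n0 /reduced_w0_red Hr lam0.
have [G [uG hG]] := gp_enum Hr.
have i12 : unimod_equiv (@string_polytope R n w lam) (@GC R n lam) ->
    has_facets (@string_polytope R n w lam) (n * n.+1).
  by move=> h; apply/(unimod_facets n0 lam0 _ h).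
have i23 : has_facets (@string_polytope R n w lam) (n * n.+1) <->
    simplicial (@string_cone R n w).
  (* Since n(n+1) is twice N, both sides say that there are N rigorous paths. *)
  rewrite /simplicial (polytope_facets R Hr lam0 uG hG n0) (cone_facets R Hr uG hG n0).
  by have := NN_double n; lia.
have i34 : simplicial (@string_cone R n w) -> cond4 n w.
  move=> /(cone_facets R Hr uG hG n0) e; apply: good_cond4 => //.
  apply: (good_all Hr) => //; apply: (peaks_exhaust Hr uG hG).
  by rewrite -e; case: Hr.
have i41 : cond4 n w -> unimod_equiv (@string_polytope R n w lam) (@GC R n lam).
  by move=> h; apply/(unimod_of_gc_map _ Hr)/(chainw_gc_map R Hr)/(cond4_chainw Hr).
by split; [split=> // h; apply/i41/i34/i23 | exact: i23 | split=> // h; apply/i23/i12/i41].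
Qed.
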